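(* Let $H\in(\frac12,1)$, $T>0$, and let $Z$ be the Rosenblatt process on $[0,T]$ with parameter $H$, built on a Brownian motion $B$. Let $g\in L^2(\Omega;\mathcal H)$ be such that $g\in\mathbb L^{2,2}$ and $$\mathbf E\int_0^T\int_0^T\|D_{x_1,x_2}g\|_{\mathcal H}^2\,dx_1dx_2<\infty.$$ Then $g$ is Skorohod integrable with respect to $Z$ and $$\mathbf E\left|\int_0^T g_s\,\delta Z(s)\right|^2\le C\left[\mathbf E\|g\|_{\mathcal H}^2+\mathbf E\int_0^T\int_0^T\|D_{x_1,x_2}g\|_{\mathcal H}^2\,dx_1dx_2\right],$$ where $C$ is a constant not depending on $g$.
   Context: Let $H'=\frac{H+1}{2}$, $d(H)=\frac{1}{H+1}\left(\frac{H}{2(2H-1)}\right)^{-1/2}$, and for $h\in(\frac12,1)$, $0<y<u$, $\frac{\partial K^{h}}{\partial u}(u,y)=c_h\,y^{\frac12-h}u^{h-\frac12}(u-y)^{h-\frac32}$ with $c_h=\left(\frac{h(2h-1)}{\beta(2-2h,h-\frac12)}\right)^{1/2}$. With $B$ a standard Brownian motion on $[0,T]$, $Z(t)=d(H)\int_0^t\int_0^t\big[\int_{y_1\vee y_2}^t \frac{\partial K^{H'}}{\partial u}(u,y_1)\frac{\partial K^{H'}}{\partial u}(u,y_2)du\big]dB(y_1)dB(y_2)$ (double Wiener-Itô integral). For $f$ on $[0,T]$, $I(f)(y_1,y_2)=d(H)\int_{y_1\vee y_2}^T f(u)\frac{\partial K^{H'}}{\partial u}(u,y_1)\frac{\partial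 K^{H'}}{\partial u}(u,y_2)\,du$, and $\mathcal H$ is the set of functions $f$ with $$\|f\|_{\mathcal H}^2:=2\int_0^T\int_0^T I(f)(y_1,y_2)^2dy_1dy_2=H(2H-1)\int_0^T\int_0^T f(u)f(v)|u-v|^{2H-2}du\,dv<\infty.$$ Malliavin calculus is with respect to $B$: $D$ is the Malliavin derivative, $D_{x_1,x_2}$ the second-order derivative, $\mathbb D^{k,p}$ the closure of smooth cylindrical variables under $\|F\|_{k,p}^p=\mathbf E|F|^p+\sum_{j=1}^k\mathbf E\|D^{(j)}F\|_{L^2([0,T]^j)}^p$, and $\mathbb L^{k,p}=L^p([0,T];\mathbb D^{k,p})$. $\delta^{(2)}$ is the double Skorohod integral with respect to $B$, i.e. the adjoint of $D^{(2)}$. Skorohod integral with respect to $Z$: a square integrable process $g$ is Skorohod integrable with respect to $Z$ if $I(g)\in\mathrm{Dom}\,\delta^{(2)}$, and then $\int_0^T g_s\,\delta Z(s):=\delta^{(2)}(I(g))$. *)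

(* Defs.v *)
From HB Require Import structures.
From mathcomp Require Import all_boot all_order all_algebra.
From mathcomp Require Import all_classical all_reals all_analysis measurable_realfun.
Set Implicit Arguments.
Unset Strict Implicit.
Unset Printing Implicit Defensive.
Import Order.TTheory GRing.Theory Num.Theory.
Import numFieldNormedType.Exports.
Local Open Scope classical_set_scope.
Local Open Scope ring_scope.

(* Processes and random fields are curried, parameters first and the sample
   point last.  Kernels obtained by integration take values in \bar R: the
   integral of a function whose positive and negative parts both have infinite
   integral is -oo, so that a kernel which is ill defined on a non-null set is
   never square integrable. *)

(* Library's [beta_fun] only covers natural parameters. *)
Definition Beta (R : realType) (a b : R) : R :=
  \int[lebesgue_measure]_(x in `[0%R, 1%R])
    (x `^ (a - 1) * (1 - x) `^ (b - 1)).

Definition c_const (R : realType) (h : R) : R :=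
  (h * (2 * h - 1) / Beta (2 - 2 * h) (h - 2^-1)) `^ (2^-1).

Definition dK (R : realType) (h u y : R) : R :=
  c_const h * y `^ (2^-1 - h) * u `^ (h - 2^-1) * (u - y) `^ (h - 3 / 2).

Definition d_const (R : realType) (H : R) : R :=
  (H + 1)^-1 * (H / (2 * (2 * H - 1))) `^ (- 2^-1).

(* For y1 or y2 greater than t the interval of integration is empty and the
   kernel vanishes. *)
Definition I_kernel (R : realType) (H t : R) (f : R -> R) (y1 y2 : R) : \bar R :=
  ((d_const H)%:E *
   \int[lebesgue_measure]_(u in `[Num.max y1 y2, t])
     (f u * dK ((H + 1) / 2) u y1 * dK ((H + 1) / 2) u y2)%:E)%E.

Definition normH2 (R : realType) (H T : R) (f : R -> R) : \bar R :=
  (2%:E * \int[lebesgue_measure]_(y1 in `[0%R, T])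
            \int[lebesgue_measure]_(y2 in `[0%R, T]) I_kernel H T f y1 y2 ^+ 2)%E.

Definition subdivision (R : realType) (T : R) (m : nat) (t : nat -> R) : Prop :=
  [/\ 0 <= t 0%N, t m <= T & forall i, (i < m)%N -> t i <= t i.+1].

Definition brownian_motion (R : realType) d (Omega : measurableType d)
    (P : probability Omega R) (T : R) (B : R -> Omega -> R) : Prop :=
  [/\ forall t, 0 <= t <= T -> measurable_fun setT (B t),
      {ae P, forall w, B 0 w = 0},
      {ae P, forall w, {within `[0, T], continuous (fun t => B t w)}},
      forall s t (A : set R), 0 <= s -> s < t -> t <= T -> measurable A ->
        P [set w | A (B t w - B s w)] = normal_prob 0 (Num.sqrt (t - s)) A &
      forall m (t : nat -> R) (A : nat -> set R), subdivision T m t ->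
        (forall i, measurable (A i)) ->
        P [set w | forall i, (i < m)%N -> A i (B (t i.+1) w - B (t i) w)] =
        (\prod_(i < m) P [set w | A i (B (t i.+1) w - B (t i) w)%R])%E ].

Definition sq_integrable (R : realType) d (Omega : measurableType d)
    (P : probability Omega R) (X : Omega -> R) : Prop :=
  measurable_fun setT X /\ (\int[P]_w (X w ^+ 2)%:E < +oo)%E.

Definition wiener_integral (R : realType) d (Omega : measurableType d)
    (P : probability Omega R) (T : R) (B : R -> Omega -> R)
    (phi : R -> R) (X : Omega -> R) : Prop :=
  [/\ measurable_fun `[0, T] phi,
      (\int[lebesgue_measure]_(x in `[0%R, T]) (phi x ^+ 2)%:E < +oo)%E,
      sq_integrable P X &
      exists (m : nat -> nat) (t a : nat -> nat -> R),
      [/\ forall n, subdivision T (m n) (t n),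
          (fun n => \int[lebesgue_measure]_(x in `[0%R, T])
             ((\sum_(i < m n) a n i * \1_(`]t n i, t n i.+1]) x - phi x) ^+ 2)%:E)%E
             @ \oo --> 0%E &
          (fun n => \int[P]_w
             ((\sum_(i < m n) a n i * (B (t n i.+1) w - B (t n i) w) - X w) ^+ 2)%:E)%E
             @ \oo --> 0%E ] ].

(* The approximating step kernels vanish on the diagonal blocks. *)
Definition double_wiener_integral (R : realType) d (Omega : measurableType d)
    (P : probability Omega R) (T : R) (B : R -> Omega -> R)
    (k : R -> R -> \bar R) (X : Omega -> R) : Prop :=
  [/\ measurable_fun (`[0, T] `*` `[0, T]) ((fun y => k y.1 y.2) : R * R -> \bar R),
      (\int[lebesgue_measure]_(x in `[0%R, T])
         \int[lebesgue_measure]_(y in `[0%R, T]) k x y ^+ 2 < +oo)%E,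
      sq_integrable P X &
      exists (m : nat -> nat) (t : nat -> nat -> R) (a : nat -> nat -> nat -> R),
      [/\ forall n, subdivision T (m n) (t n),
          (fun n => \int[lebesgue_measure]_(x in `[0%R, T])
             \int[lebesgue_measure]_(y in `[0%R, T])
             ((\sum_(i < m n) \sum_(j < m n | j != i)
                 a n i j * \1_(`]t n i, t n i.+1]) x
                         * \1_(`]t n j, t n j.+1]) y)%:E - k x y) ^+ 2)%E
             @ \oo --> 0%E &
          (fun n => \int[P]_w
             ((\sum_(i < m n) \sum_(j < m n | j != i)
                 a n i j * (B (t n i.+1) w - B (t n i) w)
                         * (B (t n j.+1) w - B (t n j) w) - X w) ^+ 2)%:E)%E
             @ \oo --> 0%E ] ].

Definition rosenblatt_process (R : realType) d (Omega : measurableType d)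
    (P : probability Omega R) (H T : R) (B Z : R -> Omega -> R) : Prop :=
  forall t, 0 <= t <= T ->
    double_wiener_integral P T B (I_kernel H t (fun=> 1)) (Z t).

Definition partials (R : realType) (n : nat) (s : seq 'I_n.+1)
    (f : 'rV[R]_n.+1 -> R) : 'rV[R]_n.+1 -> R :=
  foldr (fun i h => 'D_(delta_mx ord0 i) h) f s.

(* Functions of class C^oo all of whose partial derivatives have polynomial
   growth. *)
Definition smooth_poly_growth (R : realType) (n : nat)
    (f : 'rV[R]_n.+1 -> R) : Prop :=
  forall s : seq 'I_n.+1,
    (forall x, differentiable (partials s f) x) /\
    exists (c : R) (k : nat), forall x, `|partials s f x| <= c * (1 + `|x| ^+ k).

Definition smooth_cylindrical (R : realType) d (Omega : measurableType d)
    (P : probability Omega R) (T : R) (B : R -> Omega -> R)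
    (F : Omega -> R) (DF : R -> Omega -> R) (D2F : R -> R -> Omega -> R) : Prop :=
  exists (n : nat) (phi : 'I_n.+1 -> R -> R) (W : 'I_n.+1 -> Omega -> R)
    (f : 'rV[R]_n.+1 -> R),
  [/\ forall i, wiener_integral P T B (phi i) (W i),
      smooth_poly_growth f,
      forall w, F w = f (\row_i W i w),
      forall x w,
        DF x w = \sum_i partials [:: i] f (\row_i W i w) * phi i x &
      forall x y w,
        D2F x y w = \sum_i \sum_j
          partials [:: i; j] f (\row_i W i w) * phi i x * phi j y ].

(* F is in D^{2,2} with first and second derivatives DF and D2F: closure of the
   graph of (D, D^(2)) on smooth cylindrical variables for || . ||_{2,2}. *)
Definition malliavin22 (R : realType) d (Omega : measurableType d)
    (P : probability Omega R) (T : R) (B : R -> Omega -> R)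
    (F : Omega -> R) (DF : R -> Omega -> R) (D2F : R -> R -> Omega -> R) : Prop :=
  [/\ measurable_fun setT F,
      measurable_fun (`[0, T] `*` setT) (fun z : R * Omega => DF z.1 z.2),
      measurable_fun (`[0, T] `*` `[0, T] `*` setT)
        (fun z : R * R * Omega => D2F z.1.1 z.1.2 z.2) &
      exists (Fn : nat -> Omega -> R) (DFn : nat -> R -> Omega -> R)
        (D2Fn : nat -> R -> R -> Omega -> R),
      [/\ forall n, smooth_cylindrical P T B (Fn n) (DFn n) (D2Fn n),
          (fun n => \int[P]_w ((Fn n w - F w) ^+ 2)%:E)%E @ \oo --> 0%E,
          (fun n => \int[P]_w \int[lebesgue_measure]_(x in `[0%R, T])
             ((DFn n x w - DF x w) ^+ 2)%:E)%E @ \oo --> 0%E &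
          (fun n => \int[P]_w \int[lebesgue_measure]_(x in `[0%R, T])
             \int[lebesgue_measure]_(y in `[0%R, T])
             ((D2Fn n x y w - D2F x y w) ^+ 2)%:E)%E @ \oo --> 0%E ] ].

Definition norm22_sq (R : realType) d (Omega : measurableType d)
    (P : probability Omega R) (T : R)
    (F : Omega -> R) (DF : R -> Omega -> R) (D2F : R -> R -> Omega -> R) : \bar R :=
  (\int[P]_w (F w ^+ 2)%:E
   + \int[P]_w \int[lebesgue_measure]_(x in `[0%R, T]) (DF x w ^+ 2)%:E
   + \int[P]_w \int[lebesgue_measure]_(x in `[0%R, T])
       \int[lebesgue_measure]_(y in `[0%R, T]) (D2F x y w ^+ 2)%:E)%E.

Definition process_measurable (R : realType) d (Omega : measurableType d)
    (T : R) (g : R -> Omega -> R) : Prop :=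
  measurable_fun (`[0, T] `*` setT) (fun z : R * Omega => g z.1 z.2).

(* g is in L^2([0,T]; D^{2,2}), with jointly measurable versions
   Dg s x = D_x g_s and D2g s x y = D_{x,y} g_s of its derivatives. *)
Definition L22 (R : realType) d (Omega : measurableType d)
    (P : probability Omega R) (T : R) (B : R -> Omega -> R)
    (g : R -> Omega -> R) (Dg : R -> R -> Omega -> R)
    (D2g : R -> R -> R -> Omega -> R) : Prop :=
  [/\ process_measurable T g,
      measurable_fun (`[0, T] `*` `[0, T] `*` setT)
        (fun z : R * R * Omega => Dg z.1.1 z.1.2 z.2),
      measurable_fun (`[0, T] `*` `[0, T] `*` `[0, T] `*` setT)
        (fun z : R * R * R * Omega => D2g z.1.1.1 z.1.1.2 z.1.2 z.2),
      {ae lebesgue_measure, forall s : R, 0 <= s <= T ->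
         malliavin22 P T B (g s) (Dg s) (D2g s)} &
      (\int[lebesgue_measure]_(s in `[0%R, T])
         norm22_sq P T (g s) (Dg s) (D2g s) < +oo)%E ].

Definition L2H (R : realType) d (Omega : measurableType d)
    (P : probability Omega R) (H T : R) (g : R -> Omega -> R) : Prop :=
  process_measurable T g /\
  (\int[P]_w normH2 H T (fun s => g s w) < +oo)%E.

Definition brownian_sigma_algebra (R : realType) d (Omega : measurableType d)
    (T : R) (B : R -> Omega -> R) : set (set Omega) :=
  <<s \bigcup_(t in `[0, T]) preimage_set_system setT (B t) measurable >>.

(* The double Skorohod integral as the adjoint of D^(2), viewed as an operator
   from L^2 of the (P-completed) sigma-algebra of B to
   L^2([0,T]^2 x Omega): u is in its domain and X is its value at u.  *)
Definition delta2 (R : realType) d (Omega : measurableType d)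
    (P : probability Omega R) (T : R) (B : R -> Omega -> R)
    (u : R -> R -> Omega -> \bar R) (X : Omega -> R) : Prop :=
  [/\ measurable_fun (`[0, T] `*` `[0, T] `*` setT)
        ((fun z => u z.1.1 z.1.2 z.2) : R * R * Omega -> \bar R),
      (\int[P]_w \int[lebesgue_measure]_(x in `[0%R, T])
         \int[lebesgue_measure]_(y in `[0%R, T]) u x y w ^+ 2 < +oo)%E,
      sq_integrable P X,
      (exists X' : Omega -> R,
         (forall A : set R, measurable A ->
            brownian_sigma_algebra T B (X' @^-1` A)) /\
         {ae P, forall w, X w = X' w}) &
      forall F DF D2F, malliavin22 P T B F DF D2F ->
        (\int[P]_w (F w * X w)%:E =
         \int[P]_w \int[lebesgue_measure]_(x in `[0%R, T])
           \int[lebesgue_measure]_(y in `[0%R, T])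
             ((D2F x y w)%:E * u x y w))%E ].

Definition skorohod_integral_Z (R : realType) d (Omega : measurableType d)
    (P : probability Omega R) (H T : R) (B : R -> Omega -> R)
    (g : R -> Omega -> R) (X : Omega -> R) : Prop :=
  [/\ process_measurable T g,
      (\int[P]_w \int[lebesgue_measure]_(s in `[0%R, T]) (g s w ^+ 2)%:E < +oo)%E &
      delta2 P T B (fun y1 y2 w => I_kernel H T (fun s => g s w) y1 y2) X ].

Definition skorohod_integrable_Z (R : realType) d (Omega : measurableType d)
    (P : probability Omega R) (H T : R) (B : R -> Omega -> R)
    (g : R -> Omega -> R) : Prop :=
  exists X, skorohod_integral_Z P H T B g X.

(* Main.v *)
(** Write [u] for [I(g)]. On each dyadic grid let [e_al] be the normalized Hermite
    products of the increments of the Brownian motion and [phi_k] the normalized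
    indicators of the cells. For [F] in the domain of the second derivative, Gaussian
    integration by parts gives
      [sqrt w * E(F e_al) = E <D^2 F, phi_k (x) phi_l> e_(al-k-l)],
    where [w] is the product of the two factors brought down by differentiation.
    Applying the same identity to [g_s] and integrating against the kernel (Fubini)
    yields
      [sqrt w * <u, e_be phi_i phi_j> = <I(D^2 g), e_(be-k-l) phi_i phi_j phi_k phi_l>],
    so that no derivative of [u] itself is needed. Since
    [n (n - 1) <= 6 (1 + (n - 2) (n - 3))], Cauchy-Schwarz and Bessel's inequality give
      [(E <D^2 F, u>)^2 <= 6 (|I(g)|^2 + |I(D^2 g)|^2) E F^2]
    first on a grid, then in the limit. Riesz representation provides the integral,
    and the constant is [6 / 2 = 3] because [|f|_H^2 = 2 |I(f)|^2]. The norm bound uses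
    that the polynomials in the increments are dense in L^2(sigma(B)). *)

Require Import Defs.
From HB Require Import structures.
From mathcomp Require Import all_boot all_order all_algebra.
From mathcomp Require Import all_classical all_reals all_analysis measurable_realfun.
From mathcomp Require Import ring lra.
Set Implicit Arguments.
Unset Strict Implicit.
Unset Printing Implicit Defensive.
Import Order.TTheory GRing.Theory Num.Theory.
Import numFieldNormedType.Exports.
Local Open Scope classical_set_scope.
Local Open Scope ring_scope.

(** For fixed [s] the kernel behaves like [(s - y)^(H/2 - 1)] near [y = s]: integrable in [y],
    uniformly in [s <= T], but not square integrable. So [I(g)] is not an L^2-valued integral over
    [s]; it is only paired with bounded cell functions, and the norms of [I(g)] and [I(D^2 g)] enter
    solely as given finite quantities. The factor 6 is the maximum of
    [n (n - 1) / (1 + (n - 2) (n - 3))] over [n >= 2], attained at [n = 3]: [n] is the degree of a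
    coefficient of [F], the matching coefficient of [u] has degree [n - 2], and [(n - 2) (n - 3)] is
    the total weight of a second pair of derivatives. Duality determines an integral only on the
    closed span of the test variables. Density places every admissible value in that span, and it is
    obtained without a chaos expansion: indicators of events of [B] are shown to be bounded
    multipliers of the closure of the polynomials. Approximants are asked for at every sufficiently
    fine dyadic level, so that several of them can be brought to a common grid. *)

Section integrable_real.
Context d (T : measurableType d) (R : realType).
Variable mu : {measure set T -> \bar R}.
Implicit Types f g : T -> R.

Definition itg f := mu.-integrable setT (EFin \o f).

Lemma itg_meas f : itg f -> measurable_fun setT f.
Proof. by move=> /measurable_int /measurable_EFinP. Qed.

Lemma itg_eq f g : (forall x, f x = g x) -> itg g -> itg f.
Proof. by move=> fg; rewrite (_ : f = g)//; exact/funext. Qed.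

Lemma itg_le f g : measurable_fun setT f -> itg g ->
  (forall x, `|f x| <= `|g x|) -> itg f.
Proof.
move=> mf ig fg; apply: (le_integrable measurableT _ _ ig).
  exact/measurable_EFinP.
by move=> x _ /=; rewrite lee_fin fg.
Qed.

Lemma itg_ae_le f g : measurable_fun setT f -> itg g ->
  {ae mu, forall x, `|f x| <= g x} -> itg f.
Proof.
move=> mf ig fg; apply/integrableP; split; first exact/measurable_EFinP.
have /integrableP[_] := ig; apply: le_lt_trans.
apply: ae_ge0_le_integral => //.
- by apply: measurableT_comp => //; exact/measurable_EFinP.
- by apply: measurableT_comp => //; exact: measurable_int ig.
- by apply: filterS fg => x fgx _ /=; rewrite lee_fin (le_trans fgx)// ler_norm.
Qed.

Lemma itgD f g : itg f -> itg g -> itg (fun x => f x + g x).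
Proof. by move=> fi gi; have := integrableD measurableT fi gi. Qed.

Lemma itgZ k f : itg f -> itg (fun x => k * f x).
Proof. by move=> fi; have := integrableZl measurableT k fi. Qed.

Lemma itgN f : itg f -> itg (fun x => - f x).
Proof.
by move=> /(itgZ (-1)); congr itg; apply/funext => x; rewrite mulN1r.
Qed.

Lemma itgB f g : itg f -> itg g -> itg (fun x => f x - g x).
Proof. by move=> fi gi; apply: itgD => //; exact: itgN. Qed.

Lemma itg0 : itg (fun=> 0).
Proof. exact: integrable0. Qed.

Lemma itg_sum I (r : seq I) (P : pred I) (F : I -> T -> R) :
  (forall i, P i -> itg (F i)) -> itg (fun x => \sum_(i <- r | P i) F i x).
Proof.
move=> Fi; elim: r => [|i r IH].
  by apply: (itg_eq _ itg0) => x; rewrite big_nil.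
rewrite (_ : (fun _ => _) = (fun x => if P i then F i x +
    \sum_(j <- r | P j) F j x else \sum_(j <- r | P j) F j x)); last first.
  by apply/funext => x; rewrite big_cons.
by case Pi : (P i) => //; apply: itgD => //; exact: Fi.
Qed.

Lemma itg_abs f : itg f -> itg (fun x => `|f x|).
Proof.
move=> fi; apply: (itg_le _ fi); last by move=> x; rewrite normr_id.
by apply: measurableT_comp => //; exact: itg_meas.
Qed.

Lemma RintD f g : itg f -> itg g ->
  \int[mu]_x (f x + g x) = \int[mu]_x f x + \int[mu]_x g x.
Proof. by move=> *; rewrite RintegralD. Qed.

Lemma RintB f g : itg f -> itg g ->
  \int[mu]_x (f x - g x) = \int[mu]_x f x - \int[mu]_x g x.
Proof. by move=> *; rewrite RintegralB. Qed.

Lemma RintZ k f : itg f -> \int[mu]_x (k * f x) = k * \int[mu]_x f x.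
Proof. by move=> *; rewrite RintegralZl. Qed.

Lemma Rint0 : \int[mu]_x (0 : R) = 0.
Proof. by rewrite /Rintegral integral0. Qed.

Lemma Rint_sum I (r : seq I) (P : pred I) (F : I -> T -> R) :
  (forall i, P i -> itg (F i)) ->
  \int[mu]_x (\sum_(i <- r | P i) F i x) = \sum_(i <- r | P i) \int[mu]_x F i x.
Proof.
move=> Fi; elim: r => [|i r IH].
  by rewrite big_nil -[RHS]Rint0; apply: eq_Rintegral => x _; rewrite big_nil.
under eq_Rintegral do rewrite big_cons; rewrite big_cons.
case: ifPn => // Pi; rewrite RintD ?IH//; first exact: Fi.
exact: itg_sum.
Qed.

Lemma EFin_Rint f : itg f -> ((\int[mu]_x f x)%:E = \int[mu]_x (f x)%:E)%E.
Proof. by move=> fi; rewrite /Rintegral fineK//; exact: integrable_fin_num. Qed.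

Lemma le_Rint f g : itg f -> itg g -> (forall x, f x <= g x) ->
  \int[mu]_x f x <= \int[mu]_x g x.
Proof. by move=> *; apply: le_Rintegral. Qed.

Lemma Rint_ge0 f : (forall x, 0 <= f x) -> 0 <= \int[mu]_x f x.
Proof. by move=> *; apply: Rintegral_ge0. Qed.

Lemma le_norm_Rint f : itg f -> `|\int[mu]_x f x| <= \int[mu]_x `|f x|.
Proof. by move=> *; apply: le_normr_Rintegral. Qed.

Lemma itg_ge0P f : measurable_fun setT f -> (forall x, 0 <= f x) ->
  itg f <-> (\int[mu]_x (f x)%:E < +oo)%E.
Proof.
move=> mf f0; split=> [/integrableP[_]|foo].
  by under eq_integral => x _ do rewrite /= ger0_norm//.
apply/integrableP; split; first exact/measurable_EFinP.
by under eq_integral => x _ do rewrite /= ger0_norm//.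
Qed.

Lemma Rint_ae_eq f g : measurable_fun setT f -> measurable_fun setT g ->
  {ae mu, forall x, f x = g x} -> \int[mu]_x f x = \int[mu]_x g x.
Proof.
move=> mf mg fg; congr fine; apply: ae_eq_integral => //.
- exact/measurable_EFinP.
- exact/measurable_EFinP.
- by apply: filterS fg => x /= ->.
Qed.

End integrable_real.

(** * The space L^2 of real functions: inner product, Cauchy-Schwarz, Bessel *)

Section L2.
Context d (T : measurableType d) (R : realType).
Variable mu : {measure set T -> \bar R}.
Implicit Types f g h : T -> R.

Definition L2 f := measurable_fun setT f /\ itg mu (fun x => f x ^+ 2).

Definition ip f g : R := \int[mu]_x (f x * g x).

Lemma L2P f : L2 f <->
  (measurable_fun setT f /\ (\int[mu]_x (f x ^+ 2)%:E < +oo)%E).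
Proof.
split=> -[mf fi]; split=> //.
  apply/itg_ge0P => //; first exact: measurable_funX.
  by move=> x; exact: sqr_ge0.
apply/itg_ge0P => //; first exact: measurable_funX.
by move=> x; exact: sqr_ge0.
Qed.

Lemma L2M f g : L2 f -> L2 g -> itg mu (fun x => f x * g x).
Proof.
move=> [mf fi] [mg gi].
apply: (@itg_le _ _ _ _ _ (fun x => f x ^+ 2 + g x ^+ 2)).
- exact: measurable_funM.
- exact: itgD.
- move=> x; rewrite [X in _ <= X]ger0_norm ?addr_ge0 ?sqr_ge0//.
  rewrite normrM -[f x ^+ 2]real_normK ?num_real//.
  rewrite -[g x ^+ 2]real_normK ?num_real//.
  have := sqr_ge0 (`|f x| - `|g x|).
  have := mulr_ge0 (normr_ge0 (f x)) (normr_ge0 (g x)).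
  nra.
Qed.

Lemma L20 : L2 (fun=> 0).
Proof.
split; first exact: measurable_cst.
by apply: (itg_eq _ (itg0 _)) => x; rewrite expr0n.
Qed.

Lemma L2Z k f : L2 f -> L2 (fun x => k * f x).
Proof.
move=> [mf fi]; split; first exact: measurable_funM.
by apply: (itg_eq _ (itgZ (k ^+ 2) fi)) => x; rewrite exprMn.
Qed.

Lemma L2D f g : L2 f -> L2 g -> L2 (fun x => f x + g x).
Proof.
move=> Lf Lg; have [mf fi] := Lf; have [mg gi] := Lg.
split; first exact: measurable_funD.
by apply: (itg_eq _ (itgD (itgD fi (itgZ 2 (L2M Lf Lg))) gi)) => x; ring.
Qed.

Lemma L2N f : L2 f -> L2 (fun x => - f x).
Proof. by move=> /(L2Z (-1)); congr L2; apply/funext=> x; rewrite mulN1r. Qed.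

Lemma L2B f g : L2 f -> L2 g -> L2 (fun x => f x - g x).
Proof. by move=> Lf Lg; apply: L2D => //; exact: L2N. Qed.

Lemma L2_sum I (r : seq I) (P : pred I) (F : I -> T -> R) :
  (forall i, P i -> L2 (F i)) -> L2 (fun x => \sum_(i <- r | P i) F i x).
Proof.
move=> Fi; elim: r => [|i r IH].
  rewrite (_ : (fun _ => _) = (fun=> 0)); first exact: L20.
  by apply/funext => x; rewrite big_nil.
rewrite (_ : (fun _ => _) = (fun x => if P i then F i x +
    \sum_(j <- r | P j) F j x else \sum_(j <- r | P j) F j x)); last first.
  by apply/funext => x; rewrite big_cons.
by case Pi : (P i) => //; apply: L2D => //; exact: Fi.
Qed.

Lemma L2_eq f g : (forall x, f x = g x) -> L2 g -> L2 f.
Proof. by move=> fg; rewrite (_ : f = g)//; exact/funext. Qed.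

Lemma L2_le f g : measurable_fun setT f -> L2 g ->
  (forall x, `|f x| <= `|g x|) -> L2 f.
Proof.
move=> mf [mg gi] fg; split => //.
apply: (itg_le _ gi); first exact: measurable_funX.
by move=> x; rewrite !normrX lerXn2r ?nnegrE.
Qed.

Lemma ipC f g : ip f g = ip g f.
Proof. by rewrite /ip; under eq_Rintegral do rewrite mulrC. Qed.

Lemma ipDl f g h : L2 f -> L2 g -> L2 h ->
  ip (fun x => f x + g x) h = ip f h + ip g h.
Proof.
move=> Lf Lg Lh; rewrite /ip; under eq_Rintegral do rewrite mulrDl.
by rewrite RintD//; exact: L2M.
Qed.

Lemma ipZl k f h : L2 f -> L2 h -> ip (fun x => k * f x) h = k * ip f h.
Proof.
move=> Lf Lh; rewrite /ip; under eq_Rintegral do rewrite -mulrA.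
by rewrite RintZ//; exact: L2M.
Qed.

Lemma ipBl f g h : L2 f -> L2 g -> L2 h ->
  ip (fun x => f x - g x) h = ip f h - ip g h.
Proof.
move=> Lf Lg Lh; rewrite /ip; under eq_Rintegral do rewrite mulrBl.
by rewrite RintB//; exact: L2M.
Qed.

Lemma ip_suml I (r : seq I) (P : pred I) (F : I -> T -> R) h :
  (forall i, P i -> L2 (F i)) -> L2 h ->
  ip (fun x => \sum_(i <- r | P i) F i x) h = \sum_(i <- r | P i) ip (F i) h.
Proof.
move=> LF Lh; rewrite /ip; under eq_Rintegral do rewrite big_distrl/=.
by rewrite Rint_sum// => i Pi; apply: L2M => //; exact: LF.
Qed.

Lemma ipDr f g h : L2 f -> L2 g -> L2 h ->
  ip h (fun x => f x + g x) = ip h f + ip h g.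
Proof. by move=> *; rewrite ipC ipDl// ipC [X in _ + X]ipC. Qed.

Lemma ipBr f g h : L2 f -> L2 g -> L2 h ->
  ip h (fun x => f x - g x) = ip h f - ip h g.
Proof. by move=> *; rewrite ipC ipBl// ipC [X in _ - X]ipC. Qed.

Lemma ipZr k f h : L2 f -> L2 h -> ip h (fun x => k * f x) = k * ip h f.
Proof. by move=> *; rewrite ipC ipZl// ipC. Qed.

Lemma ip_sumr I (r : seq I) (P : pred I) (F : I -> T -> R) h :
  (forall i, P i -> L2 (F i)) -> L2 h ->
  ip h (fun x => \sum_(i <- r | P i) F i x) = \sum_(i <- r | P i) ip h (F i).
Proof. by move=> *; rewrite ipC ip_suml//; under eq_bigr do rewrite ipC. Qed.

Lemma ipE f : ip f f = \int[mu]_x (f x ^+ 2).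
Proof. by rewrite /ip; under eq_Rintegral do rewrite -expr2. Qed.

Lemma ip_ge0 f : 0 <= ip f f.
Proof. by rewrite ipE Rint_ge0// => x; exact: sqr_ge0. Qed.

Lemma ip_EFin f : L2 f -> ((ip f f)%:E = \int[mu]_x (f x ^+ 2)%:E)%E.
Proof. by move=> [_ fi]; rewrite ipE EFin_Rint. Qed.

Lemma ipDD f g : L2 f -> L2 g ->
  ip (fun x => f x + g x) (fun x => f x + g x) = ip f f + 2 * ip f g + ip g g.
Proof.
move=> Lf Lg; rewrite ipDl ?ipDr ?[ip g f]ipC//; last exact: L2D.
by ring.
Qed.

Lemma ipBB f g : L2 f -> L2 g ->
  ip (fun x => f x - g x) (fun x => f x - g x) = ip f f - 2 * ip f g + ip g g.
Proof.
move=> Lf Lg; rewrite ipBl ?ipBr ?[ip g f]ipC//; last exact: L2B.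
by ring.
Qed.

Lemma ip_CS f g : L2 f -> L2 g -> ip f g ^+ 2 <= ip f f * ip g g.
Proof.
move=> Lf Lg.
have q t : 0 <= ip f f + 2 * t * ip f g + t ^+ 2 * ip g g.
  have := ip_ge0 (fun x => f x + t * g x).
  rewrite ipDD//; last exact: L2Z.
  by rewrite ipZr ?ipZl ?ipZr//; [congr (_ <= _); ring| exact: L2Z].
have [g0|g0] := eqVneq (ip g g) 0; last first.
  have gp : 0 < ip g g by rewrite lt_neqAle eq_sym g0 ip_ge0.
  have := q (- ip f g / ip g g).
  rewrite -(pmulr_rge0 _ gp).
  have -> : ip g g * (ip f f + 2 * (- ip f g / ip g g) * ip f g
     + (- ip f g / ip g g) ^+ 2 * ip g g) = ip f f * ip g g - ip f g ^+ 2.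
    by field.
  by rewrite subr_ge0.
rewrite g0 mulr0.
suff -> : ip f g = 0 by rewrite expr0n.
apply/eqP/negPn/negP => fg0.
(* When [ip g g = 0] the quadratic is affine in [t], and this [t] would give it the value -1. *)
have := q (- (ip f f + 1) / (2 * ip f g)); rewrite g0 mulr0 addr0.
have -> : 2 * (- (ip f f + 1) / (2 * ip f g)) * ip f g = - (ip f f + 1).
  by field.
by lra.
Qed.

Lemma ip_CS_abs f g : L2 f -> L2 g ->
  `|ip f g| <= Num.sqrt (ip f f) * Num.sqrt (ip g g).
Proof.
move=> Lf Lg; rewrite -sqrtrM ?ip_ge0// -sqrtr_sqr.
by apply: ler_wsqrtr; exact: ip_CS.
Qed.

Lemma ip_tri f g : L2 f -> L2 g ->
  Num.sqrt (ip (fun x => f x + g x) (fun x => f x + g x)) <=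
  Num.sqrt (ip f f) + Num.sqrt (ip g g).
Proof.
move=> Lf Lg; rewrite -[leRHS]ger0_norm ?addr_ge0 ?sqrtr_ge0// -sqrtr_sqr.
apply: ler_wsqrtr; rewrite ipDD// sqrrD !sqr_sqrtr ?ip_ge0//.
have := le_trans (ler_norm _) (ip_CS_abs Lf Lg).
lra.
Qed.

Lemma ip_sum_le2 f g : L2 f -> L2 g ->
  ip (fun x => f x + g x) (fun x => f x + g x) <= 2 * ip f f + 2 * ip g g.
Proof.
move=> Lf Lg; have := ip_ge0 (fun x => f x - g x); rewrite ipBB// ipDD//.
lra.
Qed.

Section orthonormal.
Variables (I : finType) (P : pred I) (e : I -> T -> R).
Hypothesis Le : forall i, P i -> L2 (e i).
Hypothesis oe : forall i j, P i -> P j -> ip (e i) (e j) = (i == j)%:R.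

Let Lce c : L2 (fun x => \sum_(i | P i) c i * e i x).
Proof. by apply: L2_sum => i Pi; apply: L2Z; exact: Le. Qed.

Lemma ip_combination f (c : I -> R) : L2 f ->
  ip (fun x => \sum_(i | P i) c i * e i x) f = \sum_(i | P i) c i * ip (e i) f.
Proof.
move=> Lf; rewrite ip_suml//; last by move=> i Pi; apply: L2Z; exact: Le.
by apply: eq_bigr => i Pi; rewrite ipZl//; exact: Le.
Qed.

Lemma ip_combinationr f (c : I -> R) : L2 f ->
  ip f (fun x => \sum_(i | P i) c i * e i x) = \sum_(i | P i) c i * ip (e i) f.
Proof. by move=> Lf; rewrite ipC ip_combination. Qed.

Lemma ip_combination2 (b c : I -> R) :
  ip (fun x => \sum_(i | P i) b i * e i x) (fun x => \sum_(i | P i) c i * e i x)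
  = \sum_(i | P i) b i * c i.
Proof.
rewrite ip_combination//; apply: eq_bigr => i Pi; congr (_ * _).
rewrite ip_sumr//; [|by move=> j Pj; apply: L2Z; exact: Le|exact: Le].
rewrite (bigD1 i)//= ipZr ?oe ?eqxx ?mulr1; [|done|done|exact: Le|exact: Le].
rewrite big1 ?addr0// => j /andP[Pj ji].
rewrite ipZr ?oe//; [|exact: Le|exact: Le].
by rewrite eq_sym (negbTE ji) mulr0.
Qed.

(** The excess of the right-hand side is the sum of the squares [(ip (e i) f - c i) ^+ 2]. *)
Lemma proj_dist f (c : I -> R) : L2 f ->
  let p := fun x => \sum_(i | P i) ip (e i) f * e i x in
  let q := fun x => \sum_(i | P i) c i * e i x in
  ip (fun x => f x - p x) (fun x => f x - p x) <=
  ip (fun x => f x - q x) (fun x => f x - q x).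
Proof.
move=> Lf; cbv zeta; rewrite !ipBB// !ip_combination2 !ip_combinationr//.
rewrite -subr_ge0.
have -> : (ip f f - 2 * (\sum_(i | P i) c i * ip (e i) f) + \sum_(i | P i) c i * c i
   - (ip f f - 2 * (\sum_(i | P i) ip (e i) f * ip (e i) f) +
   \sum_(i | P i) ip (e i) f * ip (e i) f)) =
  \sum_(i | P i) (ip (e i) f - c i) ^+ 2.
  rewrite [RHS](eq_bigr (fun i => ip (e i) f * ip (e i) f - 2 * (c i * ip (e i) f)
    + c i * c i)); last by move=> i _; ring.
  by rewrite big_split/= sumrB -mulr_sumr; ring.
by apply: sumr_ge0 => i _; exact: sqr_ge0.
Qed.

Lemma Bessel f : L2 f -> \sum_(i | P i) ip (e i) f ^+ 2 <= ip f f.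
Proof.
move=> Lf; have := ip_ge0 (fun x => f x - \sum_(i | P i) ip (e i) f * e i x).
rewrite ipBB// ip_combination2 ip_combinationr//.
rewrite (eq_bigr (fun i => ip (e i) f ^+ 2)); last by move=> i _; rewrite expr2.
by lra.
Qed.

End orthonormal.

End L2.

(** * Real sequences: limits and geometric rates *)

Section realseq.
Context (R : realType).

(** [fine (limn_esup ...)] serves throughout as an everywhere measurable version of a limit known to
    exist only almost everywhere. *)
Lemma limn_esup_EFin (u : R^nat) (l : R) : u @ \oo --> l ->
  fine (limn_esup (EFin \o u)) = l.
Proof.
move=> ul; have cv : (EFin \o u) @ \oo --> l%:E by apply/cvg_EFin => //; exact: nearW.
rewrite is_cvg_limn_esupE; last by apply/cvg_ex; exists l%:E.
by rewrite (cvg_lim _ cv).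
Qed.

Lemma le_cvg0 (u : R) (v : R^nat) : v @ \oo --> 0 -> (forall n, u <= v n) -> u <= 0.
Proof.
move=> v0 uv; rewrite -(cvg_lim (@Rhausdorff R) v0).
by apply: limr_ge; [apply/cvg_ex; exists 0|exact: nearW].
Qed.

Lemma half_lt1 : `|2^-1 : R| < 1.
Proof. by rewrite ger0_norm ?invr_ge0// invf_lt1// ltr1n. Qed.

Lemma cvg_half : (fun n => (2^-1 : R) ^+ n) @ \oo --> 0.
Proof. exact: (cvg_expr half_lt1). Qed.

Lemma cvg0_le (u v : R^nat) : v @ \oo --> 0 -> (forall n, `|u n| <= v n) ->
  u @ \oo --> 0.
Proof.
move=> v0 uv; apply/norm_cvg0P; apply: (@squeeze_cvgr _ _ _ _ (fun=> 0) v) => //.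
  by apply: nearW => n; rewrite normr_ge0 uv.
exact: cvg_cst.
Qed.

Lemma cvg_subr0 (u : R^nat) (l : R) : (fun n => u n - l) @ \oo --> 0 ->
  u @ \oo --> l.
Proof.
move=> h; rewrite (_ : u = (fun n => u n - l + l)); last first.
  by apply/funext => n; rewrite subrK.
by rewrite -[X in _ --> X]add0r; apply: cvgD => //; exact: cvg_cst.
Qed.

Lemma cvg_sqr (u : R^nat) (l : R) : u @ \oo --> l ->
  (fun n => u n ^+ 2) @ \oo --> l ^+ 2.
Proof.
move=> h; rewrite (_ : (fun n => _) = u \* u); first by rewrite expr2; exact: cvgM.
by apply/funext => n; rewrite expr2.
Qed.

Lemma cvg_sqr0 (u : R^nat) : (fun n => u n ^+ 2) @ \oo --> 0 -> u @ \oo --> 0.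
Proof.
move=> h; apply/norm_cvg0P.
have := cvg_comp (fun n => u n ^+ 2) Num.sqrt h (@sqrt_continuous R 0).
rewrite sqrtr0; apply: cvg_trans; apply: near_eq_cvg; apply: nearW => n /=.
by rewrite sqrtr_sqr.
Qed.

Lemma sum_half (n : nat) : \sum_(i < n) (2^-1 : R) ^+ i <= 2.
Proof.
suff -> : \sum_(i < n) (2^-1 : R) ^+ i = 2 - 2 * 2^-1 ^+ n.
  by rewrite lerBlDr lerDl mulr_ge0 ?exprn_ge0 ?invr_ge0.
elim: n => [|n IH]; first by rewrite big_ord0 expr0; lra.
by rewrite big_ord_recr/= IH exprSr; field.
Qed.

Lemma nneg_bounded_series_cvg (u : R^nat) (M : R) : (forall n, 0 <= u n) ->
  (forall n, \sum_(k < n) u k <= M) -> cvgn (series u).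
Proof.
move=> u0 uM; apply: nondecreasing_is_cvgn.
  apply/nondecreasing_seqP => n; rewrite /series/= big_nat_recr//=.
  by rewrite lerDl.
by exists M => _ [n _ <-]; rewrite /series/= big_mkord.
Qed.

End realseq.

(** * Limits in L^2 of a probability space; Riesz representation *)

Section L2_limits.
Context d (T : measurableType d) (R : realType).
Variable P : probability T R.
Implicit Types (f g : T -> R) (F : nat -> T -> R).

Lemma itg_cst (k : R) : itg P (fun=> k).
Proof. exact: finite_measure_integrable_cst. Qed.

Lemma L2_cst (k : R) : L2 P (fun=> k).
Proof. by split; [exact: measurable_cst|exact: itg_cst]. Qed.

Lemma Rint_cst (k : R) : \int[P]_x k = k.
Proof. by rewrite /Rintegral integral_cst//= probability_setT mule1. Qed.

Lemma L2_itg f : L2 P f -> itg P f.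
Proof.
move=> Lf; apply: itg_eq (L2M Lf (L2_cst 1)) => x; by rewrite mulr1.
Qed.

Lemma itg_bounded f (k : R) : measurable_fun setT f ->
  (forall x, `|f x| <= k) -> itg P f.
Proof.
move=> mf fk; apply: (itg_le mf (itg_cst k)) => x.
by rewrite (le_trans (fk x))// ler_norm.
Qed.

Lemma ip1 f : ip P f (fun=> 1) = \int[P]_x f x.
Proof. by rewrite /ip; under eq_Rintegral do rewrite mulr1. Qed.

Lemma Rint_sqr_le f : L2 P f -> (\int[P]_x f x) ^+ 2 <= ip P f f.
Proof.
move=> Lf; rewrite -ip1 (le_trans (ip_CS Lf (L2_cst 1)))//.
by rewrite [ip P (fun=> 1) _]ipE expr1n Rint_cst mulr1.
Qed.

(** The sum of the series has integral at most 2, so it is finite almost everywhere. *)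
Lemma ae_bounded_series F : (forall n, itg P (F n)) ->
  (forall n x, 0 <= F n x) -> (forall n, \int[P]_x F n x <= 2^-1 ^+ n) ->
  {ae P, forall x, cvgn (series (F ^~ x))}.
Proof.
move=> iF F0 Fle.
pose u n x := ((F n x)%:E : \bar R).
have mu_ n : measurable_fun setT (u n) by exact: measurable_int (iF n).
have u0 n x : (0 <= u n x)%E by rewrite lee_fin.
have S_ge0 x : (0 <= \sum_(0 <= n <oo) u n x)%E by apply: nneseries_ge0.
have mS : measurable_fun setT (fun x => \sum_(0 <= n <oo) u n x)%E.
  by apply: (@ge0_emeasurable_sum _ _ _ setT u xpredT) => // *; exact: u0.
have Sfin : P.-integrable setT (fun x => \sum_(0 <= n <oo) u n x)%E.
  apply/integrableP; split => //.
  under eq_integral do rewrite gee0_abs//.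
  rewrite integral_nneseries//.
  apply: (@le_lt_trans _ _ 2%:E); last exact: ltry.
  apply: lime_le.
    by apply: is_cvg_nneseries => n _ _; exact: integral_ge0.
  apply: nearW => n; rewrite big_mkord.
  under eq_bigr do rewrite -EFin_Rint//.
  rewrite sumEFin lee_fin (le_trans _ (sum_half _ n))//.
  by apply: ler_sum => i _.
have := integrable_ae measurableT Sfin; apply: filterS => x /(_ I) Sx.
apply: (@nneg_bounded_series_cvg _ _ (fine (\sum_(0 <= n <oo) u n x)%E)) => // n.
rewrite -lee_fin fineK// -sumEFin -(big_mkord xpredT (fun i => u i x)).
by apply: nneseries_lim_ge.
Qed.

Lemma ae_cvg_fast F f : (forall n, L2 P (F n)) -> L2 P f ->
  (forall n, ip P (fun x => F n x - f x) (fun x => F n x - f x) <= 2^-1 ^+ n) ->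
  {ae P, forall x, F ^~ x @ \oo --> f x}.
Proof.
move=> LF Lf Ff.
have := @ae_bounded_series (fun n x => (F n x - f x) ^+ 2).
move=> /(_ (fun n => (L2B (LF n) Lf).2) (fun n x => sqr_ge0 _)).
have h n : \int[P]_x (F n x - f x) ^+ 2 <= 2^-1 ^+ n by rewrite -ipE.
move=> /(_ h); apply: filterS => x /cvg_series_cvg_0 cv.
exact/cvg_subr0/cvg_sqr0.
Qed.

Lemma ip_fatou F f (K : R) : (forall n, L2 P (F n)) -> measurable_fun setT f ->
  {ae P, forall x, F ^~ x @ \oo --> f x} ->
  (forall n, ip P (F n) (F n) <= K) -> L2 P f /\ ip P f f <= K.
Proof.
move=> LF mf Ff FK.
have K0 : 0 <= K by rewrite (le_trans (ip_ge0 P (F 0%N))).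
have key : (\int[P]_x (f x ^+ 2)%:E <= K%:E)%E.
  apply: (@le_trans _ _ (\int[P]_x limn_einf (fun n => (F n x ^+ 2)%:E))%E).
    apply: ae_ge0_le_integral => //.
    - by move=> x _; rewrite lee_fin sqr_ge0.
    - by apply/measurable_EFinP/measurable_funX.
    - move=> x _; rewrite limn_einf_lim; apply: lime_ge.
        exact: is_cvg_einfs.
      apply: nearW => n; apply: le_ereal_inf_tmp => _ [k _ <-].
      by rewrite lee_fin sqr_ge0.
    - rewrite (_ : (fun _ => _) = (fun x =>
          - limn_esup (-%E \o (fun n => (F n x ^+ 2)%:E)))%E); last first.
        by apply/funext => x; rewrite limn_esupN oppeK.
      apply: measurableT_comp => //; apply: measurable_fun_limn_esup => n.
      apply: measurableT_comp => //.
      by apply/measurable_EFinP/measurable_funX; have [] := LF n.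
    - apply: filterS Ff => x cv _.
      have cv2 : (fun n => (F n x ^+ 2)%:E) @ \oo --> (f x ^+ 2)%:E.
        apply/cvg_EFin; first exact: nearW.
        exact: cvg_sqr.
      by rewrite is_cvg_limn_einfE ?(cvg_lim _ cv2)//; apply/cvg_ex; exists (f x ^+ 2)%:E.
  apply: (le_trans (fatou _ _ _ _)) => //.
  - by move=> n; apply/measurable_EFinP/measurable_funX; have [] := LF n.
  - by move=> n x _; rewrite lee_fin sqr_ge0.
  - rewrite limn_einf_lim; apply: lime_le; first exact: is_cvg_einfs.
    apply: nearW => n; apply: ereal_inf_le; exists (\int[P]_x (F n x ^+ 2)%:E)%E.
      by exists n => //=.
    by rewrite -ip_EFin// lee_fin.
have Lf : L2 P f by apply/L2P; split => //; rewrite (le_lt_trans key)// ltry.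
by split=> //; rewrite -lee_fin ip_EFin.
Qed.

(** The rate 4^-n on squared distances makes the L^1 norms of successive differences at most 2^-n,
    so the telescoping series converges absolutely almost everywhere; Fatou's lemma then gives the
    distance to the limit. *)
Lemma L2_complete F : (forall n, L2 P (F n)) ->
  (forall m n, (n <= m)%N ->
    ip P (fun x => F m x - F n x) (fun x => F m x - F n x) <= 4^-1 ^+ n) ->
  exists f, [/\ L2 P f, {ae P, forall x, F ^~ x @ \oo --> f x} &
    forall n, ip P (fun x => f x - F n x) (fun x => f x - F n x) <= 4^-1 ^+ n].
Proof.
move=> LF FC.
pose f x := fine (limn_esup (fun n => (F n x)%:E)).
have mf : measurable_fun setT f.
  apply: measurableT_comp; first exact: fine_measurable.
  apply: measurable_fun_limn_esup => n; apply/measurable_EFinP.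
  by have [] := LF n.
have Ff : {ae P, forall x, F ^~ x @ \oo --> f x}.
  have LD n : L2 P (fun x => F n.+1 x - F n x) by apply: L2B.
  have := @ae_bounded_series (fun n x => `|F n.+1 x - F n x|).
  move=> /(_ (fun n => itg_abs (L2_itg (LD n))) (fun n x => normr_ge0 _)).
  have h n : \int[P]_x `|F n.+1 x - F n x| <= 2^-1 ^+ n.
    rewrite -ler_sqr ?nnegrE ?exprn_ge0 ?invr_ge0 ?Rint_ge0//.
    have LA : L2 P (fun x => `|F n.+1 x - F n x|).
      apply: (L2_le _ (LD n)); last by move=> x; rewrite normr_id.
      by apply: measurableT_comp => //; have [] := LD n.
    apply: (le_trans (Rint_sqr_le LA)).
    rewrite /ip; under eq_Rintegral do rewrite -normrM ger0_norm ?sqr_ge0//.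
    have -> : (2^-1 ^+ n) ^+ 2 = 4^-1 ^+ n :> R.
      by rewrite -exprM mulnC exprM; congr (_ ^+ _); field.
    exact: FC.
  move=> /(_ h); apply: filterS => x cv.
  have : cvgn (series (telescope (F ^~ x))) by apply: normed_cvg.
  rewrite telescopeK => /cvg_ex[l cl].
  have cvF : F ^~ x @ \oo --> l + F 0%N x.
    rewrite (_ : F ^~ x = (fun n => F n x - F 0%N x + F 0%N x)); last first.
      by apply/funext => n; rewrite subrK.
    by apply: cvgD => //; exact: cvg_cst.
  by rewrite /f (limn_esup_EFin cvF).
have LfF n : L2 P (fun x => f x - F n x) /\
    ip P (fun x => f x - F n x) (fun x => f x - F n x) <= 4^-1 ^+ n.
  apply: (@ip_fatou (fun m x => F (m + n)%N x - F n x)).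
  - by move=> m; apply: L2B.
  - by apply: measurable_funB => //; have [] := LF n.
  - apply: filterS Ff => x cv; apply: cvgB; last exact: cvg_cst.
    by rewrite (cvg_shiftn n (F ^~ x)).
  - by move=> m; apply: FC; rewrite leq_addl.
exists f; split=> //; last by move=> n; have [] := LfF n.
apply: L2_eq (L2D (LfF 0%N).1 (LF 0%N)) => x; by rewrite subrK.
Qed.

(** L^2 boundedness gives uniform integrability. With [a = |F n - f|], the bound
    [a <= min a M + a^2 / M] leaves a truncated part, to which dominated convergence applies, and a
    remainder of order [K / M]. *)
Lemma Rint_cvg_bounded2 F f (K : R) : (forall n, L2 P (F n)) ->
  measurable_fun setT f -> {ae P, forall x, F ^~ x @ \oo --> f x} ->
  (forall n, ip P (F n) (F n) <= K) ->
  (fun n => \int[P]_x F n x) @ \oo --> \int[P]_x f x.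
Proof.
move=> LF mf Ff FK; have [Lf fK] := ip_fatou LF mf Ff FK.
have K0 : 0 <= K by rewrite (le_trans (ip_ge0 P f)).
have LD n : L2 P (fun x => F n x - f x) by apply: L2B.
have mD n : measurable_fun setT (fun x => `|F n x - f x|).
  by apply: measurableT_comp => //; have [] := LD n.
have iM n M : 0 < M -> itg P (fun x => Num.min `|F n x - f x| M).
  move=> M0; apply: (@itg_bounded _ M).
    by apply: measurable_minr => //; exact: measurable_cst.
  by move=> x; rewrite ger0_norm ?ge_min ?lexx ?orbT// le_min normr_ge0 ltW.
have bound n M : 0 < M -> `|\int[P]_x F n x - \int[P]_x f x| <=
    \int[P]_x Num.min `|F n x - f x| M + 4 * K / M.
  move=> M0; rewrite -RintB; [|exact: L2_itg|exact: L2_itg].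
  apply: (le_trans (le_norm_Rint (L2_itg (LD n)))).
  have i2 : itg P (fun x => M^-1 * (F n x - f x) ^+ 2) by apply: itgZ; exact: (LD n).2.
  apply: (@le_trans _ _ (\int[P]_x (Num.min `|F n x - f x| M +
      M^-1 * (F n x - f x) ^+ 2))).
    apply: le_Rint; [exact/itg_abs/L2_itg|by apply: itgD => //; exact: iM|].
    move=> x; rewrite -[(F n x - f x) ^+ 2]real_normK ?num_real//.
    set a := `|_|; have a0 : 0 <= a by exact: normr_ge0.
    have [aM|Ma] := leP a M.
      by rewrite lerDl mulr_ge0 ?sqr_ge0// invr_ge0 ltW.
    rewrite -(ler_pM2l M0) mulrDr mulrA divff ?gt_eqF// mul1r.
    by nra.
  rewrite RintD//; last exact: iM.
  rewrite lerD2l RintZ//; last exact: (LD n).2.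
  rewrite mulrC ler_pM2r ?invr_gt0// -ipE.
  have := ip_sum_le2 (LF n) (L2N Lf).
  have -> : ip P (fun x => - f x) (fun x => - f x) = ip P f f.
    by rewrite /ip; under eq_Rintegral do rewrite mulrNN.
  by have := FK n; lra.
have lim0 M : 0 < M ->
    (fun n => \int[P]_x Num.min `|F n x - f x| M) @ \oo --> 0.
  move=> M0; apply: fine_cvg.
  have [] := @dominated_convergence _ _ _ P setT measurableT
    (fun n x => (Num.min `|F n x - f x| M)%:E) (fun=> 0%E) (fun=> M%:E) _ _ _ _ _.
  - by move=> n; exact: measurable_int (iM n M M0).
  - exact: measurable_cst.
  - apply: filterS Ff => x cv _; apply/cvg_EFin; first exact: nearW.
    apply: (@cvg0_le _ _ (fun n => `|F n x - f x|)).
      have h := cvgB cv (cvg_cst (f x)); rewrite subrr in h.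
      by apply/norm_cvg0P; exact: h.
    by move=> n; rewrite ger0_norm ?ge_min ?lexx// le_min normr_ge0 ltW.
  - exact: itg_cst.
  - apply: nearW => x n _; rewrite lee_fin.
    by rewrite ger0_norm ?ge_min ?lexx ?orbT// le_min normr_ge0 ltW.
  - by move=> _ _; rewrite integral0.
apply/cvgrPdist_lt => e e0.
(* This [M] makes [4 K / M] at most [e / 2]; [K + 1] keeps it positive when [K = 0]. *)
pose M := 8 * (K + 1) / e.
have M0 : 0 < M by rewrite divr_gt0// mulr_gt0// ltr_wpDl.
have /cvgr0Pnorm_lt /(_ (e / 2)) := lim0 M M0.
rewrite divr_gt0// => /(_ isT); apply: filterS => n /=.
move=> hn; rewrite distrC (le_lt_trans (bound n M M0))//.
have : 4 * K / M <= e / 2.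
  rewrite ler_pdivrMr// /M.
  have -> : e / 2 * (8 * (K + 1) / e) = 4 * (K + 1) by field; rewrite gt_eqF.
  by lra.
by have := ler_norm (\int[P]_x Num.min `|F n x - f x| M); lra.
Qed.

(** The preceding convergence of integrals is applied to [(F n - f) ^+ 2], whose own L^2 norm is a
    fourth moment: [(F n - f)^2 <= 2 F n^2 + 2 f^2] gives the bound [8 K + 8 K]. *)
Lemma L2_cvg_bounded4 F f (K : R) : (forall n, L2 P (fun x => F n x ^+ 2)) ->
  (forall n, measurable_fun setT (F n)) ->
  measurable_fun setT f -> {ae P, forall x, F ^~ x @ \oo --> f x} ->
  (forall n, ip P (fun x => F n x ^+ 2) (fun x => F n x ^+ 2) <= K) ->
  L2 P f /\ (fun n => ip P (fun x => F n x - f x) (fun x => F n x - f x)) @ \oo --> 0.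
Proof.
move=> LF mF mf Ff FK.
have Ff2 : {ae P, forall x, (fun n => F n x ^+ 2) @ \oo --> f x ^+ 2}.
  apply: filterS Ff => x cv.
  exact: cvg_sqr.
have [Lf2 f2K] := ip_fatou LF (measurable_funX 2 mf) Ff2 FK.
split; first by split => //; exact: L2_itg.
suff : (fun n => \int[P]_x (F n x - f x) ^+ 2) @ \oo --> \int[P]_x (0 : R).
  rewrite Rint0 => h; rewrite (_ : (fun n => _) = (fun n =>
    \int[P]_x (F n x - f x) ^+ 2))//; by apply/funext => n; rewrite ipE.
have K0 : 0 <= K by rewrite (le_trans (ip_ge0 P _) f2K).
have mD n : measurable_fun setT (fun x => F n x - f x) by exact: measurable_funB.
have dom n x : `|(F n x - f x) ^+ 2| <= `|2 * F n x ^+ 2 + 2 * f x ^+ 2|.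
  rewrite ger0_norm ?sqr_ge0// ger0_norm; last first.
    by rewrite addr_ge0// mulr_ge0 ?sqr_ge0.
  by have := sqr_ge0 (F n x + f x); nra.
have Ls : forall k, L2 P (fun x => 2 * F k x ^+ 2 + 2 * f x ^+ 2).
  move=> k.
  by apply: L2D; exact: L2Z.
have LD n : L2 P (fun x => (F n x - f x) ^+ 2).
  by apply: (L2_le _ (Ls n)) => //; exact: measurable_funX.
apply: (@Rint_cvg_bounded2 _ _ (16 * K)) => //.
- apply: filterS Ff => x cv.
  rewrite -[X in _ --> X](expr0n R 2); apply: cvg_sqr.
  by have h := cvgB cv (cvg_cst (f x)); rewrite subrr in h; exact: h.
- move=> n; apply: (@le_trans _ _ (ip P (fun x => 2 * F n x ^+ 2 + 2 * f x ^+ 2)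
      (fun x => 2 * F n x ^+ 2 + 2 * f x ^+ 2))).
    rewrite !ipE; apply: le_Rint; [exact: (LD n).2|exact: (Ls n).2|].
    by move=> x; rewrite -ler_sqrt ?sqr_ge0// !sqrtr_sqr.
  apply: (le_trans (ip_sum_le2 (L2Z 2 (LF n)) (L2Z 2 Lf2))).
  rewrite !ipZl ?ipZr//; [|exact: L2Z|exact: L2Z].
  by have := FK n; lra.
Qed.

(** [D F c] is the graph of a linear functional on a subspace; a relation is convenient because the
    value is available only through an existential. The representative is the limit of a minimizing
    sequence of [|F|^2 - 2 c], hence a limit of elements of the domain, which is the last
    conclusion. *)
Lemma riesz (D : (T -> R) -> R -> Prop) (K : R) :
  (forall (F : T -> R) c, D F c -> L2 P F) ->
  (forall (F G : T -> R) c e, D F c -> D G e -> D (fun x => F x + G x) (c + e)) ->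
  (forall k (F : T -> R) c, D F c -> D (fun x => k * F x) (k * c)) ->
  D (fun=> 0) 0 -> 0 <= K ->
  (forall (F : T -> R) c, D F c -> c ^+ 2 <= K * ip P F F) ->
  exists X, [/\ L2 P X, forall (F : T -> R) c, D F c -> ip P F X = c &
    forall e, 0 < e -> exists (F : T -> R) c, D F c /\
      ip P (fun x => X x - F x) (fun x => X x - F x) <= e].
Proof.
move=> DL DD DZ D0 K0 DK.
pose J (F : T -> R) c := ip P F F - 2 * c.
have Jge (F : T -> R) c : D F c -> - K <= J F c.
  move=> DF; have := DK _ _ DF; have := ip_ge0 P F; rewrite /J => a0 cK.
  suff : 2 * c <= K + ip P F F by lra.
  apply: (le_trans (ler_norm _)); rewrite -(ger0_norm (addr_ge0 K0 a0)).
  rewrite -ler_sqr ?nnegrE// !real_normK ?num_real//.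
  by have := sqr_ge0 (K - ip P F F); nra.
pose S := [set j | exists (F : T -> R) c, D F c /\ j = J F c].
have S0 : S !=set0 by exists (J (fun=> 0) 0), (fun=> 0), 0.
have Slb : has_lbound S by exists (- K) => _ [F [c [DF ->]]]; exact: Jge.
have Sinf : has_inf S by [].
have JinfS (F : T -> R) c : D F c -> inf S <= J F c.
  by move=> DF; apply: ge_inf => //; exists F, c.
have qpos n : 0 < (4^-1 ^+ n / 4 : R) by rewrite divr_gt0// exprn_gt0// invr_gt0.
have /choice[Fc Fc_] : forall n, exists Fc : (T -> R) * R,
    D Fc.1 Fc.2 /\ J Fc.1 Fc.2 < inf S + 4^-1 ^+ n / 4.
  move=> n; have [_ [F [c [DF ->]]] lt] := inf_adherent (qpos n) Sinf.
  by exists (F, c).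
pose F n := (Fc n).1; pose c n := (Fc n).2.
have DF n : D (F n) (c n) by have [] := Fc_ n.
have Jlt n : J (F n) (c n) < inf S + 4^-1 ^+ n / 4 by have [] := Fc_ n.
have LF n : L2 P (F n) by exact: DL (DF n).
have [X [LX _ XF]] : exists f, [/\ L2 P f, {ae P, forall x, F ^~ x @ \oo --> f x} &
    forall n, ip P (fun x => f x - F n x) (fun x => f x - F n x) <= 4^-1 ^+ n].
  apply: L2_complete => // m n nm.
  (* The midpoint competes in the infimum: by the parallelogram identity [|F m - F n|^2 / 4] is the
     mean of the two values of [J] minus its value at the midpoint, hence at most [4^-n / 4]. *)
  have Dh := DZ 2^-1 _ _ (DD _ _ _ _ (DF m) (DF n)).
  have := JinfS _ _ Dh; rewrite /J.
  have LS := L2D (LF m) (LF n).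
  rewrite (ipZl _ LS (L2Z _ LS)) (ipZr _ LS LS) ipDD// ipBB//.
  have := Jlt m; have := Jlt n; rewrite /J.
  have : (4^-1 : R) ^+ m <= 4^-1 ^+ n.
    by apply: ler_wiXn2l; rewrite ?invr_ge0// invf_le1// ler1n.
  lra.
exists X; split=> //; last first.
  move=> e e0; have := @cvg_half R => /cvgr0Pnorm_lt /(_ e e0)[n _ /(_ n (leqnn n))] /= hn.
  exists (F n), (c n); split=> //; apply: (le_trans (XF n)).
  apply: (le_trans _ (ltW (le_lt_trans (ler_norm _) hn))).
  by rewrite lerXn2r ?nnegrE ?invr_ge0// lef_pV2 ?posrE// ler_nat.
move=> G e DG; have LG := DL _ _ DG.
(* First variation: [F n + t G] cannot bring [J] below the infimum, so a quadratic in [t] stays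
   nonnegative, and its discriminant bounds the defect of the representation at [F n]. *)
have var n : (ip P (F n) G - e) ^+ 2 <= 4^-1 ^+ n * ip P G G.
  have q t : 0 <= 4^-1 ^+ n + 2 * t * (ip P (F n) G - e) + t ^+ 2 * ip P G G.
    have Dt := DD _ _ _ _ (DF n) (DZ t _ _ DG).
    have := JinfS _ _ Dt; rewrite /J ipDD//; last exact: L2Z.
    rewrite ipZr ?ipZl ?ipZr//; last exact: L2Z.
    have := Jlt n; rewrite /J; have := qpos n; lra.
  have [g0|g0] := eqVneq (ip P G G) 0; last first.
    have gp : 0 < ip P G G by rewrite lt_neqAle eq_sym g0 ip_ge0.
    have := q (- (ip P (F n) G - e) / ip P G G).
    rewrite -(pmulr_rge0 _ gp).
    have -> : ip P G G * (4^-1 ^+ n + 2 * (- (ip P (F n) G - e) / ip P G G) *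
       (ip P (F n) G - e) + (- (ip P (F n) G - e) / ip P G G) ^+ 2 * ip P G G)
      = 4^-1 ^+ n * ip P G G - (ip P (F n) G - e) ^+ 2 by field.
    by rewrite subr_ge0.
  have e0 : e = 0.
    by apply/eqP; rewrite -sqrf_eq0 eq_le sqr_ge0 andbT (le_trans (DK _ _ DG))// g0 mulr0.
  have : ip P (F n) G ^+ 2 <= 0 by rewrite (le_trans (ip_CS (LF n) LG))// g0 mulr0.
  by rewrite e0 subr0 g0 mulr0.
suff h : (ip P X G - e) ^+ 2 <= 0.
  apply/eqP; rewrite ipC -subr_eq0 -sqrf_eq0 eq_le h; exact: sqr_ge0.
apply: (@le_cvg0 _ _ (fun n => 4 * ip P G G * 4^-1 ^+ n)).
  rewrite -[X in _ --> X](mulr0 (4 * ip P G G)); apply: cvgM; first exact: cvg_cst.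
  by apply: cvg_expr; rewrite ger0_norm ?invr_ge0// invf_lt1// ltr1n.
move=> n; have := ip_CS (L2B LX (LF n)) LG; rewrite ipBl//.
have := var n; have := XF n; have := ip_ge0 P G.
move=> g0 h1 h2 h3.
have : ip P (fun x => X x - F n x) (fun x => X x - F n x) * ip P G G <=
  4^-1 ^+ n * ip P G G by exact: ler_wpM2r.
have := sqr_ge0 ((ip P X G - ip P (F n) G) - (ip P (F n) G - e)).
nra.
Qed.

End L2_limits.

Lemma Rint_dct d (T : measurableType d) (R : realType)
    (mu : {measure set T -> \bar R}) (F : nat -> T -> R) (f g : T -> R) :
  (forall n, measurable_fun setT (F n)) -> measurable_fun setT f ->
  {ae mu, forall x, F ^~ x @ \oo --> f x} -> itg mu g ->
  (forall n x, `|F n x| <= g x) ->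
  itg mu f /\ (fun n => \int[mu]_x F n x) @ \oo --> \int[mu]_x f x.
Proof.
move=> mF mf Ff ig Fg.
have [|||||fi _ cv] := @dominated_convergence _ _ _ mu setT measurableT
    (fun n x => (F n x)%:E) (EFin \o f) (EFin \o g).
- by move=> n; exact/measurable_EFinP.
- exact/measurable_EFinP.
- by apply: filterS Ff => x cv _; apply/cvg_EFin => //; exact: nearW.
- exact: ig.
- by apply: nearW => x n _ /=; rewrite lee_fin.
split=> //; apply: fine_cvg.
by rewrite EFin_Rint.
Qed.

(** * Integration against a measure given by a density *)

Section density.
Context d (T : measurableType d) (R : realType).
Variables mu nu : {measure set T -> \bar R}.
Variable p : T -> R.
Hypothesis mp : measurable_fun setT p.
Hypothesis p0 : forall x, 0 <= p x.
Hypothesis nuE : forall A, measurable A -> nu A = (\int[mu]_(x in A) (p x)%:E)%E.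

Import HBNNSimple.

Lemma ge0_integral_density (f : T -> \bar R) : measurable_fun setT f ->
  (forall x, 0 <= f x)%E ->
  (\int[nu]_x f x = \int[mu]_x (f x * (p x)%:E))%E.
Proof.
move=> mf f0; pose h := nnsfun_approx measurableT mf.
have hf x : (fun n => (h n x)%:E) @ \oo --> f x by exact: cvg_nnsfun_approx.
have h_nd x : {homo (fun n => (h n x)%:E) : a b / (a <= b)%N >-> (a <= b)%E}.
  by move=> a b ab; rewrite lee_fin; exact/lefP/nd_nnsfun_approx.
transitivity (limn (fun n => \int[nu]_x (h n x)%:E)%E).
  rewrite -monotone_convergence//.
  - by apply: eq_integral => x _; apply/esym/cvg_lim.
  - by move=> n; apply/measurable_EFinP.
  - by move=> n x _; rewrite lee_fin.
transitivity (limn (fun n => \int[mu]_x ((h n x)%:E * (p x)%:E))%E); last first.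
  rewrite -monotone_convergence//.
  - apply: eq_integral => x _; apply/cvg_lim => //.
    by apply: cvgeZr => //; exact: hf.
  - by move=> n; apply: emeasurable_funM; exact/measurable_EFinP.
  - by move=> n x _; rewrite mule_ge0 ?lee_fin.
  - by move=> x _ a b ab; rewrite lee_wpmul2r ?lee_fin//; exact/lefP/nd_nnsfun_approx.
congr (limn _); apply/funext => n.
rewrite integral_nnsfun// sintegralE.
rewrite (@eq_fsbigr _ _ _ _ _ (fun y => y%:E * \int[mu]_(x in h n @^-1` [set y]) (p x)%:E)%E); last first.
  by move=> y _; rewrite patch_setT nuE.
have -> : (fun x => (h n x)%:E * (p x)%:E)%E =
    (fun x => \sum_(y \in range (h n)) (y * \1_(h n @^-1` [set y]) x * p x)%:E)%E.
  apply/funext => x; rewrite fsumEFin// -EFinM -mulr_fsuml; congr (_ * _)%:E.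
  exact: fimfunE.
rewrite ge0_integral_fsum//; last 2 first.
  - move=> y; apply/measurable_EFinP; apply: measurable_funM => //.
    exact: measurable_funM.
  - move=> y x _; rewrite lee_fin mulr_ge0//.
    by have := nnfun_muleindic_ge0 (h n) y x; rewrite -EFinM lee_fin.
rewrite patch_setT; apply: eq_fsbigr => y _.
rewrite integral_mkcond.
have [y0|y0] := ltP y 0.
  have -> : h n @^-1` [set y] = set0.
    by apply/seteqP; split=> // x /= hy; move: y0; rewrite -hy ltNge fun_ge0.
  rewrite integral0_eq ?mule0; last by move=> x _; rewrite patchE in_set0.
  by rewrite integral0_eq// => x _; rewrite indic0 mulr0 mul0r.
rewrite -ge0_integralZl//.
- apply: eq_integral => x _; rewrite patchE /=.
  case: ifPn => [xh|xh]; first by rewrite indicE xh mulr1.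
  by rewrite indicE (negbTE xh) mulr0 mul0r mule0.
- by apply/(measurable_restrictT _ _).1 => //; apply/measurable_funTS/measurable_EFinP.
- by move=> x _; rewrite patchE; case: ifP; rewrite ?lee_fin.
Qed.

Lemma itg_density (f : T -> R) : measurable_fun setT f ->
  itg nu f <-> itg mu (fun x => f x * p x).
Proof.
move=> mf; have e : (\int[nu]_x `|(f x)%:E| = \int[mu]_x `|(f x * p x)%:E|)%E.
  rewrite ge0_integral_density//; last by apply: measurableT_comp => //; exact/measurable_EFinP.
  by apply: eq_integral => x _; rewrite EFinM abseM (gee0_abs (_ : 0 <= (p x)%:E)%E) ?lee_fin.
split=> /integrableP[_ fi]; apply/integrableP; split.
- by apply/measurable_EFinP; exact: measurable_funM.
- by rewrite -e.
- exact/measurable_EFinP.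
- by rewrite e.
Qed.

Lemma Rint_density (f : T -> R) : itg nu f ->
  \int[nu]_x f x = \int[mu]_x (f x * p x).
Proof.
move=> fi; have mf := itg_meas fi.
have fip : itg mu (fun x => f x * p x) by apply/itg_density.
rewrite /Rintegral; congr fine; rewrite integralE [RHS]integralE.
congr (_ - _)%E; rewrite ge0_integral_density//.
- by apply: eq_integral => x _; rewrite !funeposE/= -!EFin_max -EFinM maxr_pMl// mul0r.
- exact/measurable_funepos/measurable_EFinP.
- by apply: eq_integral => x _; rewrite !funenegE/= -!EFin_max -EFinM maxr_pMl// mul0r -mulNr.
- exact/measurable_funeneg/measurable_EFinP.
Qed.

End density.

(** * The centred Gaussian law: exponential moments and integration by parts *)

Section gaussian.
Context (R : realType).
Variable s : R.
Hypothesis s_gt0 : 0 < s.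
Local Notation gam := (normal_prob 0 s).
Local Notation leb := (@lebesgue_measure R).
Let s_neq0 : s != 0. Proof. by rewrite gt_eqF. Qed.

Let pdf x := normal_peak s * expR (- (x ^+ 2 / (2 * s ^+ 2))).

Let pdfE x : normal_pdf 0 s x = pdf x.
Proof.
by rewrite normal_pdfE// /normal_fun subr0 mulNr -mulr_natl.
Qed.

Let pdf_ge0 x : 0 <= pdf x.
Proof. by rewrite mulr_ge0 ?expR_ge0 ?normal_peak_ge0. Qed.

Let mpdf : measurable_fun setT pdf.
Proof.
rewrite (_ : pdf = normal_pdf 0 s); first exact: measurable_normal_pdf.
by apply/funext => x; rewrite pdfE.
Qed.

Let gamE A : measurable A -> gam A = (\int[leb]_(x in A) (pdf x)%:E)%E.
Proof.
by move=> mA; rewrite /normal_prob; apply: eq_integral => x _; rewrite pdfE.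
Qed.

(** Completing the square: [c |x| - x^2 / (2 s^2) <= c^2 s^2 - x^2 / (4 s^2)], and the last term is
    the exponent of a Gaussian of variance [2 s^2]. *)
Lemma pdf_exp_bound c : exists M, 0 <= M /\
  forall x, expR (c * `|x|) * pdf x <= M * normal_pdf 0 (Num.sqrt 2 * s) x.
Proof.
have s2 : Num.sqrt 2 * s != 0 by rewrite gt_eqF// mulr_gt0// sqrtr_gt0.
exists (normal_peak s * expR (c ^+ 2 * s ^+ 2) / normal_peak (Num.sqrt 2 * s)).
split; first by rewrite divr_ge0 ?mulr_ge0 ?expR_ge0 ?normal_peak_ge0.
move=> x; rewrite [X in _ <= X](_ : _ = normal_peak s * expR (c ^+ 2 * s ^+ 2) *
    normal_fun 0 (Num.sqrt 2 * s) x); last first.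
  rewrite normal_pdfE// mulrA divfK//.
  by rewrite gt_eqF// normal_peak_gt0.
rewrite /pdf mulrCA -mulrA ler_wpM2l ?normal_peak_ge0// /normal_fun -!expRD ler_expR.
rewrite subr0 exprMn sqr_sqrtr//.
rewrite -(ler_pM2r (_ : 0 < 4 * s ^+ 2)); last by rewrite mulr_gt0// exprn_gt0.
rewrite -[(2 * s ^+ 2) *+ 2]mulr_natl.
have -> : (c * `|x| - x ^+ 2 / (2 * s ^+ 2)) * (4 * s ^+ 2) =
  4 * s ^+ 2 * c * `|x| - 2 * x ^+ 2 by field.
have -> : (c ^+ 2 * s ^+ 2 + - x ^+ 2 / (2 * (2 * s ^+ 2))) * (4 * s ^+ 2) =
  4 * c ^+ 2 * s ^+ 4 - x ^+ 2 by field.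
rewrite -[x ^+ 2]real_normK ?num_real//.
have := sqr_ge0 (2 * s ^+ 2 * c - `|x|).
have -> : (2 * s ^+ 2 * c - `|x|) ^+ 2 = 4 * s ^+ 4 * c ^+ 2 - 4 * s ^+ 2 * c * `|x| + `|x| ^+ 2 by ring.
nra.
Qed.

Lemma gauss_itg_exp c : itg gam (fun x => expR (c * `|x|)).
Proof.
have me : measurable_fun setT (fun x : R => expR (c * `|x|)).
  by apply: measurableT_comp => //; apply: measurable_funM => //; exact: normr_measurable.
apply: (@itg_density _ _ R leb gam pdf mpdf pdf_ge0 gamE _ me).2.
have [M [M0 hM]] := pdf_exp_bound c.
have s2 : Num.sqrt 2 * s != 0 by rewrite gt_eqF// mulr_gt0// sqrtr_gt0.
have ip2 : itg leb (normal_pdf 0 (Num.sqrt 2 * s)) by exact: integrable_normal_pdf.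
apply: (itg_le _ (itgZ M ip2)).
  exact: measurable_funM.
move=> x; rewrite ger0_norm; last by rewrite mulr_ge0 ?expR_ge0.
by rewrite (le_trans (hM x))// ler_norm.
Qed.

Let dpdf (x : R) : is_derive x 1 pdf (- (x / s ^+ 2) * pdf x).
Proof.
pose c := - (2 * s ^+ 2)^-1.
have e : pdf = normal_peak s *: (expR \o (fun z => c * z ^+ 2)).
  apply/funext => y; rewrite /pdf /c /=; congr (_ * expR _).
  by rewrite mulNr mulrC.
have d0 : is_derive x 1 (fun z : R => c * z ^+ 2) (c * (2 * x)).
  have := is_deriveZ c (is_deriveX 2 (is_derive_id x 1)).
  by rewrite /GRing.scale/= expr1 mulr1.
have d2 := is_deriveZ (normal_peak s) (@is_derive1_comp R expR (fun z => c * z ^+ 2) x _ _ (is_derive_expR _) d0).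
rewrite {1}e; apply: is_derive_eq; rewrite e /GRing.scale/= /c.
by rewrite /GRing.scale/=; field.
Qed.

(** The density [p] satisfies [p' = - (x / s^2) p], so [(s^2 g' - x g) p] is the derivative of
    [s^2 g p], which vanishes at infinity. The integral is taken over [[-n-1, n+1]] and then passed
    to the limit. *)
Lemma gauss_ibp (g g' : R -> R) (C c : R) :
  (forall x : R, is_derive x 1 g (g' x)) -> continuous g' ->
  (forall x, `|g x| <= C * expR (c * `|x|)) ->
  (forall x, `|g' x| <= C * expR (c * `|x|)) ->
  \int[gam]_x (x * g x) = s ^+ 2 * \int[gam]_x g' x.
Proof.
move=> dg cg' gC g'C.
have C0 : 0 <= C.
  by have := le_trans (normr_ge0 _) (gC 0); rewrite normr0 mulr0 expR0 mulr1.
have cg : continuous g.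
  by move=> x; apply: differentiable_continuous; apply/derivable1_diffP; case: (dg x).
have mg : measurable_fun setT g by exact: continuous_measurable_fun.
have mg' : measurable_fun setT g' by exact: continuous_measurable_fun.
have iE k := gauss_itg_exp k.
have ig' : itg gam g'.
  apply: (itg_le _ (itgZ C (iE c))) => // x.
  by rewrite [X in _ <= X]ger0_norm ?mulr_ge0 ?expR_ge0.
have ixg : itg gam (fun x => x * g x).
  apply: (itg_le _ (itgZ C (iE (c + 1)))); first exact: measurable_funM.
  move=> x; rewrite [X in _ <= X]ger0_norm ?mulr_ge0 ?expR_ge0//.
  rewrite normrM mulrDl mul1r expRD mulrA mulrC ler_pM//.
  by rewrite (le_trans _ (expR_ge1Dx _))// lerDr.
have ih : itg gam (fun x => s ^+ 2 * g' x - x * g x) by apply: itgB => //; exact: itgZ.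
apply/eqP; rewrite eq_sym -subr_eq0 -RintZ// -RintB//; last exact: itgZ.
apply/eqP; rewrite (@Rint_density _ _ R leb gam pdf mpdf pdf_ge0 gamE)//.
pose h x := (s ^+ 2 * g' x - x * g x) * pdf x.
pose F x := s ^+ 2 * (g x * pdf x).
have ihl : itg leb h by exact: (@itg_density _ _ R leb gam pdf mpdf pdf_ge0 gamE _ (itg_meas ih)).1 ih.
have dF (x : R) : is_derive x 1 F (h x).
  apply: (is_derive_eq (is_deriveZ (s ^+ 2) (is_deriveM (dg x) (dpdf x)))).
  by rewrite /GRing.scale/= /h; field.
have cpdf : continuous pdf.
  by move=> x; apply: differentiable_continuous; apply/derivable1_diffP; case: (dpdf x).
have ch : continuous h.
  move=> x; apply: cvgM; last exact: cpdf.
  apply: cvgB; first by apply: cvgM; [exact: cvg_cst|exact: cg'].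
  by apply: cvgM; [exact: cvg_id|exact: cg].
have cF : continuous F.
  by move=> x; apply: differentiable_continuous; apply/derivable1_diffP; case: (dF x).
have ftc (n : nat) : \int[leb]_x (h \_ `[- n.+1%:R, n.+1%:R]) x = F n.+1%:R - F (- n.+1%:R).
  rewrite -Rintegral_mkcond /Rintegral (@continuous_FTC2 _ h F) //.
  - by have n0 : 0 < n.+1%:R :> R by []; lra.
  - exact: continuous_subspaceT.
  - split=> [x _||]; first by case: (dF x).
      by apply: cvg_at_right_filter; exact: cF.
    by apply: cvg_at_left_filter; exact: cF.
  - by move=> x _; rewrite derive1E; case: (dF x).
have [_ lim1] : itg leb h /\ (fun n => \int[leb]_x (h \_ `[- n.+1%:R, n.+1%:R]) x) @ \oo -->
    \int[leb]_x h x.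
  apply: (@Rint_dct _ _ R leb (fun n : nat => h \_ `[- n.+1%:R, n.+1%:R]) h (fun x => `|h x|)).
  - move=> n; apply: (measurable_restrictT h _).1 => //; apply: measurable_funTS.
    exact: continuous_measurable_fun.
  - exact: continuous_measurable_fun.
  - apply: nearW => x; apply: cvg_near_cst.
    near=> n; rewrite patchE mem_set//= in_itv/= -ler_norml.
    apply: ltW; apply: (@lt_le_trans _ _ n%:R); last by rewrite ler_nat.
    by near: n; exact: nbhs_infty_gtr.
  - exact: itg_abs.
  - by move=> n x; rewrite patchE; case: ifP; rewrite ?normr0.
(* The extra 1 in [c + 1] leaves a factor [expR (- |x|)] in the bound on [F]. *)
have [M [M0 hM]] := pdf_exp_bound (c + 1).
pose M' := s ^+ 2 * (C * (M * normal_peak (Num.sqrt 2 * s))).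
have s2 : Num.sqrt 2 * s != 0 by rewrite gt_eqF// mulr_gt0// sqrtr_gt0.
have Fb x : `|F x| <= M' * expR (- `|x|).
  rewrite /F normrM ger0_norm ?sqr_ge0// /M' -mulrA ler_wpM2l ?sqr_ge0//.
  rewrite normrM [`|pdf x|]ger0_norm//.
  rewrite (le_trans (ler_wpM2r (pdf_ge0 x) (gC x)))//.
  rewrite -!mulrA ler_wpM2l// mulrA.
  rewrite -(ler_pM2l (expR_gt0 `|x|)).
  have -> : expR `|x| * (M * normal_peak (Num.sqrt 2 * s) * expR (- `|x|)) =
     M * normal_peak (Num.sqrt 2 * s).
    by rewrite mulrCA -expRD addrN expR0 mulr1.
  rewrite mulrA -expRD -[X in expR (X + _)]mul1r -mulrDl addrC.
  rewrite (le_trans (hM x))// ler_wpM2l//.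
  exact: normal_pdf_ub.
apply: (cvg_unique _ lim1) => //.
have Fn0 (sg : R) : `|sg| = 1 -> (fun n : nat => F (sg * n.+1%:R)) @ \oo --> 0.
  move=> sg1; apply: (@cvg0_le _ _ (fun n => M' * expR (- 1) ^+ n)).
    rewrite -[X in _ --> X](mulr0 M'); apply: cvgM; first exact: cvg_cst.
    have e1 : expR (- 1) < 1 :> R by rewrite -[ltRHS]expR0 ltr_expR; lra.
    by apply: cvg_expr; rewrite ger0_norm ?expR_ge0.
  move=> n; rewrite (le_trans (Fb _))// ler_wpM2l//.
    by rewrite /M' mulr_ge0 ?sqr_ge0// mulr_ge0// mulr_ge0// normal_peak_ge0.
  rewrite normrM sg1 mul1r ger0_norm// -expRM_natl ler_expR.
  by rewrite mulrN1 lerN2 ler_nat.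
have := cvgB (Fn0 1 (normr1 _)) (Fn0 (-1) (normrN1 _)); rewrite subr0 => lim0.
suff e : (fun n : nat => \int[leb]_x (h \_ `[- n.+1%:R, n.+1%:R]) x) =
  (fun n : nat => F (1 * n.+1%:R)) \- (fun n : nat => F (- 1 * n.+1%:R)).
  by rewrite e; exact: lim0.
by apply/funext => n /=; rewrite mul1r mulN1r; exact: ftc.
Unshelve. all: by end_near.
Qed.

End gaussian.

(** * Decoupling a random variable from an independent sigma-algebra *)

Section decoupling.
Context d (Om : measurableType d) (R : realType) (P : probability Om R).
Variables (X : Om -> R) (nu : probability (measurableTypeR R) R).
Variable G : set (set Om).
Hypothesis mX : measurable_fun setT X.
Hypothesis mG : G `<=` measurable.
Hypothesis GT : G setT.
Hypothesis GI : setI_closed G.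
Hypothesis PGX : forall S A, G S -> measurable A ->
  P (S `&` X @^-1` A) = (P S * nu A)%E.

Local Notation OmG := (g_sigma_algebraType G).

Let mXA A : measurable A -> measurable (X @^-1` A).
Proof. by move=> mA; rewrite -[_ @^-1` _]setTI; exact: mX. Qed.

Let PsGX S A : <<s G >> S -> measurable A ->
  P (S `&` X @^-1` A) = (P S * nu A)%E.
Proof.
move=> sGS mA.
have nuA : nu A \is a fin_num by exact: fin_num_measure.
have nuA0 : 0 <= fine (nu A) by exact: fine_ge0.
(* Both sides are finite measures of [S] that agree on the pi-system [G], hence on the sigma-algebra
   it generates. *)
have h : mrestr P (mXA mA) S = mscale (NngNum nuA0) P S.
  apply: (@g_sigma_algebra_measure_unique _ _ _ G mG (fun=> setT) (fun=> GT)) => //.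
  - by rewrite bigcup_const//; exists 0%N.
  - move=> U GU.
    change (P (U `&` X @^-1` A) = ((fine (nu A))%:E * P U)%E).
    by rewrite PGX// muleC fineK.
  - move=> _; change (P (setT `&` X @^-1` A) < +oo)%E.
    by rewrite setTI ltey_eq fin_num_measure//; exact: mXA.
have {}h : P (S `&` X @^-1` A) = ((fine (nu A))%:E * P S)%E by exact: h.
by rewrite h fineK// muleC.
Qed.

Let idm : measurable_fun setT (id : Om -> OmG).
Proof.
move=> _ A sA; rewrite setTI preimage_id.
exact: (smallest_sub (@sigma_algebra_measurable _ Om) mG).
Qed.

Let phi0 (w : Om) : measurableTypeR R * OmG := (X w, w).
Let mphi : measurable_fun setT phi0.
Proof. exact: measurable_fun_pair. Qed.
Let phi : {mfun Om >-> (measurableTypeR R * OmG)%type} :=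
  HB.pack phi0 (isMeasurableFun.Build _ _ _ _ _ mphi).

Let idG : {mfun Om >-> OmG} :=
  HB.pack (id : Om -> OmG) (isMeasurableFun.Build _ _ _ _ _ idm).
Let P' := distribution P idG.

Let phiE A : measurable A -> (nu \x P')%E A = pushforward P phi A.
Proof.
move=> mA; apply: (product_measure_unique (m' := pushforward P phi)) => // U V mU mV.
rewrite /= /pushforward (_ : phi @^-1` (U `*` V) = V `&` X @^-1` U); last first.
  by apply/seteqP; split => w [].
by rewrite PsGX// muleC.
Qed.

(** The pair [(X, id)], with the sample space carrying the sigma-algebra generated by [G], has a
    product law, so Fubini integrates [X] out first. Keeping the sample point itself as second
    coordinate avoids building a vector of the remaining increments. *)
Lemma decoupling0 (Gam : R * OmG -> R) : measurable_fun setT Gam ->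
  itg P (fun w => Gam (X w, w)) ->
  (forall w, itg nu (fun x => Gam (x, w))) ->
  (forall w, \int[nu]_x Gam (x, w) = 0) ->
  \int[P]_w Gam (X w, w) = 0.
Proof.
move=> mGam iGam i1 z1.
have mE : measurable_fun setT (EFin \o Gam) by exact/measurable_EFinP.
have eqpush (f : R * OmG -> \bar R) :
    (\int[nu \x P']_z f z = \int[pushforward P phi]_z f z)%E.
  by apply: eq_measure_integral => A mA _; exact: phiE.
have ipush : (pushforward P phi).-integrable setT (EFin \o Gam).
  exact: integrable_pushforward.
have iprod : (nu \x P')%E.-integrable setT (EFin \o Gam).
  apply/integrableP; split => //; rewrite eqpush.
  by have /integrableP[] := ipush.
rewrite /Rintegral; transitivity (fine (\int[pushforward P phi]_z (Gam z)%:E)%E).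
  by congr fine; rewrite integral_pushforward.
rewrite -eqpush -integral21_prod_meas1//.
rewrite (eq_integral (fun=> 0%E)) ?integral0// => w _.
by rewrite /fubini_G/= -EFin_Rint// z1.
Qed.

End decoupling.

(** * Functions of finitely many variables with exponential growth *)

Section smooth_class.
Context (R : realType).

Definition sumabs r (x : 'I_r -> R) : R := \sum_i `|x i|.

Definition line r (x v : 'I_r -> R) (t : R) : 'I_r -> R := fun i => x i + t * v i.

(** Measurability is expressed through composition with an arbitrary source, so that the same
    function can later be tested against smaller sigma-algebras on the sample space. Continuity
    along lines is what integration by parts in one coordinate asks for. *)
Record nice r (G : ('I_r -> R) -> R) : Prop := {
  nice_meas : forall d (S : measurableType d) (v : 'I_r -> S -> R),
    (forall i, measurable_fun setT (v i)) ->
    measurable_fun setT (fun z => G (fun i => v i z));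
  nice_growth : exists C c : R, [/\ 0 <= C, 0 <= c &
    forall x, `|G x| <= C * expR (c * sumabs x)];
  nice_cont : forall x v, continuous (fun t => G (line x v t)) }.

(** Differentiability along every line, and not only along the axes, makes the class stable under
    the linear substitutions of [C1_lincomb]. *)
Record C1 r (G : ('I_r -> R) -> R) (dG : 'I_r -> ('I_r -> R) -> R) : Prop := {
  C1_nice : nice G;
  C1_dnice : forall i, nice (dG i);
  C1_der : forall x v (t : R),
    is_derive t 1 (fun t => G (line x v t)) (\sum_i v i * dG i (line x v t)) }.

Lemma sumabs_ge0 r (x : 'I_r -> R) : 0 <= sumabs x.
Proof. by apply: sumr_ge0. Qed.

Lemma nice_cst r (k : R) : nice (fun _ : 'I_r -> R => k).
Proof.
split=> [d S v mv||x v]; first exact: measurable_cst.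
  exists `|k|, 0; split=> // x; by rewrite mul0r expR0 mulr1.
by move=> t; exact: cvg_cst.
Qed.

Lemma nice_coord r (i : 'I_r) : nice (fun x : 'I_r -> R => x i).
Proof.
split=> [d S v mv||x v]; first exact: mv.
  exists 1, 1; split=> // x; rewrite !mul1r (le_trans _ (expR_ge1Dx _))//.
  by rewrite /sumabs (bigD1 i)//= addrCA lerDl addr_ge0// sumr_ge0.
move=> t; apply: cvgD; first exact: cvg_cst.
by apply: cvgM; [exact: cvg_id|exact: cvg_cst].
Qed.

Lemma nice_add r (F G : ('I_r -> R) -> R) : nice F -> nice G ->
  nice (fun x => F x + G x).
Proof.
move=> [mF [C [c [C0 c0 gF]]] cF] [mG [E [e [E0 e0 gG]]] cG].
split=> [d S v mv||x v].
- by apply: measurable_funD; [exact: mF|exact: mG].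
- exists (C + E), (c + e); split; rewrite ?addr_ge0// => x.
  rewrite (le_trans (ler_normD _ _))// mulrDl lerD//.
    rewrite (le_trans (gF x))// ler_wpM2l// ler_expR ler_wpM2r ?sumabs_ge0//.
    by rewrite lerDl.
  rewrite (le_trans (gG x))// ler_wpM2l// ler_expR ler_wpM2r ?sumabs_ge0//.
  by rewrite lerDr.
- by move=> t; apply: cvgD; [exact: cF|exact: cG].
Qed.

Lemma nice_mul r (F G : ('I_r -> R) -> R) : nice F -> nice G ->
  nice (fun x => F x * G x).
Proof.
move=> [mF [C [c [C0 c0 gF]]] cF] [mG [E [e [E0 e0 gG]]] cG].
split=> [d S v mv||x v].
- by apply: measurable_funM; [exact: mF|exact: mG].
- exists (C * E), (c + e); split; rewrite ?addr_ge0 ?mulr_ge0// => x.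
  by rewrite normrM mulrDl expRD mulrACA ler_pM.
- by move=> t; apply: cvgM; [exact: cF|exact: cG].
Qed.

Lemma nice_sum r I (s : seq I) (Q : pred I) (F : I -> ('I_r -> R) -> R) :
  (forall i, Q i -> nice (F i)) -> nice (fun x => \sum_(i <- s | Q i) F i x).
Proof.
move=> nF; elim: s => [|i s IH].
  rewrite (_ : (fun _ => _) = (fun=> 0)); first exact: nice_cst.
  by apply/funext => x; rewrite big_nil.
rewrite (_ : (fun _ => _) = (fun x => if Q i then F i x +
    \sum_(j <- s | Q j) F j x else \sum_(j <- s | Q j) F j x)); last first.
  by apply/funext => x; rewrite big_cons.
by case Qi : (Q i) => //; apply: nice_add => //; exact: nF.
Qed.

Definition lincomb r q (A : 'I_q -> 'I_r -> R) (x : 'I_r -> R) : 'I_q -> R :=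
  fun j => \sum_i A j i * x i.

Lemma lincomb_line r q (A : 'I_q -> 'I_r -> R) x v t :
  lincomb A (line x v t) = line (lincomb A x) (lincomb A v) t.
Proof.
apply/funext => j; rewrite /lincomb /line mulr_sumr -big_split/=.
by apply: eq_bigr => i _; rewrite mulrDr mulrCA.
Qed.

Lemma nice_lincomb r q (A : 'I_q -> 'I_r -> R) (G : ('I_q -> R) -> R) :
  nice G -> nice (fun x => G (lincomb A x)).
Proof.
move=> [mG [C [c [C0 c0 gG]]] cG]; split=> [d S v mv||x v].
- apply: mG => j; apply: measurable_sum => i.
  by apply: measurable_funM => //; exact: mv.
- exists C, (c * \sum_j \sum_i `|A j i|); split => //.
    by rewrite mulr_ge0// sumr_ge0// => j _; exact: sumr_ge0.
  move=> x; rewrite (le_trans (gG _))// ler_wpM2l// ler_expR -mulrA ler_wpM2l//.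
  rewrite /sumabs mulr_suml; apply: ler_sum => j _; rewrite /lincomb.
  rewrite (le_trans (ler_norm_sum _ _ _))// mulr_suml; apply: ler_sum => i _.
  rewrite normrM ler_wpM2l// (bigD1 i)//= lerDl sumr_ge0//.
- by under eq_fun do rewrite lincomb_line; exact: cG.
Qed.

Lemma C1_cst r (k : R) : C1 (fun _ : 'I_r -> R => k) (fun _ _ => 0).
Proof.
split=> [|i|x v t]; [exact: nice_cst|exact: nice_cst|].
rewrite big1 => [|i _]; [exact: is_derive_cst|by rewrite mulr0].
Qed.

Lemma C1_coord r (k : 'I_r) :
  C1 (fun x : 'I_r -> R => x k) (fun i _ => (i == k)%:R).
Proof.
split=> [|i|x v t]; [exact: nice_coord|exact: nice_cst|].
rewrite (bigD1 k)//= eqxx mulr1 big1 ?addr0; last first.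
  by move=> i /negbTE ->; rewrite mulr0.
apply: (is_derive_eq (is_deriveD (is_derive_cst (x k) t 1)
  (is_deriveM (is_derive_id t 1) (is_derive_cst (v k) t 1)))).
by rewrite /GRing.scale/= mulr0 !add0r mulr1.
Qed.

Lemma C1_add r (F G : ('I_r -> R) -> R) dF dG : C1 F dF -> C1 G dG ->
  C1 (fun x => F x + G x) (fun i x => dF i x + dG i x).
Proof.
move=> [nF ndF eF] [nG ndG eG]; split=> [|i|x v t].
- exact: nice_add.
- exact: nice_add.
- apply: (is_derive_eq (is_deriveD (eF x v t) (eG x v t))).
  by rewrite -big_split/=; apply: eq_bigr => i _; rewrite mulrDr.
Qed.

Lemma C1_mul r (F G : ('I_r -> R) -> R) dF dG : C1 F dF -> C1 G dG ->
  C1 (fun x => F x * G x) (fun i x => dF i x * G x + F x * dG i x).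
Proof.
move=> [nF ndF eF] [nG ndG eG]; split=> [|i|x v t].
- exact: nice_mul.
- by apply: nice_add; exact: nice_mul.
- apply: (is_derive_eq (is_deriveM (eF x v t) (eG x v t))).
  rewrite /GRing.scale/= !mulr_sumr -big_split/=; apply: eq_bigr => i _.
  ring.
Qed.

Lemma C1_lincomb r q (A : 'I_q -> 'I_r -> R) (G : ('I_q -> R) -> R) dG :
  C1 G dG -> C1 (fun x => G (lincomb A x))
    (fun i x => \sum_j A j i * dG j (lincomb A x)).
Proof.
move=> [nG ndG eG]; split=> [|i|x v t].
- exact: nice_lincomb.
- apply: nice_sum => j _; apply: nice_mul; first exact: nice_cst.
  exact: (@nice_lincomb _ _ A (dG j)).
- rewrite (_ : (fun _ => _) = (fun t => G (line (lincomb A x) (lincomb A v) t))); last first.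
    by apply/funext => s; rewrite lincomb_line.
  apply: (is_derive_eq (eG _ _ t)); rewrite lincomb_line /lincomb.
  rewrite (eq_bigr (fun j => \sum_i A j i * v i * dG j (line (lincomb A x) (lincomb A v) t))).
    rewrite exchange_big/=; apply: eq_bigr => i _; rewrite mulr_sumr.
    by apply: eq_bigr => j _; ring.
  by move=> j _; rewrite mulr_suml.
Qed.

Lemma C1_pow r (F : ('I_r -> R) -> R) dF k : C1 F dF ->
  C1 (fun x => F x ^+ k.+1) (fun i x => k.+1%:R * F x ^+ k * dF i x).
Proof.
move=> cF; elim: k => [|k IH].
  rewrite (_ : (fun x => F x ^+ 1) = F); last by apply/funext => x; rewrite expr1.
  rewrite (_ : (fun i x => 1%:R * F x ^+ 0 * dF i x) = dF)//.
  by apply/funext => i; apply/funext => x; rewrite expr0 !mul1r.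
rewrite (_ : (fun x => F x ^+ k.+2) = (fun x => F x * F x ^+ k.+1)); last first.
  by apply/funext => x; rewrite exprS.
rewrite (_ : (fun i x => k.+2%:R * F x ^+ k.+1 * dF i x) =
  (fun i x => dF i x * F x ^+ k.+1 + F x * (k.+1%:R * F x ^+ k * dF i x))).
  exact: C1_mul.
apply/funext => i; apply/funext => x.
by rewrite !exprS -[k.+2]addn1 natrD; ring.
Qed.

End smooth_class.

(** * Dyadic grids and normalized increments *)

Section grid.
Context (R : realType).

Definition grid (T : R) n i : R := T * i%:R / 2 ^+ n.

Definition mesh (T : R) n : R := T / 2 ^+ n.

Lemma gridS T n i : grid T n i.+1 = grid T n i + mesh T n.
Proof. by rewrite /grid /mesh -[i.+1]addn1 natrD mulrDr mulr1 mulrDl. Qed.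

Lemma pow2_gt0 n : 0 < (2 : R) ^+ n.
Proof. by rewrite exprn_gt0. Qed.

Lemma mesh_gt0 T n : 0 < T -> 0 < mesh T n.
Proof. by move=> T0; rewrite divr_gt0// pow2_gt0. Qed.

Lemma grid_ge0 T n i : 0 < T -> 0 <= grid T n i.
Proof. by move=> T0; rewrite divr_ge0 ?mulr_ge0 ?(ltW T0)// exprn_ge0. Qed.

Lemma grid_le T n i : 0 < T -> (i <= 2 ^ n)%N -> grid T n i <= T.
Proof.
move=> T0 i2; rewrite ler_pdivrMr ?pow2_gt0// ler_wpM2l ?(ltW T0)//.
by rewrite -natrX ler_nat.
Qed.

Lemma grid_subdivision T n : 0 < T -> subdivision T (2 ^ n) (grid T n).
Proof.
move=> T0; split; [exact: grid_ge0|exact: grid_le|].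
by move=> i _; rewrite gridS lerDl ltW// mesh_gt0.
Qed.

Definition xi (Om : Type) (T : R) (B : R -> Om -> R) n i w : R :=
  (B (grid T n i.+1) w - B (grid T n i) w) / Num.sqrt (mesh T n).

Definition xiv (Om : Type) (T : R) (B : R -> Om -> R) n w : 'I_(2 ^ n) -> R :=
  fun i => xi T B n i w.

End grid.
Arguments xiv {R Om} T B n w _.

(** * Brownian increments: moments and integration by parts *)

Section brownian.
Context (R : realType) d (Om : measurableType d) (P : probability Om R).
Variables (T : R) (B : R -> Om -> R).
Hypothesis T_gt0 : 0 < T.
Hypothesis hB : brownian_motion P T B.

Local Notation xi := (xi T B).
Local Notation xiv := (xiv T B).
Local Notation grid := (grid T).
Local Notation mesh := (mesh T).

Lemma bm_measurable t : 0 <= t <= T -> measurable_fun setT (B t).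
Proof. by case: hB => h _ _ _ _; exact: h. Qed.

Lemma incr_measurable s t : 0 <= s <= T -> 0 <= t <= T ->
  measurable_fun setT (fun w => B t w - B s w).
Proof. by move=> hs ht; apply: measurable_funB; exact: bm_measurable. Qed.

Lemma incr_law s t (f : R -> R) : 0 <= s -> s < t -> t <= T ->
  measurable_fun setT f -> (forall x, 0 <= f x) ->
  (\int[P]_w (f (B t w - B s w))%:E =
   \int[normal_prob 0 (Num.sqrt (t - s))]_x (f x)%:E)%E.
Proof.
move=> s0 st tT mf f0.
have mD : measurable_fun setT ((fun w => B t w - B s w) : Om -> measurableTypeR R).
  apply: incr_measurable; first by rewrite s0 (le_trans (ltW st)).
  by rewrite (le_trans s0 (ltW st)).
pose D : {mfun Om >-> measurableTypeR R} :=
  HB.pack (fun w => B t w - B s w) (isMeasurableFun.Build _ _ _ _ _ mD).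
transitivity (\int[pushforward P D]_x (f x)%:E)%E.
  rewrite (ge0_integral_pushforward (phi := D))//.
    exact/measurable_EFinP.
  by move=> x _; rewrite lee_fin.
apply: eq_measure_integral => A mA _.
by have [_ _ _ hl _] := hB; rewrite /= /pushforward -(hl s t A).
Qed.

Lemma incr_itg_exp s t c : 0 <= s -> s < t -> t <= T ->
  itg P (fun w => expR (c * `|B t w - B s w|)).
Proof.
move=> s0 st tT; have sd : 0 < Num.sqrt (t - s) by rewrite sqrtr_gt0 subr_gt0.
have me : measurable_fun setT (fun x : R => expR (c * `|x|)).
  by apply: measurableT_comp => //; apply: measurable_funM => //; exact: normr_measurable.
apply/itg_ge0P.
- apply: (measurableT_comp me); apply: incr_measurable.
    by rewrite s0 (le_trans (ltW st)).
  by rewrite (le_trans s0 (ltW st)).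
- by move=> w; exact: expR_ge0.
- rewrite (@incr_law s t (fun x => expR (c * `|x|)))//.
  have /integrableP[_] := gauss_itg_exp sd c.
  by under eq_integral => x _ do rewrite /= ger0_norm ?expR_ge0//.
Qed.

Lemma incr_var s t : 0 <= s -> s < t -> t <= T ->
  L2 P (fun w => B t w - B s w) /\
  ip P (fun w => B t w - B s w) (fun w => B t w - B s w) = t - s.
Proof.
move=> s0 st tT; have sd : 0 < Num.sqrt (t - s) by rewrite sqrtr_gt0 subr_gt0.
have hs : 0 <= s <= T by rewrite s0 (le_trans (ltW st)).
have ht : 0 <= t <= T by rewrite (le_trans s0 (ltW st)).
have e : (\int[P]_w ((B t w - B s w) ^+ 2)%:E = (t - s)%:E)%E.
  rewrite (@incr_law s t (fun x => x ^+ 2))//; last by move=> x; exact: sqr_ge0.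
  (* The variance is Gaussian integration by parts with [g = id]. *)
  have := @gauss_ibp R _ sd id (fun=> 1) 1 1.
  have <- : \int[normal_prob 0 (Num.sqrt (t - s))]_x (x ^+ 2) =
      \int[normal_prob 0 (Num.sqrt (t - s))]_x (x * id x).
    by apply: eq_Rintegral => x _; rewrite expr2.
  rewrite Rint_cst mulr1 sqr_sqrtr ?subr_ge0 ?ltW// => h.
  rewrite -EFin_Rint; first rewrite h//.
  - by move=> x; exact: cvg_cst.
  - by move=> x; rewrite !mul1r (le_trans _ (expR_ge1Dx _))// lerDr.
  - by move=> x; rewrite normr1 !mul1r -[leLHS]expR0 ler_expR.
  - apply: (itg_le _ (itgZ 2 (gauss_itg_exp sd 1))).
      exact: measurable_funX.
    move=> x; rewrite ger0_norm ?sqr_ge0// ger0_norm ?mulr_ge0 ?expR_ge0// mul1r.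
    have := expR_ge1Dxn 1 (normr_ge0 x).
    by rewrite real_normK ?num_real// (_ : 2`! = 2%N)//; lra.
have L : L2 P (fun w => B t w - B s w).
  by apply/L2P; split; [exact: incr_measurable|rewrite e ltry].
by split=> //; apply: EFin_inj; rewrite ip_EFin.
Qed.

Lemma grid_in n i : (i <= 2 ^ n)%N -> 0 <= grid n i <= T.
Proof. by move=> i2; rewrite grid_ge0// grid_le. Qed.

Let sdgt0 n : 0 < Num.sqrt (mesh n).
Proof. by rewrite sqrtr_gt0 mesh_gt0. Qed.

Let gridlt n i : grid n i < grid n i.+1.
Proof. by rewrite gridS ltrDl mesh_gt0. Qed.

Let gridB n i : grid n i.+1 - grid n i = mesh n.
Proof. by rewrite gridS addrC addKr. Qed.

Lemma measurable_xi n i : (i < 2 ^ n)%N -> measurable_fun setT (xi n i).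
Proof.
move=> i2; apply: measurable_funM; last exact: measurable_cst.
by apply: incr_measurable; apply: grid_in => //; exact: ltnW.
Qed.

(** A sum of [2 ^ n] absolute values is at most [2 ^ n] times the largest one, so for [c >= 0] the
    exponential is dominated by a sum of exponentials of single increments. *)
Lemma xi_itg_exp n c : itg P (fun w => expR (c * sumabs (xiv n w))).
Proof.
have [c0|c0] := leP 0 c; last first.
  apply: (@itg_bounded _ _ _ _ _ 1).
    apply: measurableT_comp => //; apply: measurable_funM => //.
    apply: measurable_sum => i; apply: measurableT_comp => //.
    exact: measurable_xi.
  move=> w; rewrite ger0_norm ?expR_ge0// -[leRHS]expR0 ler_expR.
  by rewrite nmulr_rle0// sumabs_ge0.
pose b := c * (2 ^ n)%:R / Num.sqrt (mesh n).
have ii (i : 'I_(2 ^ n)) : itg P (fun w => expR (b * `|B (grid n i.+1) w - B (grid n i) w|)).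
  by apply: incr_itg_exp => //; [exact: grid_ge0|exact: grid_le].
have isum : itg P (fun w => \sum_(i < 2 ^ n) expR (b * `|B (grid n i.+1) w - B (grid n i) w|)).
  by apply: itg_sum.
apply: (itg_le _ isum).
  apply: measurableT_comp => //; apply: measurable_funM => //.
  apply: measurable_sum => i; apply: measurableT_comp => //.
  exact: measurable_xi.
move=> w; rewrite ger0_norm ?expR_ge0//; apply: le_trans (ler_norm _).
have n0 : (0 < 2 ^ n)%N by rewrite expn_gt0.
pose i0 : 'I_(2 ^ n) := Ordinal n0.
pose j := [arg max_(i > i0) `|xi n i w|]%O.
have jmax (i : 'I_(2 ^ n)) : `|xi n i w| <= `|xi n j w|.
  by rewrite /j; case: Order.TotalTheory.arg_maxP => // k _ /(_ i); apply.
rewrite (bigD1 j)//= (@le_trans _ _ (expR (b * `|B (grid n j.+1) w - B (grid n j) w|)))//; last first.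
  by rewrite lerDl sumr_ge0// => i _; exact: expR_ge0.
rewrite ler_expR /b -!mulrA ler_wpM2l//.
rewrite (@le_trans _ _ (\sum_(i < 2 ^ n) `|xi n j w|))//.
  by rewrite /sumabs; apply: ler_sum => i _; exact: jmax.
rewrite sumr_const card_ord -[leLHS]mulr_natl ler_wpM2l//.
by rewrite normrM [`|_^-1|]ger0_norm ?invr_ge0 ?sqrtr_ge0// mulrC.
Qed.

Lemma nice_measurable n G : nice G -> measurable_fun setT (fun w => G (xiv n w)).
Proof. by move=> nG; apply: (nice_meas nG) => i; exact: measurable_xi. Qed.

Lemma nice_itg n G : nice G -> itg P (fun w => G (xiv n w)).
Proof.
move=> nG; have [C [c [C0 c0 gG]]] := nice_growth nG.
apply: (itg_le (nice_measurable nG) (itgZ C (xi_itg_exp n c))) => w.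
by rewrite (le_trans (gG _))// ler_norm.
Qed.

Lemma nice_L2 n G : nice G -> L2 P (fun w => G (xiv n w)).
Proof.
move=> nG; split; first exact: nice_measurable.
by under eq_fun do rewrite expr2; exact: (nice_itg (nice_mul nG nG)).
Qed.

Section coordinate_ibp.
Variables (n : nat) (k : 'I_(2 ^ n)).
Local Notation M := (2 ^ n)%N.
Local Notation sd := (Num.sqrt (mesh n)).

Let D i w := B (grid n i.+1) w - B (grid n i) w.

Let cylS (A : nat -> set R) := [set w | forall i, (i < M)%N -> A i (D i w)].

(** Cylinders that leave the k-th increment free: a pi-system, independent of that increment,
    generating the sigma-algebra of all the others. *)
Let Gk : set (set Om) := [set S | exists A : nat -> set R,
  [/\ forall i, measurable (A i), A k = setT & S = cylS A]].

Let mD i : (i < M)%N -> measurable_fun setT (D i).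
Proof. by move=> iM; apply: incr_measurable; apply: grid_in => //; exact: ltnW. Qed.

Let mcyl A : (forall i, measurable (A i)) -> measurable (cylS A).
Proof.
move=> mA; rewrite (_ : cylS A = \bigcap_(i in `I_M) (D i @^-1` A i)); last first.
  by apply/seteqP; split => w h i; exact: h.
apply: fin_bigcap_measurable => // i iM.
by rewrite -[_ @^-1` _]setTI; exact: mD.
Qed.

Let Pcyl A : (forall i, measurable (A i)) ->
  P (cylS A) = (\prod_(i < M) P [set w | A i (D i w)])%E.
Proof.
by move=> mA; have [_ _ _ _ h] := hB; apply: (h M (grid n) A) => //; exact: grid_subdivision.
Qed.

Let GkT : Gk setT.
Proof.
exists (fun=> setT); split => //.
by apply/seteqP; split.
Qed.

Let GkI : setI_closed Gk.
Proof.
move=> _ _ [A [mA Ak ->]] [A' [mA' Ak' ->]].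
exists (fun i => A i `&` A' i); split.
- by move=> i; exact: measurableI.
- by rewrite Ak Ak' setTI.
- by apply/seteqP; split => w /= => [[h h'] i iM|h]; [split; [exact: h|exact: h']|
    split=> i iM; have [] := h i iM].
Qed.

Let lawk A : measurable A ->
  P [set w | A (D k w)] = normal_prob 0 sd A.
Proof.
move=> mA; have [_ _ _ h _] := hB.
have := h (grid n k) (grid n k.+1) A (grid_ge0 _ _ T_gt0) (gridlt _ _).
by rewrite gridB; apply => //; exact: grid_le.
Qed.

Let PGk S A : Gk S -> measurable A ->
  P (S `&` D k @^-1` A) = (P S * normal_prob 0 sd A)%E.
Proof.
move=> [A' [mA' Ak ->]] mA.
pose A'' i := if i == k :> nat then A else A' i.
rewrite (_ : cylS A' `&` D k @^-1` A = cylS A''); last first.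
  apply/seteqP; split => [w [h hA] i iM|w h].
    by rewrite /A''; case: eqP => [->//|_]; exact: h.
  split=> [i iM|]; last by have := h k (ltn_ord k); rewrite /A'' eqxx.
  by have := h i iM; rewrite /A''; case: eqP => // -> _; rewrite Ak.
rewrite !Pcyl//; last by move=> i; rewrite /A''; case: ifP.
rewrite (bigD1 k)//= [in RHS](bigD1 k)//= /A'' eqxx Ak.
rewrite (_ : [set w | setT (D k w)] = setT); last by apply/seteqP; split.
rewrite probability_setT mul1e lawk// muleC; congr (_ * _)%E.
apply: eq_bigr => i ik; case: eqP => // e.
by move/eqP: ik; case; exact: val_inj.
Qed.

Let upd (x : R) (w : Om) : 'I_M -> R := fun i => if i == k then x / sd else xi n i w.

Let updE x w : upd x w =
  line (fun i => if i == k then 0 else xi n i w) (fun i => if i == k then sd^-1 else 0) x.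
Proof.
by apply/funext => i; rewrite /upd /line; case: eqP => _; rewrite ?add0r// mulr0 addr0.
Qed.

(** With the other increments frozen, it is enough that the integral over the k-th one vanishes, and
    this is the one-dimensional Gaussian identity. The variance [sd ^+ 2] cancels the factors
    [sd^-1] coming from the normalization and from the chain rule. *)
Lemma grid_ibp G dG : C1 G dG ->
  \int[P]_w (xi n k w * G (xiv n w)) = \int[P]_w dG k (xiv n w).
Proof.
move=> [nG ndG eG].
have nxG : nice (fun x : 'I_M -> R => x k * G x) by exact: nice_mul (nice_coord _ k) nG.
apply/eqP; rewrite -subr_eq0 -RintB; last 2 first.
- exact: (nice_itg nxG).
- exact: (nice_itg (ndG k)).
pose Gam (z : R * Om) := z.1 / sd * G (upd z.1 z.2) - dG k (upd z.1 z.2).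
have updk w : upd (D k w) w = xiv n w.
  by apply/funext => i; rewrite /upd; case: eqP => // ->.
have -> : \int[P]_w (xi n k w * G (xiv n w) - dG k (xiv n w)) =
    \int[P]_w Gam (D k w, w).
  by apply: eq_Rintegral => w _; rewrite /Gam /= updk.
(* A coordinate other than the k-th must be measurable for the sigma-algebra of [Gk]; the witness is
   the cylinder that constrains this coordinate only. *)
have mupd i : measurable_fun (setT : set (R * g_sigma_algebraType Gk))
    (fun z => upd z.1 z.2 i).
  rewrite /upd; case: (eqVneq i k) => [ik|ik].
    by apply: measurable_funM => //; exact: measurable_cst.
  apply: (measurableT_comp _ measurable_snd).
  apply: measurable_funM; last exact: measurable_cst.
  move=> _ A mA; rewrite setTI; apply: sub_sigma_algebra.
  exists (fun j => if j == i :> nat then A else setT); split.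
  - by move=> j; case: ifP.
  - by case: eqP => // e; move/eqP: ik; case; apply: val_inj; rewrite /= e.
  - apply/seteqP; split => [w h j jM /=|w h]; first by case: eqP => [->|].
    by have := h i (ltn_ord i); rewrite eqxx.
have g1 w : forall x : R, is_derive x 1 (fun x => G (upd x w)) (sd^-1 * dG k (upd x w)).
  move=> x; rewrite (_ : (fun x => G (upd x w)) = (fun x => G (line (fun i => if i == k then 0 else xi n i w)
     (fun i => if i == k then sd^-1 else 0) x))); last by apply/funext => y; rewrite updE.
  apply: (is_derive_eq (eG _ _ x)); rewrite (bigD1 k)//= eqxx -updE big1 ?addr0//.
  by move=> i /negbTE ->; rewrite mul0r.
pose cst w := \sum_i `|(if i == k then 0 else xi n i w)|.
have bnd H0 : nice H0 -> forall w, exists C c, [/\ 0 <= C, 0 <= c & forall x,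
    `|H0 (upd x w)| <= C * expR (c * `|x|)].
  move=> nH0 w; have [C [c [C0 c0 gC]]] := nice_growth nH0.
  exists (C * expR (c * cst w)), (c / sd); split.
  - by rewrite mulr_ge0 ?expR_ge0.
  - by rewrite divr_ge0 ?sqrtr_ge0.
  move=> x; rewrite (le_trans (gC _))// -mulrA ler_wpM2l// -expRD ler_expR.
  rewrite -mulrA -mulrDr ler_wpM2l// /sumabs /cst [leLHS](bigD1 k)//= [leRHS]addrC.
  rewrite lerD//.
    by rewrite /upd eqxx normrM [`|sd^-1|]ger0_norm ?invr_ge0 ?sqrtr_ge0// mulrC.
  rewrite [leRHS](bigD1 k)//= eqxx normr0 add0r; apply: ler_sum => i ik.
  by rewrite /upd (negbTE ik).
have mupd2 H0 : nice H0 -> forall w, measurable_fun setT (fun x : measurableTypeR R => H0 (upd x w)).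
  move=> nH0 w; apply: continuous_measurable_fun.
  by under eq_fun do rewrite updE; exact: (nice_cont nH0).
have i1 w : itg (normal_prob 0 sd) (fun x => x * G (upd x w)).
  have [C [c [C0 c0 hC]]] := bnd _ nG w.
  apply: (itg_le _ (itgZ C (gauss_itg_exp (sdgt0 n) (c + 1)))).
    by apply: measurable_funM => //; exact: mupd2.
  move=> x; rewrite [X in _ <= X]ger0_norm ?mulr_ge0 ?expR_ge0//.
  rewrite normrM mulrDl mul1r expRD mulrA mulrC ler_pM//.
  by rewrite (le_trans _ (expR_ge1Dx _))// lerDr.
have i2 w : itg (normal_prob 0 sd) (fun x => dG k (upd x w)).
  have [C [c [C0 c0 hC]]] := bnd _ (ndG k) w.
  apply: (itg_le _ (itgZ C (gauss_itg_exp (sdgt0 n) c))); first exact: mupd2.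
  by move=> x; rewrite [X in _ <= X]ger0_norm ?mulr_ge0 ?expR_ge0.
apply/eqP; apply: (@decoupling0 _ Om R P (D k) (normal_prob 0 sd) Gk) => //.
- exact: mD.
- by move=> _ [A [mA _ ->]]; exact: mcyl.
- apply: measurable_funB.
    apply: measurable_funM; last exact: (nice_meas nG).
    by apply: measurable_funM => //; exact: measurable_cst.
  exact: (nice_meas (ndG k)).
- rewrite (_ : (fun w => _) = (fun w => xi n k w * G (xiv n w) - dG k (xiv n w))).
    by apply: itgB; [exact: (nice_itg nxG)|exact: (nice_itg (ndG k))].
  by apply/funext => w; rewrite /Gam /= updk.
- move=> w; rewrite /Gam/=; apply: itgB => //.
  by apply: itg_eq (itgZ sd^-1 (i1 w)) => x; ring.
- move=> w; rewrite /Gam/= RintB//; last first.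
    by apply: itg_eq (itgZ sd^-1 (i1 w)) => x; ring.
  have [C [c [C0 c0 hC]]] := bnd _ nG w.
  have [E [e [E0 e0 hE]]] := bnd _ (nice_mul (nice_cst _ sd^-1) (ndG k)) w.
  (* Enlarged constants serve as a common exponential bound for the function and its derivative. *)
  have le1 (a b x y : R) : 0 <= a -> 0 <= b -> 0 <= x -> 0 <= y ->
      forall z : R, a * expR (x * `|z|) <= (a + b) * expR ((x + y) * `|z|).
    move=> a0 b0 x0 y0 z; rewrite ler_pM ?expR_ge0 ?lerDl// ler_expR.
    by rewrite ler_wpM2r// lerDl.
  have := @gauss_ibp R sd (sdgt0 n) (fun x => G (upd x w))
    (fun x => sd^-1 * dG k (upd x w)) (C + E) (c + e) (g1 w).
  move=> h; rewrite (_ : \int[normal_prob 0 sd]_x (x / sd * G (upd x w)) = sd^-1 * \int[normal_prob 0 sd]_x (x * G (upd x w))); last first.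
    by rewrite -RintZ//; apply: eq_Rintegral => x _; ring.
  rewrite h.
  + rewrite RintZ//; apply/eqP; rewrite subr_eq0; apply/eqP.
    by field; rewrite gt_eqF.
  + move=> x; apply: cvgM; first exact: cvg_cst.
    have := @nice_cont _ _ _ (ndG k) (fun i => if i == k then 0 else xi n i w) (fun i => if i == k then sd^-1 else 0) x.
    by under [in X in X -> _]eq_fun do rewrite -updE.
  + by move=> x; rewrite (le_trans (hC x))// le1.
  + by move=> x; rewrite (le_trans (hE x))// [C + E]addrC [c + e]addrC le1.
Qed.

End coordinate_ibp.

End brownian.

(** * Normalized Hermite polynomials and their products *)

Section hermite.
Context (R : realType).

(** The probabilists' Hermite polynomial of degree [m] divided by the square root of [m!]; the
    recursion is the three-term relation after this division. *)
Fixpoint herm (m : nat) (x : R) : R :=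
  match m with
  | 0 => 1
  | m1.+1 => match m1 with
    | 0 => x
    | m2.+1 => (x * herm m1 x - Num.sqrt m1%:R * herm m2 x) / Num.sqrt m%:R
    end
  end.

(** At [m = 0] the polynomial [herm m.-1] is [herm 0] again, but its factor [Num.sqrt 0] removes
    it. *)
Lemma hermS m x : Num.sqrt m.+1%:R * herm m.+1 x =
  x * herm m x - Num.sqrt m%:R * herm m.-1 x.
Proof.
case: m => [|m]; first by rewrite sqrtr1 sqrtr0 !mul0r subr0 mulr1 mul1r.
by rewrite [herm m.+2 x]/= mulrCA divff ?mulr1// gt_eqF// sqrtr_gt0 ltr0n.
Qed.

Lemma C1_eq r (G G' : ('I_r -> R) -> R) dG dG' : C1 G dG ->
  (forall x, G' x = G x) -> (forall i x, dG' i x = dG i x) -> C1 G' dG'.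
Proof.
move=> cG GG' dGG'; rewrite (_ : G' = G); last exact/funext.
by rewrite (_ : dG' = dG)//; apply/funext => i; apply/funext => x.
Qed.

(** The recursion has depth two, so two consecutive degrees are carried along; in the step the
    derivative takes its claimed form by the three-term relation one degree lower. *)
Lemma C1_herm r (k : 'I_r) m : C1 (fun x => herm m (x k))
  (fun i x => (i == k)%:R * (Num.sqrt m%:R * herm m.-1 (x k))).
Proof.
suff : C1 (fun x => herm m (x k)) (fun i x => (i == k)%:R * (Num.sqrt m%:R * herm m.-1 (x k))) /\
  C1 (fun x => herm m.+1 (x k)) (fun i x => (i == k)%:R * (Num.sqrt m.+1%:R * herm m (x k))).
  by case.
elim: m => [|m [IH1 IH2]]; split=> //.
- apply: C1_eq (C1_cst _ 1) _ _ => // i x; by rewrite sqrtr0 mul0r mulr0.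
- apply: C1_eq (C1_coord _ k) _ _ => // i x; by rewrite sqrtr1 !mulr1.
have s2 : Num.sqrt m.+2%:R != 0 :> R by rewrite gt_eqF// sqrtr_gt0 ltr0n.
have h1 := C1_mul (C1_coord _ k) IH2.
have h2 := C1_mul (C1_cst r (- Num.sqrt m.+1%:R)) IH1.
have h3 := C1_mul (C1_add h1 h2) (C1_cst r (Num.sqrt m.+2%:R)^-1).
apply: C1_eq h3 _ _ => [x|i x].
  by rewrite [herm m.+2 _]/= mulNr.
have e := hermS m (x k).
have q1 : Num.sqrt m.+1%:R ^+ 2 = m.+1%:R :> R by rewrite sqr_sqrtr.
have q2 : Num.sqrt m.+2%:R ^+ 2 = m.+1%:R + 1 :> R by rewrite sqr_sqrtr// -natr1.
apply: (mulfI s2); case: eqP => _; last by rewrite /= !mulr0n; ring.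
rewrite /= mulr1n [LHS](_ : _ = herm m.+1 (x k) + Num.sqrt m.+1%:R *
   (Num.sqrt m.+1%:R * herm m.+1 (x k))); last first.
  have e2 : Num.sqrt m.+1%:R * (Num.sqrt m.+1%:R * herm m.+1 (x k)) =
      m.+1%:R * herm m.+1 (x k) by rewrite mulrA -expr2 q1.
  by rewrite e2 mul1r [LHS]mulrA -expr2 q2 /=; ring.
by rewrite e /=; field.
Qed.

Notation mindex r := {ffun 'I_r -> nat}.

Definition mincr r (al : mindex r) (k : 'I_r) : mindex r :=
  [ffun i => (al i + (i == k))%N].
(** Subtraction is truncated: an entry 0 stays 0, and the formulas pair this case with a vanishing
    factor [Num.sqrt 0]. *)
Definition mdecr r (al : mindex r) (k : 'I_r) : mindex r :=
  [ffun i => (al i - (i == k))%N].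

Definition hermv r (al : mindex r) (x : 'I_r -> R) : R :=
  \prod_i herm (al i) (x i).

Lemma mincrK r (al : mindex r) k : mdecr (mincr al k) k = al.
Proof. by apply/ffunP => i; rewrite !ffunE addnK. Qed.

Lemma mdecrK r (al : mindex r) k : (0 < al k)%N -> mincr (mdecr al k) k = al.
Proof.
move=> a0; apply/ffunP => i; rewrite !ffunE; case: eqP => [->|_].
  by rewrite subnK.
by rewrite subn0 addn0.
Qed.

Lemma hermv1 r (al : mindex r) (k : 'I_r) (x : 'I_r -> R) :
  hermv al x = herm (al k) (x k) * \prod_(i | i != k) herm (al i) (x i).
Proof. by rewrite /hermv (bigD1 k). Qed.

Lemma hermv_decr r (al : mindex r) (k : 'I_r) (x : 'I_r -> R) :
  hermv (mdecr al k) x = herm (al k).-1 (x k) * \prod_(i | i != k) herm (al i) (x i).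
Proof.
rewrite (hermv1 _ k) ffunE eqxx subn1; congr (_ * _).
by apply: eq_bigr => i /negbTE ik; rewrite ffunE ik subn0.
Qed.

Lemma hermv_rec r (al : mindex r) (k : 'I_r) (x : 'I_r -> R) :
  Num.sqrt (al k).+1%:R * hermv (mincr al k) x =
  x k * hermv al x - Num.sqrt (al k)%:R * hermv (mdecr al k) x.
Proof.
rewrite hermv_decr (hermv1 _ k) (hermv1 al k) ffunE eqxx addn1.
rewrite (eq_bigr (fun i => herm (al i) (x i))); last first.
  by move=> i /negbTE ik; rewrite ffunE ik addn0.
by rewrite [LHS]mulrA hermS; ring.
Qed.

Lemma C1_hermv r (al : mindex r) : C1 (hermv al)
  (fun k x => Num.sqrt (al k)%:R * hermv (mdecr al k) x).
Proof.
(* Induction over duplicate-free lists of coordinates; the factor [(k \in s)%:R] records whether the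
   coordinate [k] has been met. *)
suff : forall s : seq 'I_r, uniq s ->
    C1 (fun x : 'I_r -> R => \prod_(i <- s) herm (al i) (x i))
    (fun k x => (k \in s)%:R * (Num.sqrt (al k)%:R * herm (al k).-1 (x k) *
       \prod_(i <- s | i != k) herm (al i) (x i))).
  move=> /(_ (index_enum _) (index_enum_uniq _)) h.
  by apply: C1_eq h _ _ => // i x; rewrite mem_index_enum mul1r hermv_decr mulrA.
elim=> [_|i s IH /= /andP[is_ us]].
  by apply: C1_eq (C1_cst r 1) _ _ => [x|i x]; rewrite ?big_nil// in_nil mul0r.
apply: C1_eq (C1_mul (C1_herm i (al i)) (IH us)) _ _ => [x|k x].
  by rewrite big_cons.
rewrite in_cons big_cons; case: (eqVneq k i) => [->|ki] /=.
  rewrite (negbTE is_) !mul0r mulr0 addr0 mul1r mul1r; congr (_ * _).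
  rewrite big_seq_cond [RHS]big_seq; apply: eq_bigl => j.
  by case: (eqVneq j i) => [->|]; rewrite ?(negbTE is_)// andbT.
by rewrite !mul0r add0r /=; ring.
Qed.

Lemma nice_hermv r (al : mindex r) : nice (hermv al : _ -> R).
Proof. exact: C1_nice (C1_hermv al). Qed.

Definition msize r (al : mindex r) : nat := \sum_i al i.

Definition hspan r (q : ('I_r -> R) -> R) : Prop :=
  exists s : seq (R * mindex r), forall x, q x = \sum_(p <- s) p.1 * hermv p.2 x.

Lemma hspan_add r (p q : ('I_r -> R) -> R) : hspan p -> hspan q ->
  hspan (fun x => p x + q x).
Proof. by move=> [s hs] [t ht]; exists (s ++ t) => x; rewrite big_cat/= hs ht. Qed.

Lemma hspan_scale r k (p : ('I_r -> R) -> R) : hspan p -> hspan (fun x => k * p x).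
Proof.
move=> [s hs]; exists [seq (k * a.1, a.2) | a <- s] => x.
by rewrite big_map hs mulr_sumr; apply: eq_bigr => a _; rewrite mulrA.
Qed.

Lemma hspan_hermv r (al : mindex r) : hspan (hermv al).
Proof. by exists [:: (1, al)] => x; rewrite big_cons big_nil addr0 mul1r. Qed.

Lemma hspan_sum r I (s : seq I) (F : I -> ('I_r -> R) -> R) :
  (forall i, hspan (F i)) -> hspan (fun x => \sum_(i <- s) F i x).
Proof.
move=> hF; elim: s => [|i s IH].
  by exists [::] => x; rewrite !big_nil.
have [t ht] := hspan_add (hF i) IH; exists t => x; by rewrite big_cons ht.
Qed.

Lemma hspan_mulcoord r (k : 'I_r) (q : ('I_r -> R) -> R) : hspan q ->
  hspan (fun x => x k * q x).
Proof.
move=> [s hs]; rewrite (_ : (fun x => _) = (fun x => \sum_(p <- s) p.1 *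
    (Num.sqrt (p.2 k).+1%:R * hermv (mincr p.2 k) x +
     Num.sqrt (p.2 k)%:R * hermv (mdecr p.2 k) x))).
  apply: hspan_sum => p; apply: hspan_scale.
  by apply: hspan_add; apply: hspan_scale; exact: hspan_hermv.
apply/funext => x; rewrite hs mulr_sumr; apply: eq_bigr => p _.
by rewrite hermv_rec; ring.
Qed.

Inductive polyf r : (('I_r -> R) -> R) -> Prop :=
| polyf_cst k : polyf (fun=> k)
| polyf_coord i : polyf (fun x => x i)
| polyf_add p q : polyf p -> polyf q -> polyf (fun x => p x + q x)
| polyf_mul p q : polyf p -> polyf q -> polyf (fun x => p x * q x).

Lemma polyf_sum r I (s : seq I) (F : I -> ('I_r -> R) -> R) :
  (forall i, polyf (F i)) -> polyf (fun x => \sum_(i <- s) F i x).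
Proof.
move=> hF; elim: s => [|i s IH].
  rewrite (_ : (fun _ => _) = (fun=> 0)); first exact: polyf_cst.
  by apply/funext => x; rewrite big_nil.
rewrite (_ : (fun _ => _) = (fun x => F i x + \sum_(j <- s) F j x)).
  exact: polyf_add.
by apply/funext => x; rewrite big_cons.
Qed.

Lemma polyf_exp r (p : ('I_r -> R) -> R) m : polyf p -> polyf (fun x => p x ^+ m).
Proof.
move=> hp; elim: m => [|m IH].
  by under eq_fun do rewrite expr0; exact: polyf_cst.
by under eq_fun do rewrite exprS; exact: polyf_mul.
Qed.

Lemma polyf_nice r (p : ('I_r -> R) -> R) : polyf p -> nice p.
Proof.
elim=> *; [exact: nice_cst|exact: nice_coord|exact: nice_add|exact: nice_mul].
Qed.

Lemma polyf_lincomb r q (A : 'I_q -> 'I_r -> R) p : polyf p ->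
  polyf (fun x => p (lincomb A x)).
Proof.
elim=> [k|i|p1 p2 _ h1 _ h2|p1 p2 _ h1 _ h2].
- exact: polyf_cst.
- apply: polyf_sum => j; apply: polyf_mul; [exact: polyf_cst|exact: polyf_coord].
- exact: polyf_add.
- exact: polyf_mul.
Qed.

(** The induction shows that multiplication by [p] preserves the span, a property stable under
    products; the claim is its instance at the constant 1. *)
Lemma polyf_hspan r (p : ('I_r -> R) -> R) : polyf p -> hspan p.
Proof.
move=> hp; suff h : forall q, hspan q -> hspan (fun x => p x * q x).
  have [|s hs] := h (fun=> 1).
    exists [:: (1, [ffun=> 0%N])] => x.
    rewrite big_cons big_nil addr0 mul1r /hermv big1// => i _.
    by rewrite ffunE.
  by exists s => x; rewrite -hs mulr1.
elim: hp => [k|i|p1 p2 _ h1 _ h2|p1 p2 _ h1 _ h2] q hq.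
- exact: hspan_scale.
- exact: hspan_mulcoord.
- rewrite (_ : (fun x => _) = (fun x => p1 x * q x + p2 x * q x)).
    by apply: hspan_add; [exact: h1|exact: h2].
  by apply/funext => x; rewrite mulrDl.
- rewrite (_ : (fun x => _) = (fun x => p1 x * (p2 x * q x))).
    by apply: h1; exact: h2.
  by apply/funext => x; rewrite mulrA.
Qed.

End hermite.
Notation mindex r := {ffun 'I_r -> nat}.

(** * Orthonormality of the Hermite products of the increments *)

Section orthonormality.
Context (R : realType) d (Om : measurableType d) (P : probability Om R).
Variables (T : R) (B : R -> Om -> R).
Hypothesis T_gt0 : 0 < T.
Hypothesis hB : brownian_motion P T B.

Local Notation xiv := (xiv T B).

Lemma hermv_L2 n (al : mindex (2 ^ n)) : L2 P (fun w => hermv al (xiv n w)).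
Proof. exact (nice_L2 T_gt0 hB (@nice_hermv R _ al)). Qed.

(** Integration by parts is applied to [hermv al * G], and the three-term relation cancels the term
    in which the Hermite product is differentiated. Raising an index is thus adjoint to a partial
    derivative. *)
Lemma hermv_ibp n (al : mindex (2 ^ n)) k G dG : C1 G dG ->
  Num.sqrt (al k).+1%:R * \int[P]_w (hermv (mincr al k) (xiv n w) * G (xiv n w)) =
  \int[P]_w (hermv al (xiv n w) * dG k (xiv n w)).
Proof.
move=> cG; have cH := C1_hermv R al.
have nG := C1_nice cG; have ndG := C1_dnice cG k.
have i1 := nice_itg T_gt0 hB (nice_mul (nice_coord R k) (nice_mul (nice_hermv R al) nG)).
have i2 := nice_itg T_gt0 hB (nice_mul (nice_hermv R (mdecr al k)) nG).
have i3 := nice_itg T_gt0 hB (nice_mul (nice_hermv R al) ndG).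
have i4 := nice_itg T_gt0 hB (nice_mul (nice_hermv R (mincr al k)) nG).
have := grid_ibp T_gt0 hB k (C1_mul cH cG).
rewrite (_ : \int[P]_w (Num.sqrt _ * _ * _ + _) =
  Num.sqrt (al k)%:R * \int[P]_w (hermv (mdecr al k) (xiv n w) * G (xiv n w)) +
  \int[P]_w (hermv al (xiv n w) * dG k (xiv n w))); last first.
  rewrite -RintZ// -RintD//; last exact: itgZ.
  by apply: eq_Rintegral => w _; rewrite mulrA.
move=> h; apply: (addrI (Num.sqrt (al k)%:R * \int[P]_w (hermv (mdecr al k) (xiv n w) * G (xiv n w)))).
rewrite -h -!RintZ// -RintD; [|exact: itgZ|exact: itgZ].
apply: eq_Rintegral => w _.
have e : Num.sqrt (al k).+1%:R * hermv (mincr al k) (xiv n w) =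
    xi T B n k w * hermv al (xiv n w) -
    Num.sqrt (al k)%:R * hermv (mdecr al k) (xiv n w) := hermv_rec al k (xiv n w).
by rewrite [X in _ + X = _]mulrA e; ring.
Qed.

(** Lowering the same entry of both indices by [hermv_ibp] reduces the size of [al]. In size 0 it
    remains that a nontrivial Hermite product is centred, which is the same identity with
    [G = 1]. *)
Lemma hermv_orthonormal n (al be : mindex (2 ^ n)) :
  ip P (fun w => hermv al (xiv n w)) (fun w => hermv be (xiv n w)) = (al == be)%:R.
Proof.
move: {2}(msize al) (leqnn (msize al)) => m; elim: m al be => [|m IH] al be hm.
  have al0 i : al i = 0%N.
    by apply/eqP; move: hm; rewrite leqn0 sum_nat_eq0 => /forallP /(_ i).
  have e1 (x : 'I_(2 ^ n) -> R) : hermv al x = 1.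
    by rewrite /hermv big1// => i _; rewrite al0.
  case: (eqVneq al be) => [<-|ab].
    by rewrite /ip; under eq_Rintegral do rewrite e1 mulr1; rewrite Rint_cst.
  have [k bk] : exists k, (0 < be k)%N.
    case: (boolP [exists k, (0 < be k)%N]) => [/existsP//|/existsPn h].
    exfalso; move/eqP: ab; apply; apply/ffunP => i; rewrite al0.
    by have := h i; rewrite -eqn0Ngt => /eqP ->.
  have := hermv_ibp (mdecr be k) k (C1_cst (2 ^ n) (1 : R)).
  rewrite mdecrK// (_ : \int[P]_w (_ * 0) = 0); last first.
    by under eq_Rintegral do rewrite mulr0; exact: Rint0.
  move=> /eqP; rewrite mulf_eq0 [X in X || _]gt_eqF ?sqrtr_gt0 ?ltr0n//= => /eqP h.
  by rewrite ipC /ip; under eq_Rintegral do rewrite e1; exact: h.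
case: (altP (@existsP _ (fun k => (0 < al k)%N))) => [[k ak]|/existsPn al0]; last first.
  apply: IH; rewrite /msize big1// => i _.
  by have := al0 i; rewrite -eqn0Ngt => /eqP.
have := hermv_ibp (mdecr al k) k (C1_hermv R be).
rewrite mdecrK// ffunE eqxx subn1 prednK// => h.
have sk : Num.sqrt (al k)%:R != 0 :> R by rewrite gt_eqF// sqrtr_gt0 ltr0n.
apply: (mulfI sk); rewrite /ip h.
rewrite (_ : \int[P]_w _ = Num.sqrt (be k)%:R *
  ip P (fun w => hermv (mdecr al k) (xiv n w)) (fun w => hermv (mdecr be k) (xiv n w))); last first.
  rewrite /ip -RintZ; last by apply: L2M; exact: hermv_L2.
  by apply: eq_Rintegral => w _; rewrite mulrCA.
rewrite IH; last first.
  rewrite -ltnS (leq_trans _ hm)// /msize [ltnRHS](bigD1 k)//= (bigD1 k)//= ffunE eqxx subn1.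
  rewrite -addSn prednK// leq_add2l; apply: leq_sum => i /negbTE ik.
  by rewrite ffunE ik subn0.
have [bk|bk] := posnP (be k).
  rewrite bk sqrtr0 mul0r; case: (eqVneq al be) => [ab|]; last by rewrite mulr0.
  by move: ak; rewrite ab bk.
case: (eqVneq al be) => [->|ab]; first by rewrite eqxx.
case: (eqVneq (mdecr al k) (mdecr be k)) => [e|]; last by rewrite !mulr0.
by move/eqP: ab; case; rewrite -(mdecrK ak) e mdecrK.
Qed.

End orthonormality.

(** * Functions of row vectors: measurability, growth, derivatives *)

Section row_functions.
Context (R : realType).


(** The set where [h > a] is open, hence a countable union of sup-norm cubes with rational centres
    and radii [1 / (k + 1)] contained in it. *)
Lemma measurable_rV r d (S : measurableType d) (h : 'rV[R]_r.+1 -> R)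
    (v : 'I_r.+1 -> S -> R) : continuous h ->
  (forall i, measurable_fun setT (v i)) ->
  measurable_fun setT (fun z => h (\row_i v i z)).
Proof.
move=> ch mv; apply: (measurability _ (RGenOInfty.measurableE R)).
move=> _ [_ [a ->] <-]; rewrite setTI.
pose box (p : 'rV[rat]_r.+1 * nat) (x : 'rV[R]_r.+1) :=
  forall i, `|x ord0 i - ratr (p.1 ord0 i)| < p.2.+1%:R^-1.
pose good p := forall x, box p x -> a < h x.
rewrite [X in measurable X](_ : _ = \bigcup_p
    (if `[< good p >] then [set z | box p (\row_i v i z)] else set0)); last first.
  apply/seteqP; split => [z /=|z [p _]]; last first.
    case: asboolP => // gp /= bz; rewrite in_itv/= andbT; exact: gp.
  rewrite in_itv/= andbT => az; set x0 := \row_i v i z.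
  have /nbhs_ballP[e /= e0 be] : nbhs x0 [set x | a < h x].
    by have := ch x0 => /cvgr_gt /(_ _ az).
  pose k := Num.trunc (2 / e).
  have ke : k.+1%:R^-1 * 2 < e.
    rewrite mulrC ltr_pdivrMr ?ltr0n// mulrC -ltr_pdivrMr//.
    exact: truncnS_gt.
  have /choice[q hq] : forall i, exists q : rat, `|x0 ord0 i - ratr q| < k.+1%:R^-1.
    move=> i; have kp : 0 < k.+1%:R^-1 :> R by rewrite invr_gt0 ltr0n.
    have lt : x0 ord0 i - k.+1%:R^-1 < x0 ord0 i + k.+1%:R^-1.
      by rewrite ltrBlDr -addrA ltrDl addr_gt0.
    have [q] := rat_in_itvoo lt; rewrite in_itv/= => /andP[h2 h3].
    by exists q; rewrite distrC ltr_distl h3 h2.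
  exists (\row_i q i, k) => //; case: asboolP => [_|]; last first.
    case=> x bx; apply: be; split => // i j; rewrite !ord1.
    have := bx j; have := hq j; rewrite /= mxE => h1 h2; rewrite /ball/= /ball_.
    rewrite (le_lt_trans (ler_distD (ratr (q j)) _ _))// (lt_trans _ ke)//.
    by rewrite mulr_natr mulr2n ltrD// distrC.
  by move=> i /=; have := hq i; rewrite /x0 !mxE.
apply: countable_bigcupT_measurable; first exact: countableP.
move=> p; case: ifP => _; last exact: measurable0.
rewrite (_ : [set z | _] = \bigcap_(i in [set: 'I_r.+1])
   [set z | `|v i z - ratr (p.1 ord0 i)| < p.2.+1%:R^-1]); last first.
  by apply/seteqP; split => z /= hz i; have := hz i; rewrite mxE// => hi; exact: hi.
apply: fin_bigcap_measurable; first exact: finite_finset.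
move=> i _; rewrite -[X in measurable X]setTI.
apply: measurable_fun_ltr => //.
by apply: measurableT_comp => //; exact: measurable_funB.
Qed.

Definition pgrowth r (h : 'rV[R]_r -> R) : Prop :=
  exists (c : R) (k : nat), forall x, `|h x| <= c * (1 + `|x| ^+ k).

Lemma rV_norm_le r (x : 'rV[R]_r) : `|x| <= \sum_i `|x ord0 i|.
Proof.
have [->|x0] := eqVneq x 0; first by rewrite normr0 sumr_ge0.
have x0' : mx_norm x != 0 by apply: contra x0 => /eqP/mx_norm_eq0 ->.
have [[i j] /= e] := mx_norm_neq0 x0'.
rewrite [leLHS]e ord1 (bigD1 j)//= lerDl; exact: sumr_ge0.
Qed.

Lemma exprn_le_expR (y : R) k : 0 <= y -> y ^+ k <= k`!%:R * expR y.
Proof.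
move=> y0; case: k => [|k]; first by rewrite expr0 fact0 mul1r -[leLHS]expR0 ler_expR.
have := expR_ge1Dxn k y0; rewrite -lerBrDl => h.
rewrite -ler_pdivrMl ?ltr0n ?fact_gt0// mulrC (le_trans h)//.
by rewrite lerBlDr lerDl.
Qed.

Lemma nice_rV r (h : 'rV[R]_r.+1 -> R) : continuous h -> pgrowth h ->
  nice (fun x : 'I_r.+1 -> R => h (\row_i x i)).
Proof.
move=> ch [c [k hc]]; split=> [d S v mv||x v].
- exact: measurable_rV.
- exists (`|c| * (1 + k`!%:R)), 1; split => // x.
  apply: (le_trans (hc _)); set N := `|\row_i x i : 'rV[R]_r.+1|.
  have N0 : 0 <= 1 + N ^+ k by rewrite addr_ge0// exprn_ge0// normr_ge0.
  apply: (le_trans (ler_wpM2r N0 (ler_norm c))).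
  rewrite -mulrA ler_wpM2l// mulrDl mul1r mul1r lerD//.
    by rewrite -[leLHS]expR0 ler_expR sumabs_ge0.
  have n0 : `|\row_i x i : 'rV[R]_r.+1| <= sumabs x.
    rewrite (le_trans (rV_norm_le _))// /sumabs.
    by apply: ler_sum => i _; rewrite mxE.
  rewrite (le_trans (exprn_le_expR k (normr_ge0 _)))//.
  by rewrite ler_wpM2l// ler_expR.
- rewrite (_ : (fun t => _) = h \o (fun t => (\row_i x i : 'rV[R]_r.+1) + t *: \row_i v i)); last first.
    apply/funext => t /=; congr h; apply/rowP => i.
    by rewrite !mxE /line.
  move=> t; apply: continuous_comp; last exact: ch.
  apply: cvgD; first exact: cvg_cst.
  by apply: cvgZr_tmp; exact: cvg_id.
Qed.

(** The derivative along a line is the differential in the direction [v], expanded by linearity on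
    the canonical basis. *)
Lemma C1_rV r (f : 'rV[R]_r.+1 -> R) :
  (forall x, differentiable f x) -> pgrowth f ->
  (forall i, continuous ('D_(delta_mx ord0 i) f)) ->
  (forall i, pgrowth ('D_(delta_mx ord0 i) f)) ->
  C1 (fun x : 'I_r.+1 -> R => f (\row_i x i))
    (fun i x => 'D_(delta_mx ord0 i) f (\row_i x i)).
Proof.
move=> df gf cdf gdf; split=> [|i|x v t].
- by apply: nice_rV => // y; exact: differentiable_continuous.
- exact: (nice_rV (cdf i) (gdf i)).
have lE s : (\row_i line x v s i : 'rV[R]_r.+1) = (\row_i line x v t i) + (s - t) *: \row_i v i.
  by apply/rowP => i; rewrite !mxE /line -addrA -mulrDl; congr (_ + _ * _); ring.
set a : 'rV[R]_r.+1 := \row_i line x v t i; set b : 'rV[R]_r.+1 := \row_i v i.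
have E : (fun h : R => h^-1 *: (((fun t => f (\row_i line x v t i)) \o shift t) (h *: (1 : R)) - f a)) =
  (fun h => h^-1 *: ((f \o shift a) (h *: b) - f a)).
  apply/funext => h /=; rewrite lE /= -/a -/b; congr (_ *: (f _ - _)).
  by rewrite [RHS]addrC; congr (_ + _ *: _); rewrite /GRing.scale/= mulr1 addrK.
have dv : derivable f a b by apply: diff_derivable; exact: df.
split; first by rewrite /derivable E.
rewrite /derive E -/(derive f a b) deriveE; last exact: df.
rewrite (_ : b = \sum_i v i *: delta_mx ord0 i); last first.
  by rewrite [LHS]row_sum_delta; apply: eq_bigr => i _; rewrite mxE.
rewrite linear_sum; apply: eq_bigr => i _.
by rewrite linearZ -deriveE//; exact: df.
Qed.

End row_functions.

(** * Refinement of dyadic cells and increments *)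

Section refinement.
Context (R : realType).
Variables (T : R).
Hypothesis T_gt0 : 0 < T.

Definition cell n k : R -> R :=
  fun x => \1_(`]grid T n k, grid T n k.+1]%classic) x / Num.sqrt (mesh T n).

(** Coefficients of a coarse normalized increment on the fine ones: [j %/ 2 ^ e == k] says that the
    fine interval [j] lies in the coarse interval [k], and the denominator is the ratio of the two
    normalizations. *)
Definition refmx n e (k : nat) (j : 'I_(2 ^ (n + e))) : R :=
  (j %/ 2 ^ e == k)%N%:R / Num.sqrt (2 ^+ e).
Arguments refmx : clear implicits.

Lemma block_telescope n e k (V : nat -> R) : (k < 2 ^ n)%N ->
  \sum_(j < 2 ^ (n + e)) (j %/ 2 ^ e == k)%N%:R * (V j.+1 - V j) =
  V (k.+1 * 2 ^ e)%N - V (k * 2 ^ e)%N.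
Proof.
move=> kn; have e0 : (0 < 2 ^ e)%N by rewrite expn_gt0.
rewrite -(big_mkord xpredT (fun j => (j %/ 2 ^ e == k)%N%:R * (V j.+1 - V j))).
have h1 : (k * 2 ^ e <= k.+1 * 2 ^ e)%N by rewrite leq_mul2r leqnSn orbT.
have h2 : (k.+1 * 2 ^ e <= 2 ^ (n + e))%N by rewrite expnD leq_mul2r kn orbT.
rewrite (big_cat_nat (n := (k * 2 ^ e)%N))//=; last exact: leq_trans h2.
rewrite [X in _ + X](big_cat_nat (n := (k.+1 * 2 ^ e)%N))//=.
rewrite big_nat_cond big1 ?add0r; last first.
  move=> j /andP[/andP[_ jk] _]; rewrite (_ : (_ == _) = false) ?mul0r//.
  by apply/negbTE; rewrite neq_ltn ltn_divLR// jk.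
rewrite [X in _ + X]big_nat_cond [X in _ + X]big1 ?addr0; last first.
  move=> j /andP[/andP[kj _] _]; rewrite (_ : (_ == _) = false) ?mul0r//.
  by apply/negbTE; rewrite neq_ltn [X in _ || X]leq_divRL// kj orbT.
rewrite -telescope_sumr// big_nat [RHS]big_nat; apply: eq_bigr => j /andP[kj jk].
rewrite (_ : (_ == _) = true) ?mul1r//.
by rewrite eqn_leq -ltnS ltn_divLR// jk leq_divRL.
Qed.

Lemma grid_refine n e k : grid T (n + e) (k * 2 ^ e) = grid T n k.
Proof.
rewrite /grid natrM natrX exprD; field.
by rewrite !expf_neq0.
Qed.

Lemma mesh_refine n e : Num.sqrt (mesh T n) =
  Num.sqrt (2 ^+ e) * Num.sqrt (mesh T (n + e)).
Proof.
rewrite -sqrtrM ?exprn_ge0//; congr Num.sqrt; rewrite /mesh exprD; field.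
by rewrite !expf_neq0.
Qed.

(** Stated for an arbitrary path [V], so that it serves both the Brownian increments and the cells,
    which are increments of the path of indicators of []-oo, t]]. *)
Lemma refine_path (V : R -> R) n e k : (k < 2 ^ n)%N ->
  (V (grid T n k.+1) - V (grid T n k)) / Num.sqrt (mesh T n) =
  \sum_j refmx n e k j *
    ((V (grid T (n + e) j.+1) - V (grid T (n + e) j)) / Num.sqrt (mesh T (n + e))).
Proof.
move=> kn; rewrite -(grid_refine n e k) -(grid_refine n e k.+1).
rewrite -(block_telescope e (fun j => V (grid T (n + e) j)) kn) mulr_suml.
rewrite (mesh_refine n e); apply: eq_bigr => j _; rewrite /refmx; field.
by rewrite !gt_eqF// sqrtr_gt0 ?exprn_gt0// mesh_gt0.
Qed.

Lemma xi_refine (Om : Type) (B : R -> Om -> R) n e k w : (k < 2 ^ n)%N ->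
  xi T B n k w = \sum_j refmx n e k j * xi T B (n + e) j w.
Proof. by move=> kn; rewrite /xi (refine_path (fun t => B t w) e kn). Qed.

Lemma indic_oc (a b x : R) : a <= b ->
  \1_(`]a, b]%classic) x = \1_(`]-oo, b]%classic) x - \1_(`]-oo, a]%classic) x :> R.
Proof.
move=> ab; rewrite !indicE !mem_setE !in_itv/=.
have [xa|ax] := leP x a; first by rewrite (le_trans xa ab) subrr.
by case: (leP x b) => _; rewrite subr0.
Qed.

Lemma cell_path n k x : cell n k x =
  (\1_(`]-oo, grid T n k.+1]%classic) x - \1_(`]-oo, grid T n k]%classic) x) /
   Num.sqrt (mesh T n).
Proof. by rewrite /cell indic_oc// gridS lerDl ltW// mesh_gt0. Qed.

Lemma cell_refine n e k x : (k < 2 ^ n)%N ->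
  cell n k x = \sum_j refmx n e k j * cell (n + e) j x.
Proof.
move=> kn; rewrite cell_path (refine_path (fun t => \1_(`]-oo, t]%classic) x) e kn).
by apply: eq_bigr => j _; rewrite cell_path.
Qed.

Local Notation leb := (@lebesgue_measure R).

Lemma indic_ip (a b : R) : a <= b ->
  L2 leb (\1_(`]a, b]%classic) : R -> R) /\
  ip leb (\1_(`]a, b]%classic)) (\1_(`]a, b]%classic)) = b - a.
Proof.
move=> ab.
have e : (\int[leb]_x ((\1_(`]a, b]%classic) x : R) ^+ 2)%:E = (b - a)%:E)%E.
  transitivity (\int[leb]_x (\1_(`]a, b]%classic) x)%:E)%E.
    by apply: eq_integral => x _; rewrite indicE; case: (_ \in _); rewrite ?expr1n ?expr0n.
  rewrite integral_indic// setIT.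
  transitivity (lebesgue_measure (`]a, b]%classic : set R)) => //.
  rewrite lebesgue_measure_itv/= lte_fin.
  case: ltP => // ba; have -> : a = b by apply/eqP; rewrite eq_le ab ba.
  by rewrite subrr.
have L : L2 leb (\1_(`]a, b]%classic) : R -> R).
  by apply/L2P; split; [exact: measurable_indic|rewrite e ltry].
by split=> //; apply: EFin_inj; rewrite ip_EFin.
Qed.

Lemma cell_L2 n k : L2 leb (cell n k).
Proof.
have gk : grid T n k <= grid T n k.+1 by rewrite gridS lerDl ltW// mesh_gt0.
apply: (L2_eq _ (L2Z (Num.sqrt (mesh T n))^-1 (indic_ip gk).1)) => x.
by rewrite /cell mulrC.
Qed.

Lemma grid_mono n k l : (k <= l)%N -> grid T n k <= grid T n l.
Proof.
move=> kl; rewrite /grid ler_pM2r ?invr_gt0 ?exprn_gt0//.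
by rewrite ler_wpM2l ?ler_nat// ltW.
Qed.

Lemma cell_orthonormal n k l : ip leb (cell n k) (cell n l) = (k == l)%:R.
Proof.
have gk i : grid T n i <= grid T n i.+1 by exact: grid_mono.
have s0 : Num.sqrt (mesh T n) != 0 by rewrite gt_eqF// sqrtr_gt0 mesh_gt0.
case: (eqVneq k l) => [<-|kl].
  have [L e] := indic_ip (gk k).
  rewrite (_ : cell n k = (fun x => (Num.sqrt (mesh T n))^-1 * \1_(`]grid T n k, grid T n k.+1]%classic) x)); last first.
    by apply/funext => x; rewrite /cell mulrC.
  rewrite ipZl// ?ipZr// ?e; last exact: L2Z.
  rewrite (_ : grid T n k.+1 - grid T n k = Num.sqrt (mesh T n) ^+ 2); first by rewrite /=; field.
  by rewrite gridS [_ + _ - _]addrC addKr sqr_sqrtr// ltW// mesh_gt0.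
rewrite /ip (_ : (fun x => _) = (fun=> 0)) ?Rint0//; apply/funext => x.
rewrite /cell mulrACA !indicE !mem_setE !in_itv/=.
case: (boolP (_ < x <= _)) => [/andP[h1 h2]|_]; last by rewrite !mul0r.
case: (boolP (_ < x <= _)) => [/andP[h3 h4]|_]; last by rewrite mulr0 mul0r.
case: (ltngtP k l) kl => // kl _.
  by move: (le_lt_trans (le_trans h2 (grid_mono n kl)) h3); rewrite ltxx.
by move: (le_lt_trans (le_trans h4 (grid_mono n kl)) h1); rewrite ltxx.
Qed.

End refinement.
Arguments refmx R n e k j : clear implicits.

(** * The refinement matrix and Gaussian moments of linear combinations *)

Section refinement_brownian.
Context (R : realType) d (Om : measurableType d) (P : probability Om R).
Variables (T : R) (B : R -> Om -> R).
Hypothesis T_gt0 : 0 < T.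
Hypothesis hB : brownian_motion P T B.

Lemma xi_L2 n (i : 'I_(2 ^ n)) : L2 P (xi T B n i).
Proof. exact: (nice_L2 T_gt0 hB (nice_coord R i)). Qed.

Lemma xi_orthonormal n (k l : 'I_(2 ^ n)) :
  ip P (xi T B n k) (xi T B n l) = (k == l)%:R.
Proof. by rewrite /ip (grid_ibp T_gt0 hB k (C1_coord R l)) Rint_cst. Qed.

(** Read off from covariances: the rows express orthonormal coarse increments in orthonormal fine
    ones. *)
Lemma refmx_orthonormal n e (k l : 'I_(2 ^ n)) :
  \sum_j refmx R n e k j * refmx R n e l j = (k == l)%:R.
Proof.
rewrite -(xi_orthonormal k l).
rewrite -(@ip_combination2 _ _ _ P _ xpredT (fun j : 'I_(2 ^ (n + e)) => xi T B (n + e) j)).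
- by congr ip; apply/funext => w; rewrite (xi_refine T_gt0 B e).
- by move=> i _; exact: xi_L2.
- by move=> i j _ _; exact: xi_orthonormal.
Qed.

Definition lin n (b : 'I_(2 ^ n) -> R) w : R := \sum_j b j * xi T B n j w.

(** The even moments of a centred Gaussian, the product being [(2 q - 1)!!]; one integration by
    parts lowers the power by two. *)
Lemma lin_moment n (b : 'I_(2 ^ n) -> R) q :
  \int[P]_w (lin b w ^+ (2 * q)) =
  (\prod_(i < q) (2 * i%:R + 1)) * (\sum_j b j ^+ 2) ^+ q.
Proof.
have nL : nice (fun x : 'I_(2 ^ n) -> R => \sum_j b j * x j).
  by apply: nice_sum => j _; apply: nice_mul; [exact: nice_cst|exact: nice_coord].
have cL : C1 (fun x : 'I_(2 ^ n) -> R => \sum_j b j * x j) (fun i _ => b i).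
  have := C1_lincomb (fun _ : 'I_1 => b) (C1_coord R (@ord0 0)).
  by move=> h; apply: C1_eq h _ _ => // i x; rewrite big_ord1 eqxx mulr1.
elim: q => [|q IH].
  by under eq_Rintegral do rewrite muln0 expr0; rewrite Rint_cst big_ord0 mul1r.
have npow m : nice (fun x : 'I_(2 ^ n) -> R => (\sum_j b j * x j) ^+ m).
  by apply: (polyf_nice (polyf_exp _ _)); apply: polyf_sum => j; apply: polyf_mul;
    [exact: polyf_cst|exact: polyf_coord].
rewrite big_ord_recr/= exprSr.
have cP := C1_pow (2 * q) cL.
transitivity (\sum_k b k * \int[P]_w (xi T B n k w * lin b w ^+ (2 * q).+1)).
  have ii (k : 'I_(2 ^ n)) : itg P (fun w => xi T B n k w * lin b w ^+ (2 * q).+1).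
    exact: (nice_itg T_gt0 hB (nice_mul (nice_coord R k) (npow _))).
  rewrite (eq_bigr (fun k => \int[P]_w (b k * (xi T B n k w * lin b w ^+ (2 * q).+1)))); last first.
    by move=> k _; rewrite RintZ.
  rewrite -Rint_sum; last by move=> k _; apply: itgZ.
  apply: eq_Rintegral => w _.
  rewrite (_ : (2 * q.+1 = (2 * q).+2)%N) ?mulnS// exprS {1}/lin mulr_suml.
  by apply: eq_bigr => k _; rewrite mulrA.
have E (k : 'I_(2 ^ n)) : \int[P]_w (xi T B n k w * lin b w ^+ (2 * q).+1) =
    \int[P]_w ((2 * q).+1%:R * lin b w ^+ (2 * q) * b k) := grid_ibp T_gt0 hB k cP.
rewrite (eq_bigr (fun k => b k * \int[P]_w ((2 * q).+1%:R * lin b w ^+ (2 * q) * b k))); last first.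
  by move=> k _; rewrite E.
rewrite (eq_bigr (fun k => b k ^+ 2 * ((2 * q%:R + 1) * \int[P]_w (lin b w ^+ (2 * q))))).
  by rewrite -mulr_suml IH; ring.
move=> k _.
have i0 : itg P (fun w => lin b w ^+ (2 * q)) := nice_itg T_gt0 hB (npow _).
rewrite (_ : \int[P]_w (_ * _ * b k) = ((2 * q).+1%:R * b k) * \int[P]_w (lin b w ^+ (2 * q))).
  by rewrite -natr1 natrM; ring.
by rewrite -RintZ//; apply: eq_Rintegral => w _; ring.
Qed.

End refinement_brownian.

Lemma ip_sum_le d (S : measurableType d) (R : realType) (mu : {measure set S -> \bar R})
    m (F : nat -> S -> R) : (forall i, (i < m)%N -> L2 mu (F i)) ->
  L2 mu (fun z => \sum_(i < m) F i z) /\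
  ip mu (fun z => \sum_(i < m) F i z) (fun z => \sum_(i < m) F i z) <=
  2 ^+ m * \sum_(i < m) ip mu (F i) (F i).
Proof.
elim: m => [|m IH] LF.
  have -> : (fun z => \sum_(i < 0) F i z) = (fun=> 0) :> (S -> R).
    by apply/funext => z; rewrite big_ord0.
  split; first exact: L20.
  by rewrite big_ord0 mulr0 ipE; under eq_Rintegral do rewrite expr0n; rewrite Rint0.
have {IH} [L le] := IH (fun i im => LF i (ltnW im)).
have LFm : L2 mu (F m) by exact: LF.
have -> : (fun z => \sum_(i < m.+1) F i z) = (fun z => \sum_(i < m) F i z + F m z).
  by apply/funext => z; rewrite big_ord_recr.
split; first exact: L2D.
rewrite (le_trans (ip_sum_le2 L LFm))// big_ord_recr/= exprS mulrDr.
apply: lerD; first by rewrite -mulrA ler_wpM2l.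
by rewrite ler_wpM2r ?ip_ge0// ler_peMr// exprn_ege1// ler1n.
Qed.

(** * Rounding subdivisions to the dyadic grid *)

Section path_approximation.
Context (R : realType) d (S : measurableType d) (mu : {measure set S -> \bar R}).
Variables (T : R) (V : R -> S -> R).
Hypothesis T_gt0 : 0 < T.
(** Satisfied by Brownian motion in L^2 of the probability and by the indicators of []-oo, t]] in
    L^2 of Lebesgue measure; both are then approximated with the same coefficients. *)
Hypothesis V_incr : forall s t, 0 <= s -> s <= t -> t <= T ->
  L2 mu (fun z => V t z - V s z) /\
  ip mu (fun z => V t z - V s z) (fun z => V t z - V s z) = t - s.

Definition gfloor n (t : R) : nat := Num.trunc (t * 2 ^+ n / T).

Lemma gfloor_itv n t : 0 <= t -> grid T n (gfloor n t) <= t < grid T n (gfloor n t) + mesh T n.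
Proof.
move=> t0; have h0 : 0 <= t * 2 ^+ n / T.
  by rewrite divr_ge0 ?mulr_ge0 ?exprn_ge0// ltW.
have := truncn_itv h0; rewrite -/(gfloor n t) => /andP[h1 h2].
rewrite -gridS /grid ler_pdivrMr ?exprn_gt0// ltr_pdivlMr ?exprn_gt0//.
rewrite ler_pdivlMr// in h1; rewrite ltr_pdivrMr// in h2.
by rewrite ![T * _]mulrC h1 h2.
Qed.

Lemma gfloor_le n t : 0 <= t -> t <= T -> (gfloor n t <= 2 ^ n)%N.
Proof.
move=> t0 tT; rewrite -(ler_nat R) natrX.
have h0 : 0 <= t * 2 ^+ n / T by rewrite divr_ge0 ?mulr_ge0 ?exprn_ge0// ltW.
have /andP[h1 _] := truncn_itv h0; rewrite (le_trans h1)//.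
by rewrite ler_pdivrMr// mulrC ler_wpM2l// exprn_ge0.
Qed.

Lemma gfloor_mono n s t : s <= t -> (gfloor n s <= gfloor n t)%N.
Proof.
move=> st; apply: le_truncn; rewrite ler_pM2r ?invr_gt0//.
by rewrite ler_wpM2r// exprn_ge0.
Qed.

Lemma subdivision_itv m (t : nat -> R) i : subdivision T m t -> (i <= m)%N ->
  0 <= t i <= T.
Proof.
move=> [t0 tm ti] im; apply/andP; split.
  elim: i im => // i IH im; rewrite (le_trans (IH (ltnW im)))//; exact: ti.
apply: le_trans tm.
suff h k : (i <= k)%N -> (k <= m)%N -> t i <= t k by exact: h.
elim: k => [|k IH]; first by rewrite leqn0 => /eqP ->.
rewrite leq_eqVlt => /predU1P[-> //|ik km].
by rewrite (le_trans (IH ik (ltnW km)))//; exact: ti.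
Qed.

(** Grid coefficients of the step function whose subdivision points have been rounded down to the
    grid; [Num.sqrt (mesh T n)] undoes the normalization of the cells. *)
Definition dycoef m (t a : nat -> R) n (j : 'I_(2 ^ n)) : R :=
  \sum_(i < m) a i * ((gfloor n (t i) <= j)%N && (j < gfloor n (t i.+1))%N)%:R *
    Num.sqrt (mesh T n).
Arguments dycoef : clear implicits.

Lemma dycoef_sum m (t a : nat -> R) n (U : R -> R) : subdivision T m t ->
  \sum_j dycoef m t a n j * ((U (grid T n j.+1) - U (grid T n j)) / Num.sqrt (mesh T n)) =
  \sum_(i < m) a i * (U (grid T n (gfloor n (t i.+1))) - U (grid T n (gfloor n (t i)))).
Proof.
move=> st; rewrite (eq_bigr (fun j : 'I_(2 ^ n) => \sum_(i < m) a i *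
   ((gfloor n (t i) <= j)%N && (j < gfloor n (t i.+1))%N)%:R *
   (U (grid T n j.+1) - U (grid T n j)))); last first.
  move=> j _; rewrite /dycoef mulr_suml; apply: eq_bigr => i _; field.
  by rewrite gt_eqF// sqrtr_gt0 mesh_gt0.
rewrite exchange_big/=; apply: eq_bigr => i _.
under eq_bigr do rewrite -mulrA; rewrite -mulr_sumr; congr (_ * _).
have /andP[h0 h0'] := subdivision_itv st (ltnW (ltn_ord i)).
have /andP[h1 h1'] := subdivision_itv st (ltn_ord i).
set p := gfloor n (t i); set q := gfloor n (t i.+1).
have pq : (p <= q)%N by apply: gfloor_mono; have [_ _] := st; apply.
have q2 : (q <= 2 ^ n)%N by exact: gfloor_le.
rewrite -(big_mkord xpredT (fun j => ((p <= j)%N && (j < q)%N)%:R *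
  (U (grid T n j.+1) - U (grid T n j)))).
rewrite (big_cat_nat (n := p))//=; last exact: leq_trans q2.
rewrite [X in _ + X](big_cat_nat (n := q))//=.
rewrite big_nat_cond big1 ?add0r; last first.
  by move=> j /andP[/andP[_ jp] _]; rewrite leqNgt jp mul0r.
rewrite [X in _ + X]big_nat_cond [X in _ + X]big1 ?addr0; last first.
  by move=> j /andP[/andP[qj _] _]; rewrite [(j < q)%N]ltnNge qj andbF mul0r.
rewrite -(telescope_sumr (fun j => U (grid T n j)))// big_nat [RHS]big_nat.
by apply: eq_bigr => j ->; rewrite mul1r.
Qed.

(** Rounding moves each subdivision point by less than one mesh, and [V_incr] turns this into a
    squared error of at most [mesh T n] per endpoint. *)
Lemma path_approx m (t a : nat -> R) : subdivision T m t ->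
  exists K, 0 <= K /\ forall n,
  L2 mu (fun z => \sum_j dycoef m t a n j *
     ((V (grid T n j.+1) z - V (grid T n j) z) / Num.sqrt (mesh T n))) /\
  (let D := fun z => \sum_j dycoef m t a n j *
     ((V (grid T n j.+1) z - V (grid T n j) z) / Num.sqrt (mesh T n)) -
     \sum_(i < m) a i * (V (t i.+1) z - V (t i) z) in
  L2 mu D /\ ip mu D D <= K * mesh T n).
Proof.
(* [4 * a i ^+ 2] accounts for the two endpoints of the i-th interval, [2 ^+ m] for the sum of [m]
   terms in [ip_sum_le]. *)
move=> st; exists (2 ^+ m * \sum_(i < m) 4 * a i ^+ 2); split.
  by rewrite mulr_ge0 ?exprn_ge0// sumr_ge0// => i _; rewrite mulr_ge0 ?sqr_ge0.
move=> n.
have LS : L2 mu (fun z => \sum_(i < m) a i * (V (t i.+1) z - V (t i) z)).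
  apply: L2_sum => i _; apply: L2Z; apply: (V_incr _ _ _).1.
  - by have /andP[] := subdivision_itv st (ltnW (ltn_ord i)).
  - by have [_ _] := st; apply.
  - by have /andP[] := subdivision_itv st (ltn_ord i).
pose g i := grid T n (gfloor n (t i)).
pose F i z := a i * ((V (t i) z - V (g i) z) - (V (t i.+1) z - V (g i.+1) z)).
have Vg i : (i <= m)%N -> L2 mu (fun z => V (t i) z - V (g i) z) /\
    ip mu (fun z => V (t i) z - V (g i) z) (fun z => V (t i) z - V (g i) z) <= mesh T n.
  move=> im; have /andP[h0 h0'] := subdivision_itv st im.
  have /andP[g1 g2] := gfloor_itv n h0.
  have [L e] := V_incr (grid_ge0 n (gfloor n (t i)) T_gt0) g1 h0'.
  by split=> //; rewrite e lerBlDl ltW.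
have FL i : (i < m)%N -> L2 mu (F i) /\ ip mu (F i) (F i) <= 4 * a i ^+ 2 * mesh T n.
  move=> im; have [L0 e0] := Vg i (ltnW im); have [L1 e1] := Vg i.+1 im.
  split; first by apply: L2Z; exact: L2B.
  rewrite (ipZl _ (L2B L0 L1) (L2Z _ (L2B L0 L1))) (ipZr _ (L2B L0 L1) (L2B L0 L1)) (ipBB L0 L1).
  have := ip_sum_le2 L0 (L2N L1); rewrite ipDD//; last exact: L2N.
  have -> : ip mu (fun z => V (t i) z - V (g i) z) (fun z => - (V (t i.+1) z - V (g i.+1) z)) =
      - ip mu (fun z => V (t i) z - V (g i) z) (fun z => V (t i.+1) z - V (g i.+1) z).
    rewrite -[RHS]mulN1r -ipZr//; congr ip; apply/funext => z; by rewrite mulN1r.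
  have -> : ip mu (fun z => - (V (t i.+1) z - V (g i.+1) z)) (fun z => - (V (t i.+1) z - V (g i.+1) z)) =
      ip mu (fun z => (V (t i.+1) z - V (g i.+1) z)) (fun z => (V (t i.+1) z - V (g i.+1) z)).
    by rewrite /ip; apply: eq_Rintegral => z _; rewrite mulrNN.
  move=> h; rewrite mulrA -expr2 (_ : 4 * a i ^+ 2 * mesh T n = a i ^+ 2 * (4 * mesh T n)); last by ring.
  rewrite ler_wpM2l ?sqr_ge0//; lra.
have DE : (fun z => \sum_j dycoef m t a n j *
     ((V (grid T n j.+1) z - V (grid T n j) z) / Num.sqrt (mesh T n)) -
     \sum_(i < m) a i * (V (t i.+1) z - V (t i) z)) = (fun z => \sum_(i < m) F i z).
  apply/funext => z; rewrite (dycoef_sum a n (fun s => V s z) st) -sumrB.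
  by apply: eq_bigr => i _; rewrite /F /g; ring.
have [LF leF] := ip_sum_le (fun i im => (FL i im).1).
rewrite DE; split; last split => //.
  rewrite (_ : (fun z => _) = (fun z => (\sum_(i < m) F i z) +
    \sum_(i < m) a i * (V (t i.+1) z - V (t i) z))); first exact: L2D.
  by apply/funext => z; rewrite -[X in X + _](congr1 (fun f => f z) DE) subrK.
rewrite (le_trans leF)// -mulrA ler_wpM2l ?exprn_ge0// mulr_suml.
by apply: ler_sum => i _; exact: (FL i _).2.
Qed.

End path_approximation.
Arguments dycoef {R} T m t a n j.

(** * Wiener integrals as limits along dyadic grids *)

Section wiener.
Context (R : realType) d (Om : measurableType d) (P : probability Om R).
Variables (T : R) (B : R -> Om -> R).
Hypothesis T_gt0 : 0 < T.
Hypothesis hB : brownian_motion P T B.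
Local Notation leb := (@lebesgue_measure R).

Definition cut (phi : R -> R) : R -> R := phi \_ `[0, T]%classic.

Lemma ereal_cvg0_lt (u : nat -> \bar R) (e : R) : u @ \oo --> 0%E -> 0 < e ->
  \forall n \near \oo, (u n < e%:E)%E.
Proof.
move=> u0 e0; apply: (u0 [set x | (x < e%:E)%E]); rewrite nbhsE/=; exists [set x | (x < e%:E)%E] => //.
by split; [exact: open_ereal_lt_ereal|rewrite /= lte_fin].
Qed.

Lemma wiener_L2 phi W : wiener_integral P T B phi W ->
  L2 leb (cut phi) /\ L2 P W.
Proof.
move=> [mphi fphi sW _]; split; last exact/L2P.
apply/L2P; split; first exact/(measurable_restrictT _ _).1.
apply: le_lt_trans fphi; rewrite [leRHS]integral_mkcond; apply: ge0_le_integral => //.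
- by move=> x _; rewrite lee_fin sqr_ge0.
- by apply/measurable_EFinP/measurable_funX; exact/(measurable_restrictT _ _).1.
- apply/(measurable_restrictT _ _).1 => //.
  by apply/measurable_EFinP; exact: measurable_funX.
- move=> x _; rewrite /cut !patchE; case: ifP => // _.
  by rewrite lee_fin expr0n.
Qed.

Lemma bm_path s t : 0 <= s -> s <= t -> t <= T ->
  L2 P (fun w => B t w - B s w) /\
  ip P (fun w => B t w - B s w) (fun w => B t w - B s w) = t - s.
Proof.
move=> s0; rewrite le_eqVlt => /predU1P[<- tT|st tT]; last exact: (incr_var hB s0 st tT).
have -> : (fun w => B s w - B s w) = (fun=> 0) by apply/funext => w; rewrite subrr.
split; first exact: L20.
by rewrite ipE subrr; under eq_Rintegral do rewrite expr0n; rewrite Rint0.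
Qed.

Lemma indic_path s t : 0 <= s -> s <= t -> t <= T ->
  let V := fun (t : R) => (\1_(`]-oo, t]%classic) : R -> R) in
  L2 leb (fun x => V t x - V s x) /\
  ip leb (fun x => V t x - V s x) (fun x => V t x - V s x) = t - s.
Proof.
move=> s0 st tT V.
have -> : (fun x => V t x - V s x) = \1_(`]s, t]%classic).
  by apply/funext => x; rewrite /V -indic_oc.
exact: indic_ip.
Qed.

(** One vector of coefficients approximates both the integrand and its integral, and it exists at
    every fine level, so that several Wiener integrals can share a grid. *)
Lemma wiener_dyadic phi W (e : R) : wiener_integral P T B phi W -> 0 < e ->
  exists n0, forall n, (n0 <= n)%N -> exists b : 'I_(2 ^ n) -> R,
    ip leb (fun x => \sum_j b j * cell T n j x - cut phi x)
           (fun x => \sum_j b j * cell T n j x - cut phi x) <= e /\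
    ip P (fun w => lin T B b w - W w) (fun w => lin T B b w - W w) <= e.
Proof.
move=> hW e0; have [Lphi LW] := wiener_L2 hW.
have [mphi _ _ [m [t [a [st cv1 cv2]]]]] := hW.
(* Two errors are combined through [|a + b|^2 <= 2 |a|^2 + 2 |b|^2], hence the division by 4. *)
have e4 : 0 < e / 4 by rewrite divr_gt0.
have [q [hq1 hq2]] : exists q,
   (\int[leb]_(x in `[0%R, T]) ((\sum_(i < m q) a q i * \1_(`]t q i, t q i.+1]) x - phi x) ^+ 2)%:E < (e / 4)%:E)%E /\
   (\int[P]_w ((\sum_(i < m q) a q i * (B (t q i.+1) w - B (t q i) w) - W w) ^+ 2)%:E < (e / 4)%:E)%E.
  have [q _ /(_ q (leqnn q)) h] := filterI (ereal_cvg0_lt cv1 e4) (ereal_cvg0_lt cv2 e4).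
  by exists q.
have [K1 [K10 hK1]] := path_approx T_gt0 indic_path (a q) (st q).
have [K2 [K20 hK2]] := path_approx T_gt0 bm_path (a q) (st q).
have : (fun n => (K1 + K2) * T * (2^-1 : R) ^+ n) @ \oo --> 0.
  rewrite -[X in _ --> X](mulr0 ((K1 + K2) * T)); apply: cvgM; first exact: cvg_cst.
  exact: cvg_half.
move=> /cvgr0Pnorm_lt /(_ _ e4)[n0 _ hn0].
exists n0 => n /hn0 /=.
have K0 : 0 <= K1 + K2 by rewrite addr_ge0.
rewrite ger0_norm ?mulr_ge0 ?exprn_ge0 ?invr_ge0 ?(ltW T_gt0)// => Kn.
have meshE : mesh T n = T * 2^-1 ^+ n by rewrite /mesh exprVn.
have mesh0 := mesh_gt0 n T_gt0.
have {Kn} [Kn1 Kn2] : K1 * mesh T n <= e / 4 /\ K2 * mesh T n <= e / 4.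
  move: Kn; rewrite -mulrA -meshE mulrDl => Kn.
  have := mulr_ge0 K10 (ltW mesh0); have := mulr_ge0 K20 (ltW mesh0).
  by split; lra.
pose S z := \sum_(i < m q) a q i * (\1_(`]-oo, t q i.+1]%classic) z - \1_(`]-oo, t q i]%classic) z) : R.
have SE x : S x = \sum_(i < m q) a q i * \1_(`]t q i, t q i.+1]) x.
  apply: eq_bigr => i _; rewrite -indic_oc//.
  by have [_ _] := st q; apply.
have comb (d' : measure_display) (Z : measurableType d') (mu : {measure set Z -> \bar R}) (f g h : Z -> R) :
    L2 mu (fun z => f z - g z) -> L2 mu (fun z => g z - h z) ->
    ip mu (fun z => f z - g z) (fun z => f z - g z) <= e / 4 ->
    ip mu (fun z => g z - h z) (fun z => g z - h z) <= e / 4 ->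
    ip mu (fun z => f z - h z) (fun z => f z - h z) <= e.
  move=> L1 L2' h1 h2.
  rewrite (_ : (fun z => f z - h z) = (fun z => (f z - g z) + (g z - h z))); last first.
    by apply/funext => z; rewrite addrA subrK.
  by have := ip_sum_le2 L1 L2'; lra.
exists (dycoef T (m q) (t q) (a q) n); split.
  have [L1 [L1' le1]] := hK1 n.
  have LS : L2 leb S by apply: (L2_eq _ (L2B L1 L1')) => x; rewrite /S; ring.
  have cellE x : \sum_j dycoef T (m q) (t q) (a q) n j * cell T n j x =
    \sum_j dycoef T (m q) (t q) (a q) n j * ((\1_(`]-oo, grid T n j.+1]%classic) x -
      \1_(`]-oo, grid T n j]%classic) x) / Num.sqrt (mesh T n)).
    by apply: eq_bigr => j _; rewrite cell_path.
  apply: (comb _ _ leb (fun x => \sum_j dycoef T (m q) (t q) (a q) n j * cell T n j x) S (cut phi)).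
  - by apply: (L2_eq _ L1') => x; rewrite cellE.
  - exact: L2B.
  - apply: (le_trans _ Kn1); apply: (le_trans _ le1).
    by rewrite (_ : (fun z => _ - S z) = (fun z => \sum_j dycoef T (m q) (t q) (a q) n j *
     ((\1_(`]-oo, grid T n j.+1]%classic) z - \1_(`]-oo, grid T n j]%classic) z) / Num.sqrt (mesh T n)) - S z))//;
      apply/funext => x; rewrite cellE.
  - rewrite -lee_fin ip_EFin; last exact: L2B.
    apply: (le_trans _ (ltW hq1)); rewrite [leRHS]integral_mkcond le_eqVlt; apply/orP; left.
    apply/eqP; apply: eq_integral => x _; rewrite /cut !patchE SE.
    case: ifPn => // x0T; rewrite subr0 big1 ?expr0n// => i _.
    rewrite indicE (_ : (x \in _) = false) ?mulr0//; apply/negbTE; apply: contra x0T.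
    rewrite !inE/= !in_itv/= => /andP[h1 h2].
    have /andP[g1 _] := subdivision_itv (st q) (ltnW (ltn_ord i)).
    have /andP[_ g2] := subdivision_itv (st q) (ltn_ord i).
    by rewrite (le_trans g1 (ltW h1)) (le_trans h2 g2).
have [L1 [L1' le1]] := hK2 n.
apply: (comb _ _ P (lin T B (dycoef T (m q) (t q) (a q) n)) (fun w => \sum_(i < m q) a q i * (B (t q i.+1) w - B (t q i) w)) W).
- exact: L1'.
- apply: L2B => //; apply: L2_eq (L2B L1 L1') => w; ring.
- exact: (le_trans le1 Kn2).
- rewrite -lee_fin ip_EFin; first exact: ltW hq2.
  apply: L2B => //; apply: L2_eq (L2B L1 L1') => w; ring.
Qed.

End wiener.

Section ip_limit.
Context d (S : measurableType d) (R : realType) (mu : {measure set S -> \bar R}).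

Lemma ip_cvg g F f : L2 mu g -> (forall n, L2 mu (F n)) -> L2 mu f ->
  (fun n => ip mu (fun x => F n x - f x) (fun x => F n x - f x)) @ \oo --> 0 ->
  (fun n => ip mu g (F n)) @ \oo --> ip mu g f.
Proof.
move=> Lg LF Lf Ff; have LD n : L2 mu (fun x => F n x - f x) by exact: L2B.
apply/cvg_subr0/cvg_sqr0.
apply: (@cvg0_le R _ (fun n => ip mu g g * ip mu (fun x => F n x - f x) (fun x => F n x - f x))).
  by rewrite -[X in _ --> X](mulr0 (ip mu g g)); apply: cvgM => //; exact: cvg_cst.
by move=> n; rewrite ger0_norm ?sqr_ge0// -ipBr//; exact: ip_CS.
Qed.

End ip_limit.

Lemma rV_norm_exp (R : realType) r (x : 'rV[R]_r) q :
  `|x| ^+ (2 * q) <= 1 + \sum_i x ord0 i ^+ (2 * q).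
Proof.
have S0 : 0 <= \sum_i x ord0 i ^+ (2 * q).
  by apply: sumr_ge0 => i _; rewrite exprM exprn_ge0 ?sqr_ge0.
have [->|x0] := eqVneq x 0.
  rewrite normr0; apply: (@le_trans _ _ 1); first by rewrite expr0n; case: (_ == _).
  rewrite lerDl; apply: sumr_ge0 => i _; by rewrite exprM exprn_ge0 ?sqr_ge0.
have x0' : mx_norm x != 0 by apply: contra x0 => /eqP/mx_norm_eq0 ->.
have [[i j] /= e] := mx_norm_neq0 x0'.
have -> : `|x| = `|x ord0 j| by rewrite [LHS]e ord1.
rewrite (bigD1 j)//= exprM real_normK ?num_real// -exprM.
rewrite addrCA lerDl addr_ge0// sumr_ge0// => l _.
by rewrite exprM exprn_ge0 ?sqr_ge0.
Qed.

(** * Integration by parts for smooth cylindrical variables *)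

Section cylindrical.
Context (R : realType) d (Om : measurableType d) (P : probability Om R).
Variables (T : R) (B : R -> Om -> R).
Hypothesis T_gt0 : 0 < T.
Hypothesis hB : brownian_motion P T B.
Local Notation leb := (@lebesgue_measure R).
Variables (r : nat) (phi : 'I_r.+1 -> R -> R) (W : 'I_r.+1 -> Om -> R) (n0 : nat).
Hypothesis hW : forall i, wiener_integral P T B (phi i) (W i).

(** Levels of the form [n0 + e m] refine the level [n0] of the Hermite products; the summable rate
    [2^-m] yields almost sure convergence. *)
Lemma wiener_family : exists (e : nat -> nat)
    (b : forall m, 'I_r.+1 -> 'I_(2 ^ (n0 + e m)) -> R), forall m i,
  ip leb (fun x => \sum_j @b m i j * cell T (n0 + e m) j x - cut T (phi i) x)
         (fun x => \sum_j @b m i j * cell T (n0 + e m) j x - cut T (phi i) x) <= 2^-1 ^+ m /\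
  ip P (fun w => lin T B (@b m i) w - W i w) (fun w => lin T B (@b m i) w - W i w) <= 2^-1 ^+ m.
Proof.
have h m : exists eb : {e : nat & 'I_r.+1 -> 'I_(2 ^ (n0 + e)) -> R}, forall i,
  ip leb (fun x => \sum_j projT2 eb i j * cell T (n0 + projT1 eb) j x - cut T (phi i) x)
         (fun x => \sum_j projT2 eb i j * cell T (n0 + projT1 eb) j x - cut T (phi i) x) <= 2^-1 ^+ m /\
  ip P (fun w => lin T B (projT2 eb i) w - W i w) (fun w => lin T B (projT2 eb i) w - W i w) <= 2^-1 ^+ m.
  have e0 : 0 < 2^-1 ^+ m :> R by rewrite exprn_gt0.
  have [N hN] := choice (fun i => wiener_dyadic T_gt0 hB (hW i) e0).
  pose e := \max_i N i.
  have Ne i : (N i <= n0 + e)%N by rewrite (leq_trans (leq_bigmax i))// leq_addl.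
  have [b hb] := choice (fun i => hN i _ (Ne i)).
  by exists (existT _ e b).
have [f hf] := choice h.
by exists (fun m => projT1 (f m)), (fun m => projT2 (f m)).
Qed.

Variables (e : nat -> nat) (b : forall m, 'I_r.+1 -> 'I_(2 ^ (n0 + e m)) -> R).
Hypothesis hb : forall m i,
  ip leb (fun x => \sum_j @b m i j * cell T (n0 + e m) j x - cut T (phi i) x)
         (fun x => \sum_j @b m i j * cell T (n0 + e m) j x - cut T (phi i) x) <= 2^-1 ^+ m /\
  ip P (fun w => lin T B (@b m i) w - W i w) (fun w => lin T B (@b m i) w - W i w) <= 2^-1 ^+ m.

Let Wm m w : 'rV[R]_r.+1 := \row_i lin T B (@b m i) w.
Let Wi w : 'rV[R]_r.+1 := \row_i W i w.

Lemma lin_L2 n (c : 'I_(2 ^ n) -> R) : L2 P (lin T B c).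
Proof. by apply: L2_sum => j _; apply: L2Z; exact: xi_L2. Qed.

Lemma lin_sum_le m i : \sum_j @b m i j ^+ 2 <= 2 * ip P (W i) (W i) + 2.
Proof.
have LW := (wiener_L2 (hW i)).2; have Ll := lin_L2 (@b m i).
have <- : ip P (lin T B (@b m i)) (lin T B (@b m i)) = \sum_j @b m i j ^+ 2.
  rewrite ipE; have := lin_moment T_gt0 hB (@b m i) 1.
  by rewrite muln1 expr1 big_ord1 mulr0 add0r mul1r.
have h := (hb m i).2.
have := ip_sum_le2 (L2B Ll LW) LW.
rewrite (_ : (fun x => _ - _ + _) = lin T B (@b m i)); last by apply/funext => w; rewrite subrK.
have h1 : (2^-1 : R) ^+ m <= 1 by rewrite exprn_ile1// ?invr_ge0// invf_le1 ?ler1n.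
lra.
Qed.

Lemma Wm_cvg : {ae P, forall w, Wm ^~ w @ \oo --> Wi w}.
Proof.
have h i : {ae P, forall w, (fun m => lin T B (@b m i) w) @ \oo --> W i w}.
  apply: ae_cvg_fast => [m||m]; first exact: lin_L2.
  - exact: (wiener_L2 (hW i)).2.
  - exact: (hb m i).2.
have : {ae P, forall w, forall i : nat,
    (fun m => lin T B (@b m (inord i)) w) @ \oo --> W (inord i) w}.
  by apply: ae_foralln => i; exact: h.
apply: filterS => w cw.
have : (fun m => \sum_i `|lin T B (@b m i) w - W i w|) @ \oo --> (\sum_(i < r.+1) 0 : R).
  apply: cvg_big => [|i _]; first exact: add_continuous.
  have := cw i; rewrite inord_val => /subr_cvg0 ?.
  exact/norm_cvg0P.
rewrite big1// => s0; apply/subr_cvg0/norm_cvg0P.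
apply: (cvg0_le s0) => m; rewrite normr_id (le_trans (rV_norm_le _))//.
by apply: ler_sum => i _; rewrite !mxE.
Qed.

Section function.
Variable h : 'rV[R]_r.+1 -> R.
Hypothesis ch : continuous h.
Hypothesis gh : pgrowth h.

Lemma nice_Wm m : nice (fun x => h (\row_i \sum_j @b m i j * x j)).
Proof. by have := nice_lincomb (@b m) (nice_rV ch gh). Qed.

(** Growth of order [k] leads to moments of order [4 k] of Gaussian linear combinations, whose
    variances are bounded uniformly in [m] by [lin_sum_le]. *)
Lemma hWm_bound : exists K, forall m,
  ip P (fun w => h (Wm m w) ^+ 2) (fun w => h (Wm m w) ^+ 2) <= K.
Proof.
have [c [k hc]] := gh.
pose C q := \prod_(i < q) (2 * i%:R + 1) : R.
(* From [(1 + y)^4 <= 8 (1 + y^4)] and a bound of [y^4] by 1 plus the sum of the powers of the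
   coordinates; the constant part is [8 * 2]. *)
exists (16 * c ^+ 4 + 8 * c ^+ 4 * \sum_i C (2 * k)%N * (2 * ip P (W i) (W i) + 2) ^+ (2 * k)) => m.
have nl i : nice (fun x => (\sum_j @b m i j * x j) ^+ (2 * (2 * k))).
  have : nice (fun x : 'I_(2 ^ (n0 + e m)) -> R => \sum_j @b m i j * x j).
    by apply: nice_sum => j _; apply: nice_mul; [exact: nice_cst|exact: nice_coord].
  elim: (2 * (2 * k))%N => [|q IH] n1.
    by under eq_fun do rewrite expr0; exact: nice_cst.
  under eq_fun do rewrite exprS; apply: nice_mul => //; exact: IH.
have il i : itg P (fun w => lin T B (@b m i) w ^+ (2 * (2 * k))) by exact: (nice_itg T_gt0 hB (nl i)).
have iR : itg P (fun w => 8 * c ^+ 4 * (2 + \sum_i lin T B (@b m i) w ^+ (2 * (2 * k)))).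
  by apply: itgZ; apply: itgD; [exact: itg_cst|exact: itg_sum].
apply: (@le_trans _ _ (\int[P]_w (8 * c ^+ 4 * (2 + \sum_i lin T B (@b m i) w ^+ (2 * (2 * k)))))).
  apply: le_Rint => //.
    exact: (nice_itg T_gt0 hB (nice_mul (nice_mul (nice_Wm m) (nice_Wm m)) (nice_mul (nice_Wm m) (nice_Wm m)))).
  move=> w; have := hc (Wm m w); set y := `|Wm m w| ^+ k => hy.
  have y0 : 0 <= y by exact: exprn_ge0.
  have h1 : h (Wm m w) ^+ 2 <= c ^+ 2 * (1 + y) ^+ 2.
    rewrite -exprMn -[leLHS]real_normK ?num_real// lerXn2r ?nnegrE//.
    exact: le_trans hy.
  have y4 : y ^+ 4 <= 1 + \sum_i lin T B (@b m i) w ^+ (2 * (2 * k)).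
    have := rV_norm_exp (Wm m w) (2 * k).
    rewrite -exprM (_ : (k * 4 = 2 * (2 * k))%N); last by rewrite mulnA mulnC.
    by move=> hh; apply: (le_trans hh); rewrite lerD2l; apply: ler_sum => i _; rewrite mxE.
  apply: (@le_trans _ _ ((c ^+ 2 * (1 + y) ^+ 2) ^+ 2)).
    by rewrite -expr2 lerXn2r ?nnegrE ?sqr_ge0//; apply: mulr_ge0; exact: sqr_ge0.
  have h3 : (1 + y) ^+ 4 <= 8 * (1 + y ^+ 4).
    have a1 : (1 + y) ^+ 2 <= 2 * (1 + y ^+ 2) by have := sqr_ge0 (y - 1); lra.
    rewrite (_ : 4 = 2 * 2)%N// !exprM.
    have : ((1 + y) ^+ 2) ^+ 2 <= (2 * (1 + y ^+ 2)) ^+ 2.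
      by rewrite lerXn2r ?nnegrE ?sqr_ge0 ?mulr_ge0 ?addr_ge0 ?sqr_ge0.
    have := sqr_ge0 (y ^+ 2 - 1); lra.
  rewrite exprMn -!exprM -mulrA.
  have c4 : 0 <= c ^+ 4 by rewrite (_ : 4 = 2 * 2)%N// exprM sqr_ge0.
  rewrite (_ : 8 * (c ^+ 4 * _) = c ^+ 4 * (8 * (2 + \sum_i lin T B (@b m i) w ^+ (2 * (2 * k))))); last by ring.
  by rewrite ler_wpM2l// (le_trans h3)// ler_wpM2l//; lra.
rewrite RintZ; last by apply: itgD; [exact: itg_cst|exact: itg_sum].
rewrite RintD; [|exact: itg_cst|exact: itg_sum].
rewrite Rint_cst Rint_sum//.
have c4 : 0 <= c ^+ 4 by rewrite (_ : 4 = 2 * 2)%N// exprM sqr_ge0.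
rewrite mulrDr; apply: lerD; first by lra.
apply: ler_wpM2l; [exact: mulr_ge0|apply: ler_sum => i _].
rewrite lin_moment// ler_wpM2l//.
  by apply: prodr_ge0 => j _; rewrite addr_ge0// mulr_ge0.
rewrite lerXn2r ?nnegrE ?lin_sum_le//; first by apply: sumr_ge0 => *; rewrite sqr_ge0.
by apply: (le_trans _ (lin_sum_le m i)); apply: sumr_ge0 => *; rewrite sqr_ge0.
Qed.

Lemma hWm_L2 m : L2 P (fun w => h (Wm m w)).
Proof. exact: (nice_L2 T_gt0 hB (nice_Wm m)). Qed.

(** Almost sure convergence with bounded fourth moments gives convergence in L^2. *)
Lemma hW_cvg : L2 P (fun w => h (Wi w)) /\
  (fun m => ip P (fun w => h (Wm m w) - h (Wi w)) (fun w => h (Wm m w) - h (Wi w))) @ \oo --> 0.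
Proof.
have [K hK] := hWm_bound.
apply: (L2_cvg_bounded4 (K := K)) => //.
- move=> m; exact: (nice_L2 T_gt0 hB (nice_mul (nice_Wm m) (nice_Wm m))).
- by move=> m; exact: (hWm_L2 m).1.
- apply: measurable_rV => // i; exact: (wiener_L2 (hW i)).2.1.
- apply: filterS Wm_cvg => w cw.
  exact: (cvg_comp (fun m => Wm m w) h cw (@ch (Wi w))).
Qed.

End function.

(** The Wiener integrals are replaced by linear combinations of increments of the level [n0 + e m],
    where everything is a function of one Gaussian vector; the k-th row of [refmx] turns the fine
    partial derivatives into the coarse direction [k]. Then [m] tends to infinity. *)
Lemma cyl_ibp f (al : mindex (2 ^ n0)) k : smooth_poly_growth f ->
  Num.sqrt (al k).+1%:R * ip P (fun w => hermv (mincr al k) (xiv T B n0 w)) (fun w => f (Wi w)) =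
  \sum_i ip leb (cell T n0 k) (cut T (phi i)) *
    ip P (fun w => hermv al (xiv T B n0 w)) (fun w => partials [:: i] f (Wi w)).
Proof.
move=> sf; have df s x : differentiable (partials s f) x by exact: (sf s).1.
have gf s : pgrowth (partials s f) by exact: (sf s).2.
have cf s : continuous (partials s f) by move=> x; exact: differentiable_continuous.
have cell_coef m i : \sum_j refmx R n0 (e m) k j * @b m i j =
    ip leb (cell T n0 k) (fun x => \sum_j @b m i j * cell T (n0 + e m) j x).
  rewrite (_ : cell T n0 k = (fun x => \sum_j refmx R n0 (e m) k j * cell T (n0 + e m) j x)).
    rewrite (@ip_combination2 _ _ _ leb _ xpredT (fun j : 'I_(2 ^ (n0 + e m)) => cell T (n0 + e m) j))//.
      by move=> j _; exact: cell_L2.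
    by move=> i' j _ _; rewrite cell_orthonormal.
  by apply/funext => x; rewrite (cell_refine T_gt0 (e m)).
have approx m : Num.sqrt (al k).+1%:R *
    ip P (fun w => hermv (mincr al k) (xiv T B n0 w)) (fun w => f (Wm m w)) =
  \sum_i ip leb (cell T n0 k) (fun x => \sum_j @b m i j * cell T (n0 + e m) j x) *
    ip P (fun w => hermv al (xiv T B n0 w)) (fun w => partials [:: i] f (Wm m w)).
  pose A := refmx R n0 (e m).
  have xiE w : xiv T B n0 w = lincomb A (xiv T B (n0 + e m) w).
    by apply/funext => j; rewrite /lincomb -xi_refine.
  have cf1 := C1_rV (df [::]) (gf [::]) (fun i => cf [:: i]) (fun i => gf [:: i]).
  have cG := C1_mul (C1_lincomb A (C1_hermv R al)) (C1_lincomb (@b m) cf1).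
  set G := (fun x => _) in cG; set dG := (fun i x => _) in cG.
  have nG := C1_nice cG.
  have GE w : G (xiv T B (n0 + e m) w) = hermv al (xiv T B n0 w) * f (Wm m w).
    by rewrite /G -xiE.
  (* Orthonormality of the rows of [refmx] keeps only the k-th derivative of the Hermite factor. *)
  have dGE w : \sum_j A k j * dG j (xiv T B (n0 + e m) w) =
    Num.sqrt (al k)%:R * hermv (mdecr al k) (xiv T B n0 w) * f (Wm m w) +
    \sum_i (\sum_j A k j * @b m i j) * (hermv al (xiv T B n0 w) * partials [:: i] f (Wm m w)).
    rewrite /dG -xiE.
    under eq_bigr do rewrite mulrDr !mulr_suml !mulr_sumr.
    rewrite big_split/=; congr (_ + _).
      rewrite exchange_big/= (bigD1 k)//= [X in _ + X]big1 ?addr0.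
        transitivity ((\sum_j A k j * A k j) * (Num.sqrt (al k)%:R * hermv (mdecr al k) (xiv T B n0 w) * f (Wm m w))).
          by rewrite mulr_suml; apply: eq_bigr => j _; rewrite !mulrA.
        by rewrite (refmx_orthonormal T_gt0 hB) eqxx mul1r.
      move=> l lk; transitivity ((\sum_j A k j * A l j) * (Num.sqrt (al l)%:R * hermv (mdecr al l) (xiv T B n0 w) * f (Wm m w))).
        by rewrite mulr_suml; apply: eq_bigr => j _; rewrite !mulrA.
      by rewrite (refmx_orthonormal T_gt0 hB) eq_sym (negbTE lk) mul0r.
    rewrite exchange_big/=; apply: eq_bigr => i _; rewrite mulr_suml; apply: eq_bigr => j _.
    ring.
  have Lh al' : L2 P (fun w => hermv al' (xiv T B n0 w)) by exact: hermv_L2.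
  have Lf := hWm_L2 (cf [::]) (gf [::]) m.
  have Lfi i := hWm_L2 (cf [:: i]) (gf [:: i]) m.
  have ixG j : itg P (fun w => A k j * (xi T B (n0 + e m) j w * G (xiv T B (n0 + e m) w))).
    exact/itgZ/(nice_itg T_gt0 hB (nice_mul (nice_coord R j) nG)).
  have idG j : itg P (fun w => A k j * dG j (xiv T B (n0 + e m) w)).
    exact/itgZ/(nice_itg T_gt0 hB (C1_dnice cG j)).
  have i1 : itg P (fun w => Num.sqrt (al k)%:R * hermv (mdecr al k) (xiv T B n0 w) * f (Wm m w)).
    by apply: L2M => //; exact: L2Z.
  have i2 i : itg P (fun w => (\sum_j A k j * @b m i j) *
      (hermv al (xiv T B n0 w) * partials [:: i] f (Wm m w))).
    by apply: itgZ; apply: L2M.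
  have key : \int[P]_w (xi T B n0 k w * (hermv al (xiv T B n0 w) * f (Wm m w))) =
    \int[P]_w (Num.sqrt (al k)%:R * hermv (mdecr al k) (xiv T B n0 w) * f (Wm m w) +
    \sum_i (\sum_j A k j * @b m i j) * (hermv al (xiv T B n0 w) * partials [:: i] f (Wm m w))).
    transitivity (\int[P]_w \sum_j (A k j * (xi T B (n0 + e m) j w * G (xiv T B (n0 + e m) w)))).
      apply: eq_Rintegral => w _; rewrite (xi_refine T_gt0 B (e m) w (ltn_ord k)) mulr_suml.
      by apply: eq_bigr => j _; rewrite GE -/A [RHS]mulrA.
    rewrite Rint_sum//.
    rewrite (eq_bigr (fun j => \int[P]_w (A k j * dG j (xiv T B (n0 + e m) w)))).
      by rewrite -Rint_sum//; apply: eq_Rintegral => w _; exact: dGE.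
    move=> j _; rewrite RintZ; last exact: (nice_itg T_gt0 hB (nice_mul (nice_coord R j) nG)).
    rewrite RintZ; last exact: (nice_itg T_gt0 hB (C1_dnice cG j)).
    by rewrite (grid_ibp T_gt0 hB j cG).
  have i3 : itg P (fun w => xi T B n0 k w * (hermv al (xiv T B n0 w) * f (Wm m w))).
    apply: (itg_eq _ (itg_sum _ (fun j _ => ixG j))) => w.
    rewrite (xi_refine T_gt0 B (e m) w (ltn_ord k)) mulr_suml.
    by apply: eq_bigr => j _; rewrite GE -/A [RHS]mulrA.
  rewrite /ip -RintZ; last exact: L2M.
  (* The term that lowers [al] cancels against the three-term relation, as in [hermv_ibp]. *)
  transitivity (\int[P]_w (xi T B n0 k w * (hermv al (xiv T B n0 w) * f (Wm m w)) -
     Num.sqrt (al k)%:R * hermv (mdecr al k) (xiv T B n0 w) * f (Wm m w))).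
    by apply: eq_Rintegral => w _; rewrite mulrA hermv_rec mulrBl mulrA.
  rewrite RintB// key RintD//; last exact: itg_sum.
  rewrite addrC addKr Rint_sum//; apply: eq_bigr => i _.
  by rewrite RintZ ?cell_coef//; exact: L2M.
have [Lf cvf] := hW_cvg (cf [::]) (gf [::]).
have Lh al' : L2 P (fun w => hermv al' (xiv T B n0 w)) by exact: hermv_L2.
have cl : (fun m => Num.sqrt (al k).+1%:R *
    ip P (fun w => hermv (mincr al k) (xiv T B n0 w)) (fun w => f (Wm m w))) @ \oo -->
  Num.sqrt (al k).+1%:R * ip P (fun w => hermv (mincr al k) (xiv T B n0 w)) (fun w => f (Wi w)).
  apply: cvgM; first exact: cvg_cst.
  apply: ip_cvg => // m; exact: (hWm_L2 (cf [::]) (gf [::])).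
apply: (cvg_unique (@Rhausdorff R) cl).
rewrite (_ : (fun m => _) = (fun m => \sum_i ip leb (cell T n0 k) (fun x => \sum_j @b m i j * cell T (n0 + e m) j x) *
    ip P (fun w => hermv al (xiv T B n0 w)) (fun w => partials [:: i] f (Wm m w)))); last first.
  by apply/funext => m; exact: approx.
apply: cvg_big => [|i _]; first exact: add_continuous.
apply: cvgM.
  apply: ip_cvg.
  - exact: cell_L2.
  - by move=> m; apply: L2_sum => j _; apply: L2Z; exact: cell_L2.
  - exact: (wiener_L2 (hW i)).1.
  - apply: (@cvg0_le R _ (fun m => 2^-1 ^+ m)); first exact: cvg_half.
    by move=> m; rewrite ger0_norm ?ip_ge0//; exact: (hb m i).1.
have [Lfi cvfi] := hW_cvg (cf [:: i]) (gf [:: i]).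
apply: ip_cvg => // m; exact: (hWm_L2 (cf [:: i]) (gf [:: i])).
Qed.

End cylindrical.

(** * Product measures, tensor products and fields on a square *)

Section prodm.
Context d1 d2 (S1 : measurableType d1) (S2 : measurableType d2) (R : realType).
Variables (m1 : {sigma_finite_measure set S1 -> \bar R}).
Variables (m2 : {sigma_finite_measure set S2 -> \bar R}).

(** A copy of the product measure that carries the sigma-finite structure, so that it can itself be
    a factor of further products. *)
Definition prodm : set (S1 * S2) -> \bar R := (m1 \x m2)%E.
HB.instance Definition _ := Measure.on prodm.

Let prodm_sigma_finite : sigma_finite setT prodm.
Proof.
have [F TF Foo] := sigma_finiteT m1; have [G TG Goo] := sigma_finiteT m2.
exists (fun n => if unpickle n is Some (i, j) then F i `*` G j else set0).
  apply/seteqP; split=> // -[x y] _.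
  have [i _ Fx] : (\bigcup_i F i) x by rewrite -TF.
  have [j _ Gy] : (\bigcup_i G i) y by rewrite -TG.
  by exists (pickle (i, j)) => //; rewrite pickleK.
move=> k; case: unpickle => [[i j]|]; last by rewrite measure0.
have [? ?] := Foo i; have [? ?] := Goo j; split; first exact: measurableX.
by rewrite /prodm product_measure1E// lte_mul_pinfty// ge0_fin_numE.
Qed.

HB.instance Definition _ := Measure_isSigmaFinite.Build _ _ _ prodm prodm_sigma_finite.

Lemma prodm_tonelli (f : S1 * S2 -> \bar R) : measurable_fun setT f ->
  (forall z, 0 <= f z)%E ->
  (\int[prodm]_z f z = \int[m1]_x \int[m2]_y f (x, y))%E.
Proof. exact: fubini_tonelli1. Qed.

Lemma prodm_tonelli2 (f : S1 * S2 -> \bar R) : measurable_fun setT f ->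
  (forall z, 0 <= f z)%E ->
  (\int[prodm]_z f z = \int[m2]_y \int[m1]_x f (x, y))%E.
Proof. exact: fubini_tonelli2. Qed.

Lemma prodm_fubini (f : S1 * S2 -> \bar R) : prodm.-integrable setT f ->
  (\int[prodm]_z f z = \int[m1]_x \int[m2]_y f (x, y))%E.
Proof. by move=> If; rewrite [RHS](integral12_prod_meas1 If). Qed.

Lemma prodm_fubini2 (f : S1 * S2 -> \bar R) : prodm.-integrable setT f ->
  (\int[prodm]_z f z = \int[m2]_y \int[m1]_x f (x, y))%E.
Proof. by move=> If; rewrite [RHS](integral21_prod_meas1 If). Qed.

Lemma prodm_integrable (f : S1 * S2 -> \bar R) : measurable_fun setT f ->
  (\int[m1]_x \int[m2]_y `|f (x, y)| < +oo)%E -> prodm.-integrable setT f.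
Proof. by move=> mf h; apply/integrable12ltyP. Qed.

End prodm.


Section tensor.
Context d1 d2 (S1 : measurableType d1) (S2 : measurableType d2) (R : realType).
Variables (m1 : {sigma_finite_measure set S1 -> \bar R}).
Variables (m2 : {sigma_finite_measure set S2 -> \bar R}).

Definition tensor (f : S1 -> R) (g : S2 -> R) (z : S1 * S2) : R := f z.1 * g z.2.

Lemma tensor_meas f g : measurable_fun setT f -> measurable_fun setT g ->
  measurable_fun setT (tensor f g).
Proof.
move=> mf mg; apply: measurable_funM.
  exact: (measurableT_comp mf measurable_fst).
exact: (measurableT_comp mg measurable_snd).
Qed.

Lemma tensor_Rint f g : itg m1 f -> itg m2 g ->
  itg (prodm m1 m2) (tensor f g) /\
  \int[(prodm m1 m2)]_z tensor f g z = \int[m1]_x f x * \int[m2]_y g y.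
Proof.
move=> If Ig; have mf := itg_meas If; have mg := itg_meas Ig.
have inner x : itg m2 (fun y => f x * g y) by exact: itgZ.
have I : itg (prodm m1 m2) (tensor f g).
  apply: prodm_integrable; first by apply/measurable_EFinP; exact: tensor_meas.
  rewrite (_ : (\int[m1]_x _)%E = (\int[m1]_x (`|f x| * \int[m2]_y `|g y|)%:E)%E).
    rewrite -EFin_Rint; last first.
      apply: (itg_eq _ (itgZ (\int[m2]_y `|g y|) (itg_abs If))) => x.
      by rewrite mulrC.
    exact: ltry.
  apply: eq_integral => x _; rewrite -RintZ; last exact: itg_abs.
  rewrite EFin_Rint; last by apply: itgZ; exact: itg_abs.
  by apply: eq_integral => y _; rewrite /tensor/= normrM.
split=> //.
have e : (\int[(prodm m1 m2)]_z (tensor f g z)%:E = (\int[m1]_x f x * \int[m2]_y g y)%:E)%E.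
  rewrite (prodm_fubini I).
  transitivity (\int[m1]_x (f x * \int[m2]_y g y)%:E)%E.
    apply: eq_integral => x _; rewrite -RintZ// EFin_Rint//.
  rewrite -EFin_Rint; last first.
    by apply: (itg_eq _ (itgZ (\int[m2]_y g y) If)) => x; rewrite mulrC.
  rewrite mulrC -RintZ//; congr (_ %:E); apply: eq_Rintegral => x _; exact: mulrC.
by rewrite /Rintegral e.
Qed.

Lemma tensor_L2 f g : L2 m1 f -> L2 m2 g -> L2 (prodm m1 m2) (tensor f g).
Proof.
move=> [mf If] [mg Ig]; split; first exact: tensor_meas.
apply: (itg_eq _ (tensor_Rint If Ig).1) => z; by rewrite /tensor exprMn.
Qed.

Lemma tensor_ip f g f' g' : L2 m1 f -> L2 m2 g -> L2 m1 f' -> L2 m2 g' ->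
  ip (prodm m1 m2) (tensor f g) (tensor f' g') = ip m1 f f' * ip m2 g g'.
Proof.
move=> Lf Lg Lf' Lg'; rewrite -(tensor_Rint (L2M Lf Lf') (L2M Lg Lg')).2.
by apply: eq_Rintegral => z _; rewrite /tensor mulrACA.
Qed.

End tensor.

Section square.
Context (R : realType) d (S : measurableType d) d' (X : measurableType d').
Variables (mu : {sigma_finite_measure set S -> \bar R}).
Variables (nu : {sigma_finite_measure set X -> \bar R}) (D : set X).
Hypothesis mD : measurable D.

Local Notation sqm := (prodm mu (prodm nu nu)).

Definition box : set (S * (X * X)) := [set: S] `*` (D `*` D).

Lemma box_meas : measurable box.
Proof. by apply: measurableX => //; exact: measurableX. Qed.

(** The sample point is moved to the front, and the field is extended by [point], which is 0 for
    real and extended real values. *)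
Definition cut2 (U : pointedType) (V : X -> X -> S -> U) : S * (X * X) -> U :=
  (fun z => V z.2.1 z.2.2 z.1) \_ box.

Lemma cut2E (U : pointedType) (V : X -> X -> S -> U) w x y :
  cut2 V (w, (x, y)) = if (x \in D) && (y \in D) then V x y w else point.
Proof.
rewrite /cut2 patchE /box; congr (if _ then _ else _).
by apply/idP/andP; rewrite !inE => -[]//= _ [].
Qed.

Lemma cut2_meas d2 (U : measurableType d2) (V : X -> X -> S -> U) :
  measurable_fun (D `*` D `*` setT) (fun z => V z.1.1 z.1.2 z.2) ->
  measurable_fun setT (cut2 V).
Proof.
move=> mV; rewrite /cut2; apply/(measurable_restrictT _ box_meas).
apply: (measurable_comp (F := D `*` D `*` setT) (f := fun z => V z.1.1 z.1.2 z.2)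
  (g := fun z : S * (X * X) => (z.2, z.1))) => //.
- by apply: measurableX => //; exact: measurableX.
- by move=> _ [[w [x y]] [_ [h1 h2]] <-].
- apply: (@measurable_funS _ _ _ _ setT) => //.
  by apply: measurable_fun_pair; [exact: measurable_snd|exact: measurable_fst].
Qed.

Lemma cut2_int (V : X -> X -> S -> \bar R) : measurable_fun setT (cut2 V) ->
  (forall x y w, 0 <= V x y w)%E ->
  (\int[mu]_w \int[nu]_(x in D) \int[nu]_(y in D) V x y w =
   \int[sqm]_z cut2 V z)%E.
Proof.
move=> mc V0.
have c0 z : (0 <= cut2 V z)%E.
  by case: z => w [x y]; rewrite cut2E; case: ifP.
rewrite prodm_tonelli//; apply: eq_integral => w _.
rewrite prodm_tonelli//; last exact: (measurableT_comp mc (measurable_pair1 w)).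
rewrite integral_mkcond; apply: eq_integral => x _.
rewrite patchE; case: ifPn => [xD|xD].
  rewrite integral_mkcond; apply: eq_integral => y _.
  by rewrite patchE cut2E xD.
by rewrite integral0_eq// => y _; rewrite cut2E (negbTE xD).
Qed.

End square.

(** * Second-order integration by parts on the Malliavin domain *)

Section second_order.
Context (R : realType) d (Om : measurableType d) (P : probability Om R).
Variables (T : R) (B : R -> Om -> R).
Hypothesis T_gt0 : 0 < T.
Hypothesis hB : brownian_motion P T B.
Local Notation leb := (@lebesgue_measure R).
Local Notation leb2 := (prodm leb leb).
Local Notation mu2 := (prodm P leb2).
Local Notation I := (`[0, T]%classic : set (measurableTypeR R)).

Definition basis2 n (al : mindex (2 ^ n)) (k l : 'I_(2 ^ n)) : Om * (R * R) -> R :=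
  tensor (fun w => hermv al (xiv T B n w)) (tensor (cell T n k) (cell T n l)).

(** A weak form of [V] being the second derivative of [F]: an identity between coefficients, linear
    in the pair and stable under L^2 limits. *)
Definition ibp2 (F : Om -> R) (V : Om * (R * R) -> R) : Prop :=
  forall n (al : mindex (2 ^ n)) (k l : 'I_(2 ^ n)),
  Num.sqrt (al k).+1%:R * (Num.sqrt (mincr al k l).+1%:R *
    ip P (fun w => hermv (mincr (mincr al k) l) (xiv T B n w)) F) =
  ip mu2 (basis2 al k l) V.

Lemma basis2_L2 n (al : mindex (2 ^ n)) (k l : 'I_(2 ^ n)) : L2 mu2 (basis2 al k l).
Proof.
by apply: tensor_L2; [exact: hermv_L2|apply: tensor_L2; exact: cell_L2].
Qed.

Section smooth.
Variables (r : nat) (phi : 'I_r.+1 -> R -> R) (W : 'I_r.+1 -> Om -> R).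
Hypothesis hW : forall i, wiener_integral P T B (phi i) (W i).

Lemma cyl_L2 h : continuous h -> pgrowth h -> L2 P (fun w => h (\row_i W i w)).
Proof.
move=> ch gh; have [e [b hb]] := wiener_family T_gt0 hB 0 hW.
exact: (hW_cvg T_gt0 hB hW hb ch gh).1.
Qed.

Lemma smooth_ibp f n (al : mindex (2 ^ n)) k : smooth_poly_growth f ->
  Num.sqrt (al k).+1%:R * ip P (fun w => hermv (mincr al k) (xiv T B n w)) (fun w => f (\row_i W i w)) =
  \sum_i ip leb (cell T n k) (cut T (phi i)) *
    ip P (fun w => hermv al (xiv T B n w)) (fun w => partials [:: i] f (\row_i W i w)).
Proof.
move=> sf; have [e [b hb]] := wiener_family T_gt0 hB n hW.
exact: (cyl_ibp T_gt0 hB hW hb).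
Qed.

Lemma smooth_cut2 (f : 'I_r.+1 -> 'I_r.+1 -> Om -> R) (D2F : R -> R -> Om -> R) :
  (forall x y w, D2F x y w = \sum_i \sum_j f i j w * phi i x * phi j y) ->
  cut2 I D2F = (fun z => \sum_i \sum_j
     tensor (f i j) (tensor (cut T (phi i)) (cut T (phi j))) z).
Proof.
move=> hD; apply/funext => -[w [x y]]; rewrite cut2E hD.
case: ifPn => [/andP[xI yI]|xyI].
  apply: eq_bigr => i _; apply: eq_bigr => j _.
  by rewrite /tensor /cut/= !patchE xI yI mulrA.
rewrite big1// => i _; rewrite big1// => j _.
rewrite /tensor /cut/= !patchE; move: xyI; rewrite negb_and => /orP[]/negbTE ->.
  by rewrite mul0r mulr0.
by rewrite mulr0 mulr0.
Qed.

End smooth.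

Lemma smooth_poly_growth_partial r (f : 'rV[R]_r.+1 -> R) t : smooth_poly_growth f ->
  smooth_poly_growth (partials t f).
Proof.
by move=> sf s; rewrite /partials -foldr_cat; exact: sf.
Qed.

(** The first-order formula is used twice, the second time for the partial derivatives of [f], which
    belong to the same class. *)
Lemma smooth_ibp2 F DF D2F : smooth_cylindrical P T B F DF D2F ->
  [/\ L2 P F, L2 mu2 (cut2 I D2F) & ibp2 F (cut2 I D2F)].
Proof.
move=> [r [phi [W [f [hW sf hF _ hD]]]]].
have df s x : differentiable (partials s f) x by exact: (sf s).1.
have gf s : pgrowth (partials s f) by exact: (sf s).2.
have cf s : continuous (partials s f) by move=> x; exact: differentiable_continuous.
have FE : F = (fun w => f (\row_i W i w)) by apply/funext.
have LF s : L2 P (fun w => partials s f (\row_i W i w)) by exact: (cyl_L2 hW).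
have Lphi i : L2 leb (cut T (phi i)) := (wiener_L2 (hW i)).1.
have Lt i j : L2 mu2 (tensor (fun w => partials [:: i; j] f (\row_i W i w)) (tensor (cut T (phi i)) (cut T (phi j)))).
  by apply: tensor_L2; [exact: LF|exact: tensor_L2].
rewrite (smooth_cut2 hD); split.
- by rewrite FE; exact: (LF [::]).
- by apply: L2_sum => i _; apply: L2_sum => j _.
move=> n al k l; have Lb := basis2_L2 al k l.
rewrite ip_sumr//; last by move=> i _; apply: L2_sum.
under eq_bigr do rewrite ip_sumr//.
rewrite FE (smooth_ibp hW _ _ sf) mulr_sumr exchange_big/=; apply: eq_bigr => j _.
rewrite mulrCA (smooth_ibp hW _ _ (smooth_poly_growth_partial [:: j] sf)) mulr_sumr.
apply: eq_bigr => i _.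
have Lk q : L2 leb (cell T n q) by exact: cell_L2.
rewrite (tensor_ip (hermv_L2 T_gt0 hB al) (tensor_L2 (Lk k) (Lk l)) (LF [:: i; j])
  (tensor_L2 (Lphi i) (Lphi j))) (tensor_ip (Lk k) (Lk l) (Lphi i) (Lphi j)).
ring.
Qed.

(** [f] is only known to be measurable; it lies in L^2 because one of the differences [F n - f] has
    finite norm. *)
Lemma L2_near d' (S : measurableType d') (mu : {measure set S -> \bar R}) (F : nat -> S -> R) (f : S -> R) :
  measurable_fun setT f -> (forall n, L2 mu (F n)) ->
  (fun n => \int[mu]_x ((F n x - f x) ^+ 2)%:E)%E @ \oo --> 0%E ->
  L2 mu f /\ (fun n => ip mu (fun x => F n x - f x) (fun x => F n x - f x)) @ \oo --> 0.
Proof.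
move=> mf LF cv; have [n _ /(_ n (leqnn n))/= hn] := ereal_cvg0_lt cv ltr01.
have Lf : L2 mu f.
  have L : L2 mu (fun x => F n x - f x).
    apply/L2P; split; last exact: lt_trans hn (ltry _).
    by apply: measurable_funB => //; have [] := LF n.
  by apply: (L2_eq _ (L2B (LF n) L)) => x; ring.
split=> //; suff : (fun n => (ip mu (fun x => F n x - f x) (fun x => F n x - f x))%:E) @ \oo --> 0%:E.
  by move=> /fine_cvg.
apply: cvg_trans cv; apply: near_eq_cvg; apply: nearW => q /=.
by rewrite ip_EFin//; exact: L2B.
Qed.

Lemma malliavin22_approx F DF D2F : malliavin22 P T B F DF D2F ->
  [/\ L2 P F, L2 mu2 (cut2 I D2F) & exists Fn DFn D2Fn,
  [/\ forall n, smooth_cylindrical P T B (Fn n) (DFn n) (D2Fn n),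
    (fun n => ip P (fun x => Fn n x - F x) (fun x => Fn n x - F x)) @ \oo --> 0 &
    (fun n => ip mu2 (fun z => cut2 I (D2Fn n) z - cut2 I D2F z)
                (fun z => cut2 I (D2Fn n) z - cut2 I D2F z)) @ \oo --> 0]].
Proof.
move=> [mF _ mD2 [Fn [DFn [D2Fn [hs cF _ cD]]]]].
have LF n : L2 P (Fn n) by have [] := smooth_ibp2 (hs n).
have LD n : L2 mu2 (cut2 I (D2Fn n)) by have [] := smooth_ibp2 (hs n).
have mc : measurable_fun setT (cut2 I D2F) by exact: cut2_meas.
have [L1 c1] := L2_near mF LF cF.
have cD' : (fun n => \int[mu2]_z ((cut2 I (D2Fn n) z - cut2 I D2F z) ^+ 2)%:E)%E @ \oo --> 0%E.
  rewrite (_ : (fun n => _) = (fun n => \int[P]_w \int[leb]_(x in `[0%R, T])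
             \int[leb]_(y in `[0%R, T]) ((D2Fn n x y w - D2F x y w) ^+ 2)%:E)%E)//.
  apply/funext => n.
  have e : (fun z => ((cut2 I (D2Fn n) z - cut2 I D2F z) ^+ 2)%:E) =
      cut2 I (fun x y w => ((D2Fn n x y w - D2F x y w) ^+ 2)%:E).
    apply/funext => -[w [x y]]; rewrite !cut2E; case: ifP => // _.
    by rewrite subrr expr0n.
  rewrite e cut2_int//.
    rewrite -e; apply/measurable_EFinP/measurable_funX/measurable_funB => //.
    by have [] := LD n.
  by move=> *; rewrite lee_fin sqr_ge0.
have [L2' c2] := L2_near mc LD cD'.
by split=> //; exists Fn, DFn, D2Fn.
Qed.

(** Both sides of [ibp2] are continuous in L^2, so the identity passes from smooth variables to the
    closure. *)
Lemma malliavin22_ibp2 F DF D2F : malliavin22 P T B F DF D2F ->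
  [/\ L2 P F, L2 mu2 (cut2 I D2F) & ibp2 F (cut2 I D2F)].
Proof.
move=> /malliavin22_approx[L1 L2' [Fn [DFn [D2Fn [hs c1 c2]]]]].
have LF n : L2 P (Fn n) by have [] := smooth_ibp2 (hs n).
have LD n : L2 mu2 (cut2 I (D2Fn n)) by have [] := smooth_ibp2 (hs n).
split=> // n al k l.
have Lh : L2 P (fun w => hermv (mincr (mincr al k) l) (xiv T B n w)) by exact: hermv_L2.
have h2 := ip_cvg (basis2_L2 al k l) LD L2' c2.
apply: (cvg_unique (@Rhausdorff R) _ h2).
rewrite (_ : (fun m => _) = (fun m => Num.sqrt (al k).+1%:R * (Num.sqrt (mincr al k l).+1%:R *
    ip P (fun w => hermv (mincr (mincr al k) l) (xiv T B n w)) (Fn m)))); last first.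
  by apply/funext => m; have [_ _ ->] := smooth_ibp2 (hs m).
apply: cvgM; first exact: cvg_cst.
apply: cvgM; first exact: cvg_cst.
exact: ip_cvg.
Qed.

End second_order.

(** * Integrals of functions singular at the endpoints *)

Section antiderivative.
Context (R : realType).
Local Notation leb := (@lebesgue_measure R).

(** [f] may blow up at [a] and [b]: compact subintervals exhaust the open one, the fundamental
    theorem of calculus applies on each, and monotone convergence concludes. *)
Lemma integral_le_antiderivative (a b M : R) (f F : R -> R) : a < b ->
  (forall x : R, a < x < b -> is_derive x 1 F (f x)) ->
  (forall x : R, a < x < b -> {for x, continuous f}) ->
  (forall x, a < x < b -> 0 <= f x) -> (forall x, a < x < b -> `|F x| <= M) ->
  (\int[leb]_(x in `]a, b[) (f x)%:E <= (2 * M)%:E)%E.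
Proof.
(* [n + 3] keeps [e n] below half the length, so that no subinterval degenerates. *)
move=> ab dF cf f0 FM; pose e n : R := (b - a) / n.+3%:R.
have ba : 0 < b - a by rewrite subr_gt0.
have e0 n : 0 < e n by rewrite divr_gt0.
have e2 n : e n < (b - a) / 2 by rewrite /e ltr_pM2l// ltf_pV2 ?posrE// ltr_nat.
have in_ab n x : a + e n <= x <= b - e n -> a < x < b.
  by move=> /andP[h1 h2]; have := e0 n => ?; apply/andP; split; lra.
pose E n := `[a + e n, b - e n]%classic.
have EU : `]a, b[%classic = \bigcup_n E n.
  apply/seteqP; split=> x /=; rewrite ?in_itv/=.
    move=> /andP[h1 h2]; pose m := Num.min (x - a) (b - x).
    have m0 : 0 < m by rewrite lt_min !subr_gt0 h1.
    pose n := Num.trunc ((b - a) / m); exists n => //; rewrite /E/= in_itv/=.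
    have en : e n <= m.
      rewrite ler_pdivrMr// mulrC -ler_pdivrMr// ltW// (lt_le_trans (truncnS_gt _))//.
      by rewrite ler_nat; exact: (leq_trans (leqnSn _) (leqnSn _)).
    have := ge_min (x - a) (x - a) (b - x); have := ge_min (b - x) (x - a) (b - x).
    rewrite !lexx orbT /= -/m => h3 h4; apply/andP; split; lra.
  by move=> [n _]; rewrite /E/= in_itv/=; exact: in_ab.
have cE n : {within E n, continuous f}.
  apply: (@continuous_in_subspaceT _ _ (E n) f) => x; rewrite inE /E/= in_itv/= => /in_ab.
  exact: cf.
have mf n : measurable_fun (E n) (EFin \o f).
  apply/measurable_EFinP; apply: subspace_continuous_measurable_fun => //.
  exact: measurable_itv.
rewrite EU; have cv := @ge0_nondecreasing_set_cvg_integral _ (measurableTypeR R) R E (EFin \o f) leb.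
have {}cv : (\int[leb]_(x in E i) (f x)%:E)%E @[i --> \oo] -->
    (\int[leb]_(x in \bigcup_i E i) (f x)%:E)%E.
  apply: cv => //.
  - move=> n m nm; apply/subsetPset => x; rewrite /E/= !in_itv/= => /andP[h1 h2].
    have : e m <= e n by rewrite /e ler_pM2l// lef_pV2 ?posrE// ler_nat.
    by move=> ?; apply/andP; split; lra.
  - by move=> n; exact: measurable_itv.
  - by move=> n x; rewrite /E/= in_itv/= => /in_ab/f0; rewrite lee_fin.
rewrite -(cvg_lim _ cv)//; apply: lime_le; first by apply/cvg_ex; eexists; exact: cv.
apply: nearW => n.
have cn : a + e n < b - e n by have := e2 n => ?; lra.
rewrite (@continuous_FTC2 _ f F)//.
- have h1 : `|F (b - e n)| <= M by apply: FM; apply: (in_ab n); rewrite lexx ltW.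
  have h2 : `|F (a + e n)| <= M by apply: FM; apply: (in_ab n); rewrite lexx ltW.
  rewrite -EFinB lee_fin; move: h1 h2; rewrite !ler_norml => /andP[? ?] /andP[? ?].
  lra.
- exact: cE.
- have cF x : a < x < b -> {for x, continuous F}.
    move=> /dF h; apply: differentiable_continuous; apply/derivable1_diffP.
    exact: ex_derive.
  split.
  + move=> x; rewrite in_itv/= => /andP[h1 h2].
    have /dF h : a < x < b by apply: (in_ab n); rewrite !ltW.
    exact: ex_derive.
  + by apply: cvg_at_right_filter; apply: cF; apply: (in_ab n); rewrite lexx ltW.
  + by apply: cvg_at_left_filter; apply: cF; apply: (in_ab n); rewrite lexx ltW.
- move=> x; rewrite in_itv/= => /andP[h1 h2].
  have /dF h : a < x < b by apply: (in_ab n); rewrite !ltW.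
  by rewrite derive1E derive_val.
Qed.

End antiderivative.

(** * The kernel: separation of its singularities and a uniform bound *)

Section kernel.
Context (R : realType).
Variables (H T : R).
Hypothesis H_gt : 2^-1 < H.
Hypothesis H_lt : H < 1.
Hypothesis T_gt0 : 0 < T.
Local Notation leb := (@lebesgue_measure R).
Local Notation I := (`[0, T]%classic : set (measurableTypeR R)).

(** Both inequalities are closed, to match the interval of integration of [I_kernel]. *)
Definition kap (u y : R) : R :=
  if (0 <= y) && (y <= u) then dK ((H + 1) / 2) u y else 0.

Lemma kap_ge0 u y : 0 <= kap u y.
Proof. by rewrite /kap; case: ifP => // _; rewrite /dK !mulr_ge0 ?powR_ge0. Qed.

Lemma kap_meas : measurable_fun setT (fun z : measurableTypeR R * measurableTypeR R => kap z.1 z.2).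
Proof.
rewrite /kap; apply: measurable_fun_if => //.
- apply: measurable_and; exact: measurable_fun_ler.
- rewrite /dK; apply: measurable_funM; first apply: measurable_funM; first apply: measurable_funM => //.
  + apply: (measurableT_comp (measurable_powR _)).
    by apply: measurable_funS measurable_snd.
  + apply: (measurableT_comp (measurable_powR _)).
    by apply: measurable_funS measurable_fst.
  + apply: (measurableT_comp (measurable_powR _)).
    apply: (@measurable_funS _ _ _ _ setT) => //.
    by apply: measurable_funB; [exact: measurable_fst|exact: measurable_snd].
Qed.

(** The two singularities are separated by comparing [y] with [u / 2]: below it
    [(u - y)^(H/2 - 1) u^(H/2) <= 2 u^(H - 1)], above it [(u / y)^(H/2) <= 2]. *)
Lemma kap_le u y : kap u y <= c_const ((H + 1) / 2) *
   (\1_(`]0, u[%classic) y * (2 * (u - y) `^ (H / 2 - 1) + 2 * u `^ (H - 1) * y `^ (- (H / 2)))).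
Proof.
have H1 : H < 1 := H_lt; have H2 : 2^-1 < H := H_gt.
have c0 : 0 <= c_const ((H + 1) / 2) by rewrite powR_ge0.
have R0 : 0 <= 2 * (u - y) `^ (H / 2 - 1) + 2 * u `^ (H - 1) * y `^ (- (H / 2)).
  by rewrite addr_ge0 ?mulr_ge0 ?powR_ge0.
have E1 : 2^-1 - (H + 1) / 2 = - (H / 2) :> R by field.
have E2 : (H + 1) / 2 - 2^-1 = H / 2 :> R by field.
have E3 : (H + 1) / 2 - 3 / 2 = H / 2 - 1 :> R by field.
have [/andP[y0 yu]|h] := boolP ((0 < y) && (y < u)); last first.
  rewrite /kap; case: ifP => [/andP[y0 yu]|_]; last by rewrite mulr_ge0 ?mulr_ge0.
  rewrite /dK E1 E2 E3; apply: (@le_trans _ _ 0); last by rewrite mulr_ge0 ?mulr_ge0.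
  (* At [y = 0] and at [y = u] one factor is a power of 0 with nonzero exponent, which [powR] sets
     to 0. *)
  move: y0 yu; rewrite 2!le_eqVlt => /predU1P[<-|y0]/predU1P yu.
    rewrite powR0; last by rewrite oppr_eq0 mulf_neq0// gt_eqF// (lt_trans _ H_gt).
    by rewrite !(mulr0, mul0r).
  case: yu => [e|yu]; last by rewrite y0 yu in h.
  rewrite e subrr powR0; last by rewrite lt_eqF// subr_lt0 ltr_pdivrMr// mul1r (lt_trans H_lt)// ltr1n.
  by rewrite !mulr0.
have u0 : 0 < u by exact: lt_trans yu.
rewrite /kap (ltW y0) (ltW yu) /dK E1 E2 E3 indicE mem_set ?mul1r /=; last by rewrite in_itv/= y0 yu.
rewrite -!mulrA ler_wpM2l//.
have two a : a <= 1 -> 2 `^ a <= 2 :> R.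
  by move=> a1; rewrite -[leRHS](powRr1 (ler0n _ 2)) ler_powR ?ler1n.
have [yh|yh] := leP y (u / 2).
- have h1 : (u - y) `^ (H / 2 - 1) * u `^ (H / 2) <= 2 * u `^ (H - 1).
    have uu : u `^ (H - 1) = u `^ (H / 2 - 1) * u `^ (H / 2).
      by rewrite -powRD ?(gt_eqF u0) ?implybT//; congr (_ `^ _); field.
    rewrite uu mulrA ler_wpM2r ?powR_ge0//.
    rewrite -(opprB 1) !powRN invf_ple ?posrE ?powR_gt0//; [|lra|by rewrite mulr_gt0 ?invr_gt0 ?powR_gt0].
    have h0 : u `^ (1 - H / 2) <= 2 * (u - y) `^ (1 - H / 2).
      apply: (@le_trans _ _ ((2 * (u - y)) `^ (1 - H / 2))).
        apply: ge0_ler_powR; rewrite ?nnegrE; lra.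
      by rewrite powRM//; [rewrite ler_wpM2r ?powR_ge0// two//; lra|lra].
    by rewrite invfM invrK ler_pdivrMl.
  apply: (@le_trans _ _ (2 * u `^ (H - 1) * y `^ (- (H / 2)))).
    by rewrite mulrC [u `^ _ * _]mulrC ler_wpM2r ?powR_ge0.
  by rewrite -mulrA lerDr mulr_ge0 ?powR_ge0.
- have h1 : y `^ (- (H / 2)) * u `^ (H / 2) <= 2.
    have h0 : u `^ (H / 2) <= 2 * y `^ (H / 2).
      apply: (@le_trans _ _ ((2 * y) `^ (H / 2))).
        by apply: ge0_ler_powR; rewrite ?nnegrE; lra.
      by rewrite powRM//; [rewrite ler_wpM2r ?powR_ge0// two//; lra|lra].
    by rewrite powRN ler_pdivrMl ?powR_gt0// [y `^ _ * _]mulrC.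
  rewrite mulrA; apply: (@le_trans _ _ (2 * (u - y) `^ (H / 2 - 1))).
    by rewrite ler_wpM2r ?powR_ge0.
  by rewrite lerDl !mulr_ge0 ?powR_ge0.
Qed.

(** Both terms of [kap_le] have explicit antiderivatives, and the powers of [u] combine into
    [u^(H/2)], at most [T^(H/2)]; hence the uniformity in [u]. *)
Lemma kap_bound : exists2 C, 0 <= C &
  forall u, 0 <= u <= T -> (\int[leb]_y (kap u y)%:E <= C%:E)%E.
Proof.
set c := c_const ((H + 1) / 2); have c0 : 0 <= c by rewrite powR_ge0.
set a := H / 2; have a0 : 0 < a by rewrite /a; have := H_gt; lra.
have a1 : 0 < 1 - a by rewrite /a; have := H_lt; lra.
set M := (2 / a + 2 / (1 - a)) * T `^ a.
have A0 : 0 <= 2 / a by apply: divr_ge0 => //; exact: ltW.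
have A1 : 0 <= 2 / (1 - a) by apply: divr_ge0 => //; exact: ltW.
have M0 : 0 <= M by apply: mulr_ge0; [exact: addr_ge0|exact: powR_ge0].
exists (c * (2 * M)); first by rewrite mulr_ge0// mulr_ge0.
move=> u /andP[u0 uT].
pose f y := 2 * (u - y) `^ (H / 2 - 1) + 2 * u `^ (H - 1) * y `^ (- (H / 2)).
have f0 y : 0 <= f y by rewrite addr_ge0 ?mulr_ge0 ?powR_ge0.
have mpow p : measurable_fun setT (fun y : measurableTypeR R => (u - y) `^ p).
  by apply: (measurableT_comp (measurable_powR p)); exact: measurable_funB.
have mf : measurable_fun setT f.
  have mpow' p : measurable_fun setT (fun y : measurableTypeR R => y `^ p) by exact: measurable_powR.
  by apply: measurable_funD; apply: measurable_funM => //; exact: mpow.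
apply: (@le_trans _ _ (\int[leb]_y (c * (\1_(`]0, u[%classic) y * f y))%:E)%E).
  apply: ge0_le_integral => //.
  - by move=> y _; rewrite lee_fin kap_ge0.
  - apply/measurable_EFinP.
    exact: (measurableT_comp kap_meas (pair1_measurable u)).
  - by apply/measurable_EFinP; apply: measurable_funM => //; apply: measurable_funM.
  - by move=> y _; rewrite lee_fin; exact: kap_le.
under eq_integral do rewrite EFinM.
rewrite ge0_integralZl//; last 2 first.
- by apply/measurable_EFinP; apply: measurable_funM.
- by move=> y _; rewrite lee_fin mulr_ge0.
rewrite EFinM lee_pmul//.
  by apply: integral_ge0 => y _; rewrite lee_fin mulr_ge0.
rewrite (_ : (\int[leb]_y _)%E = (\int[leb]_(y in `]0%R, u[) (f y)%:E)%E); last first.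
  rewrite [RHS]integral_mkcond; apply: eq_integral => y _.
  by rewrite patchE indicE mem_setE; case: ifP => _; rewrite ?mul1r ?mul0r.
have [u00|un0] := leP u 0.
  by rewrite set_itv_ge ?bnd_simp -?leNgt// integral_set0 lee_fin mulr_ge0.
pose F y := 2 * u `^ (H - 1) / (1 - a) * y `^ (1 - a) - 2 / a * (u - y) `^ a.
apply: (@integral_le_antiderivative R 0 u M f F un0).
- move=> y /andP[y0 yu].
  have d1 : is_derive (y : R) (1 : R) (fun y => y `^ (1 - a)) ((1 - a) * y `^ (1 - a - 1)) by exact: is_derive1_powR.
  have d2 : is_derive (u - y : R) (1 : R) (fun y => y `^ a) (a * (u - y) `^ (a - 1)).
    by apply: is_derive1_powR; rewrite subr_gt0.
  have d3 : is_derive (y : R) (1 : R) (fun y => u - y) (-1).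
    by apply: (is_derive_eq (is_deriveB (is_derive_cst u y 1) (is_derive_id y 1))); rewrite sub0r.
  have d4 := @is_derive1_comp R (fun y => y `^ a) (fun y => u - y) y _ _ d2 d3.
  have d5 := is_deriveB (is_deriveZ (2 * u `^ (H - 1) / (1 - a)) d1) (is_deriveZ (2 / a) d4).
  apply: (is_derive_eq d5); rewrite /GRing.scale/= /f -/a.
  rewrite (_ : 1 - a - 1 = - a); last by ring.
  by field; rewrite !gt_eqF.
- move=> y /andP[y0 yu].
  have d1 : is_derive (y : R) (1 : R) (fun y => y `^ (- a)) ((- a) * y `^ (- a - 1)) by exact: is_derive1_powR.
  have d2 : is_derive (u - y : R) (1 : R) (fun y => y `^ (a - 1)) ((a - 1) * (u - y) `^ (a - 1 - 1)).
    by apply: is_derive1_powR; rewrite subr_gt0.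
  have d3 : is_derive (y : R) (1 : R) (fun y => u - y) (-1).
    by apply: (is_derive_eq (is_deriveB (is_derive_cst u y 1) (is_derive_id y 1))); rewrite sub0r.
  have d4 := @is_derive1_comp R (fun y => y `^ (a - 1)) (fun y => u - y) y _ _ d2 d3.
  have d5 := is_deriveD (is_deriveZ 2 d4) (is_deriveZ (2 * u `^ (H - 1)) d1).
  have [df d6] : exists df, is_derive (y : R) (1 : R) f df by eexists; apply: (is_derive_eq d5).
  apply: differentiable_continuous; apply/derivable1_diffP; exact: ex_derive.
- by move=> y _; exact: f0.
- move=> y /andP[y0 yu].
  have h1 : y `^ (1 - a) <= u `^ (1 - a) by apply: ge0_ler_powR; rewrite ?nnegrE; lra.
  have h2 : (u - y) `^ a <= u `^ a by apply: ge0_ler_powR; rewrite ?nnegrE; lra.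
  have h3 : u `^ a <= T `^ a by apply: ge0_ler_powR; rewrite ?nnegrE; lra.
  have h4 : u `^ (H - 1) * u `^ (1 - a) = u `^ a.
    by rewrite -powRD ?(gt_eqF un0) ?implybT//; congr (_ `^ _); rewrite /a; field.
  have k1 : 2 * u `^ (H - 1) / (1 - a) * y `^ (1 - a) <= 2 / (1 - a) * T `^ a.
    rewrite (_ : 2 * u `^ (H - 1) / (1 - a) * y `^ (1 - a) =
      2 / (1 - a) * (u `^ (H - 1) * y `^ (1 - a))); last by rewrite -!mulrA; congr (2 * _); rewrite mulrCA.
    rewrite ler_wpM2l// (le_trans _ h3)// -h4 ler_wpM2l ?powR_ge0//.
  have k2 : 2 / a * (u - y) `^ a <= 2 / a * T `^ a.
    by rewrite ler_wpM2l// (le_trans h2).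
  have k3 : 0 <= 2 * u `^ (H - 1) / (1 - a) * y `^ (1 - a).
    by rewrite !mulr_ge0 ?powR_ge0 ?invr_ge0 ?(ltW a1).
  have k4 : 0 <= 2 / a * (u - y) `^ a by apply: mulr_ge0 => //; exact: powR_ge0.
  by rewrite ler_norml /M mulrDl /F; apply/andP; split; lra.
Qed.

End kernel.

(** The integral is the difference of those of the positive and negative parts, each measurable by
    Tonelli; this covers kernels that are infinite or ill defined at some points. *)
Lemma measurable_integral_section d1 d2 (S1 : measurableType d1) (S2 : measurableType d2)
    (R : realType) (m2 : {sigma_finite_measure set S2 -> \bar R}) (f : S1 * S2 -> \bar R) :
  measurable_fun setT f -> measurable_fun setT (fun x => \int[m2]_y f (x, y))%E.
Proof.
move=> mf.
rewrite (_ : (fun x => _) = (fun x => \int[m2]_y f^\+ (x, y) - \int[m2]_y f^\- (x, y))%E).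
  apply: emeasurable_funB.
    have h : measurable_fun setT (fubini_F m2 (f^\+)%E).
      by apply: measurable_fun_fubini_tonelli_F => //; exact: measurable_funepos.
    exact: h.
  have h : measurable_fun setT (fubini_F m2 (f^\-)%E).
    by apply: measurable_fun_fubini_tonelli_F => //; exact: measurable_funeneg.
  exact: h.
apply/funext => x; rewrite integralE; congr (_ - _)%E; apply: eq_integral => y _.
  by rewrite !funeposE.
by rewrite !funenegE.
Qed.

Lemma ge0_tensor_integral d1 d2 (S1 : measurableType d1) (S2 : measurableType d2)
    (R : realType) (m1 : {sigma_finite_measure set S1 -> \bar R})
    (m2 : {sigma_finite_measure set S2 -> \bar R}) (f : S1 -> R) (g : S2 -> R) :
  measurable_fun setT f -> measurable_fun setT g ->
  (forall x, 0 <= f x) -> (forall y, 0 <= g y) ->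
  (\int[prodm m1 m2]_z (tensor f g z)%:E =
   (\int[m1]_x (f x)%:E) * \int[m2]_y (g y)%:E)%E.
Proof.
move=> mf mg f0 g0; rewrite prodm_tonelli//; last 2 first.
- by apply/measurable_EFinP; exact: tensor_meas.
- by move=> z; rewrite lee_fin mulr_ge0.
rewrite -ge0_integralZr//; last 3 first.
- exact/measurable_EFinP.
- by move=> x _; rewrite lee_fin.
- by apply: integral_ge0 => y _; rewrite lee_fin.
apply: eq_integral => x _; rewrite -ge0_integralZl//; last 3 first.
- exact/measurable_EFinP.
- by move=> y _; rewrite lee_fin.
- by rewrite lee_fin.
Qed.

(** * Fubini for the kernel operator *)

Section kernel_fubini.
Context (R : realType).
Variables (H T : R).
Hypothesis H_gt : 2^-1 < H.
Hypothesis H_lt : H < 1.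
Hypothesis T_gt0 : 0 < T.
Local Notation leb := (@lebesgue_measure R).
Local Notation leb2 := (prodm leb leb).
Local Notation I := (`[0, T]%classic : set (measurableTypeR R)).
Local Notation RR := (measurableTypeR R).

Lemma d_const_gt0 : 0 < d_const H.
Proof.
have H1 : H < 1 := H_lt; have H2 : 2^-1 < H := H_gt.
rewrite mulr_gt0 ?invr_gt0 ?powR_gt0//; first by lra.
by apply: divr_gt0; [lra|apply: mulr_gt0; lra].
Qed.

Definition kap2 (s : R) (y : R * R) : R := kap H s y.1 * kap H s y.2.

Lemma kap2_meas : measurable_fun setT (fun z : RR * (RR * RR) => kap2 z.1 z.2).
Proof.
have m1 : measurable_fun setT (fun z : RR * (RR * RR) => z.2.1).
  exact: (measurableT_comp measurable_fst measurable_snd).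
have m2 : measurable_fun setT (fun z : RR * (RR * RR) => z.2.2).
  exact: (measurableT_comp measurable_snd measurable_snd).
apply: measurable_funM.
  exact: (measurableT_comp (kap_meas H) (measurable_fun_pair measurable_fst m1)).
exact: (measurableT_comp (kap_meas H) (measurable_fun_pair measurable_fst m2)).
Qed.

Section field.
Context d (S : measurableType d).
Variable m : {sigma_finite_measure set S -> \bar R}.

Definition cutp (G : R -> S -> R) : RR * S -> R := (fun q => G q.1 q.2) \_ (I `*` setT).

Lemma cutp_meas G : measurable_fun (I `*` setT) (fun q : RR * S => G q.1 q.2) ->
  measurable_fun setT (cutp G).
Proof. by move=> mG; apply/(measurable_restrictT _ _).1 => //; exact: measurableX. Qed.

Lemma cutpE G s z : cutp G (s, z) = if s \in I then G s z else 0.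
Proof.
rewrite /cutp patchE (_ : ((s, z) \in _) = (s \in I))//.
by apply/idP/idP; rewrite !inE => // -[].
Qed.

(** [S] is the sample space for [g], and its product with the plane for the second derivative: one
    operator serves both. *)
Definition IK (G : R -> S -> R) : S * (RR * RR) -> \bar R :=
  cut2 I (fun y1 y2 z => I_kernel H T (G ^~ z) y1 y2).

(** The supports of the two factors of [kap2] encode the lower limit [max y1 y2], so the domain of
    integration no longer depends on [y]. *)
Lemma IKE G z y : IK G (z, y) =
  ((d_const H)%:E * \int[leb]_s (cutp G (s, z) * kap2 s y)%:E)%E.
Proof.
case: y => y1 y2; rewrite /IK cut2E; case: ifPn => [/andP[]|yI]; last first.
  rewrite integral0_eq ?mule0// => s _; rewrite cutpE; case: ifP => sI; last by rewrite mul0r.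
  congr (_ %:E); rewrite /kap2 /kap/=; move: yI sI; rewrite !mem_setE !in_itv/= negb_and.
  move=> h /andP[s0 sT]; case: ifP => [/andP[a1 a2]|_]; last by rewrite mul0r mulr0.
  case: ifP => [/andP[b1 b2]|_]; last by rewrite !mulr0.
  by move: h; rewrite a1 b1 (le_trans a2 sT) (le_trans b2 sT).
rewrite !mem_setE !in_itv/= => /andP[a1 a2] /andP[b1 b2].
rewrite /I_kernel; congr (_ * _)%E; rewrite integral_mkcond; apply: eq_integral => s _.
rewrite patchE cutpE !mem_setE !in_itv/= ge_max /kap2 /kap/= a1 b1/=.
have [y1s|y1s] := leP y1 s; have [y2s|y2s] := leP y2 s => /=;
  rewrite ?mul0r ?mulr0 ?if_same//.
rewrite (le_trans a1 y1s)/=; case: ifP => _; first by rewrite mulrA.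
by rewrite mul0r.
Qed.

Lemma IK_meas G : measurable_fun (I `*` setT) (fun q : RR * S => G q.1 q.2) ->
  measurable_fun setT (IK G).
Proof.
move=> mG; rewrite (_ : IK G = (fun p => (d_const H)%:E *
    \int[leb]_s (cutp G (s, p.1) * kap2 s p.2)%:E)%E); last first.
  by apply/funext => -[z y]; rewrite IKE.
apply: emeasurable_funM => //.
apply: (@measurable_integral_section _ _ _ _ _ leb
  (fun q : (S * (RR * RR)) * RR => (cutp G (q.2, q.1.1) * kap2 q.2 q.1.2)%:E)).
apply/measurable_EFinP; apply: measurable_funM.
  apply: (measurableT_comp (cutp_meas mG)); apply: measurable_fun_pair => //.
  exact: (measurableT_comp measurable_fst measurable_fst).
have m12 : measurable_fun setT (fun q : (S * (RR * RR)) * RR => q.1.2).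
  exact: (measurableT_comp measurable_snd measurable_fst).
exact: (measurableT_comp kap2_meas (measurable_fun_pair measurable_snd m12)).
Qed.

Variables (G : R -> S -> R) (e : S -> R) (phi : RR * RR -> R) (M : R).
Hypothesis mG : measurable_fun (I `*` setT) (fun q : RR * S => G q.1 q.2).
Hypothesis LG : L2 (prodm leb m) (cutp G).
Hypothesis Le : L2 m e.
Hypothesis Lphi : L2 leb2 phi.
Hypothesis phiM : forall y, `|phi y| <= M.

Let mphi : measurable_fun setT phi := Lphi.1.

Let Psi (q : (S * (RR * RR)) * RR) : R :=
  e q.1.1 * phi q.1.2 * (d_const H * (cutp G (q.2, q.1.1) * kap2 q.2 q.1.2)).

Let A s y := phi y * (d_const H * kap2 s y).

Let PsiE s p : Psi (p, s) = tensor (fun z => e z * cutp G (s, z)) (A s) p.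
Proof. by rewrite /Psi /tensor /A/=; ring. Qed.

Let Psi_meas : measurable_fun setT Psi.
Proof.
have m11 : measurable_fun setT (fun q : (S * (RR * RR)) * RR => q.1.1).
  exact: (measurableT_comp measurable_fst measurable_fst).
have m12 : measurable_fun setT (fun q : (S * (RR * RR)) * RR => q.1.2).
  exact: (measurableT_comp measurable_snd measurable_fst).
apply: measurable_funM; first apply: measurable_funM.
- exact: (measurableT_comp Le.1 m11).
- exact: (measurableT_comp mphi m12).
- apply: measurable_funM => //; apply: measurable_funM.
    by apply: (measurableT_comp (cutp_meas mG)); exact: measurable_fun_pair.
  exact: (measurableT_comp kap2_meas (measurable_fun_pair measurable_snd m12)).
Qed.

Let A_meas s : measurable_fun setT (A s).
Proof.
apply: measurable_funM => //; apply: measurable_funM => //.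
exact: (measurableT_comp kap2_meas (pair1_measurable s)).
Qed.

(** Since [phi] is bounded, the integral is controlled by a product of two integrals of [kap], each
    at most the constant of [kap_bound]. *)
Let A_bound : exists2 C, 0 <= C & forall s, s \in I ->
  (\int[leb2]_y `|A s y|%:E <= C%:E)%E.
Proof.
have [C C0 hC] := kap_bound T H_gt H_lt.
have M0 : 0 <= M := le_trans (normr_ge0 _) (phiM (0, 0)).
have d0 := ltW d_const_gt0.
exists (M * d_const H * (C * C)); first by apply: mulr_ge0; exact: mulr_ge0.
move=> s; rewrite mem_setE in_itv/= => sI.
have mk : measurable_fun setT (kap H s).
  exact: (measurableT_comp (kap_meas H) (pair1_measurable s)).
apply: (@le_trans _ _ (\int[leb2]_y ((M * d_const H)%:E * (tensor (kap H s) (kap H s) y)%:E))%E).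
  apply: ge0_le_integral => //.
  - by apply/measurable_EFinP; apply: measurableT_comp.
  - apply: emeasurable_funM => //; apply/measurable_EFinP; exact: tensor_meas.
  - move=> y _; have k0 : 0 <= kap2 s y by apply: mulr_ge0; exact: kap_ge0.
    rewrite -EFinM lee_fin /A normrM (ger0_norm (mulr_ge0 d0 k0)) -(mulrA M).
    exact: (ler_wpM2r (mulr_ge0 d0 k0) (phiM y)).
rewrite ge0_integralZl//; last 3 first.
- by apply/measurable_EFinP; exact: tensor_meas.
- by move=> y _; rewrite lee_fin mulr_ge0 ?kap_ge0.
- by rewrite lee_fin mulr_ge0.
rewrite (EFinM (M * _)) lee_pmul//.
- by rewrite lee_fin mulr_ge0.
- by apply: integral_ge0 => y _; rewrite lee_fin mulr_ge0 ?kap_ge0.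
rewrite ge0_tensor_integral//; last 2 first.
- by move=> x; exact: kap_ge0.
- by move=> x; exact: kap_ge0.
by rewrite EFinM lee_pmul ?hC// integral_ge0// => y _; rewrite lee_fin kap_ge0.
Qed.

Let LI : L2 leb (\1_I : RR -> R).
Proof.
apply/L2P; split => //.
rewrite (eq_integral (EFin \o \1_I)); last first.
  by move=> x _ /=; rewrite indicE expr2 -natrM mulnb andbb.
rewrite integral_indic// setIT.
apply: (@le_lt_trans _ _ (lebesgue_measure (`[0, T]%classic : set R))); first exact: lexx.
by rewrite lebesgue_measure_itv/= lte_fin T_gt0 -EFinB; exact: ltry.
Qed.

Let itgE : itg (prodm leb m) (fun q => e q.2 * cutp G q).
Proof.
apply: (itg_eq _ (L2M (tensor_L2 LI Le) LG)) => -[s z].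
rewrite /tensor/= cutpE indicE; case: ifP => sI; first by rewrite mul1r.
by rewrite !mulr0.
Qed.

(** At fixed [s] the integrand is a tensor product whose second factor has absolute integral at most
    [C]; what is left is the integrability of [e G] over time and [S], which [itgE] provides. *)
Let itgPsi : itg (prodm (prodm m leb2) leb) Psi.
Proof.
have [C C0 hC] := A_bound.
apply: prodm_integrable; first exact/measurable_EFinP.
rewrite -(@prodm_tonelli _ _ _ _ _ (prodm m leb2) leb (fun q => `|(Psi q)%:E|%E))//; last first.
  by apply/measurable_EFinP; exact: measurableT_comp.
rewrite prodm_tonelli2//; last first.
  by apply/measurable_EFinP; exact: measurableT_comp.
have mE s : measurable_fun setT (fun z => `|e z * cutp G (s, z)|).
  apply: measurableT_comp => //; apply: measurable_funM; first exact: Le.1.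
  exact: (measurableT_comp (cutp_meas mG) (pair1_measurable s)).
apply: (@le_lt_trans _ _ (\int[leb]_s (C%:E * \int[m]_z `|e z * cutp G (s, z)|%:E))%E).
  apply: ge0_le_integral => //.
  - by move=> s _; apply: integral_ge0.
  - apply: (measurable_fun_fubini_tonelli_G (fun q => `|(Psi q)%:E|%E)) => //.
    by apply/measurable_EFinP; exact: measurableT_comp.
  - apply: emeasurable_funM => //.
    apply: (@measurable_integral_section _ _ _ _ _ m (fun q => `|e q.2 * cutp G q|%:E)).
    by apply/measurable_EFinP; apply: measurableT_comp => //; exact: itg_meas itgE.
  - move=> s _.
    rewrite (eq_integral (fun p => (tensor (fun z => `|e z * cutp G (s, z)|) (fun y => `|A s y|) p)%:E)); last first.
      by move=> p _; rewrite PsiE /tensor/= normrM.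
    rewrite ge0_tensor_integral//; last exact: measurableT_comp.
    have [sI|sI] := boolP (s \in I); first by rewrite muleC lee_pmul// ?integral_ge0// hC.
    by rewrite integral0_eq ?mul0e ?mule_ge0 ?integral_ge0// => z _; rewrite cutpE (negbTE sI) mulr0 normr0.
rewrite ge0_integralZl//; last 2 first.
- apply: (@measurable_integral_section _ _ _ _ _ m (fun q => `|e q.2 * cutp G q|%:E)).
  by apply/measurable_EFinP; apply: measurableT_comp => //; exact: itg_meas itgE.
- by move=> s _; apply: integral_ge0.
apply: lte_mul_pinfty => //.
rewrite -(@prodm_tonelli _ _ _ _ _ leb m (fun q => `|e q.2 * cutp G q|%:E))//; last first.
  by apply/measurable_EFinP; apply: measurableT_comp => //; exact: itg_meas itgE.
by have /integrableP[_] := itgE.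
Qed.

(** Infinite values of the kernel become 0; when its square is integrable this changes it on a null
    set only. *)
Definition IKr p : R := fine (IK G p).

Let h s := (\int[prodm m leb2]_p (Psi (p, s))%:E)%E.

Definition kphi s := \int[leb2]_y (phi y * (d_const H * kap2 s y)).

(** Pairing the kernel with [tensor e phi] amounts to integrating the pairings of [e] with the field
    at time [s] against the weight [kphi s], in which the space [S] no longer appears. *)
Lemma kernel_fubini : L2 (prodm m leb2) IKr ->
  [/\ leb.-integrable setT h,
      (ip (prodm m leb2) (tensor e phi) IKr)%:E = (\int[leb]_s h s)%E &
      {ae leb, forall s, h s = (kphi s * ip m e (fun z => cutp G (s, z)))%:E}].
Proof.
move=> LU; split.
- apply/integrableP; split; first exact: (measurable_fubini_G itgPsi).
  have mP := measurable_int _ itgPsi.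
  have fin := (integrable21ltyP _ _ mP).1 itgPsi.
  apply: le_lt_trans fin; apply: ge0_le_integral => //.
  + by apply: measurableT_comp => //; exact: (measurable_fubini_G itgPsi).
  + apply: (measurable_fun_fubini_tonelli_G (fun q => `|(Psi q)%:E|%E)) => //.
    exact: measurableT_comp.
  + move=> s _; apply: le_abse_integral => //.
    exact: (measurableT_comp mP (pair2_measurable s)).
- rewrite -(prodm_fubini2 itgPsi) (prodm_fubini itgPsi) /ip EFin_Rint; last first.
    by apply: (L2M _ LU); exact: tensor_L2.
  apply: ae_eq_integral => //.
  + by apply/measurable_EFinP; apply: measurable_funM; [exact: (tensor_L2 Le Lphi).1|exact: LU.1].
  + exact: (measurable_fubini_F itgPsi).
  + have := ae_integrable1 itgPsi; apply: filterS => -[z y] Iz _.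
    (* Where [e z * phi y] vanishes both sides are 0 even if the kernel is infinite; elsewhere,
       dividing by it shows that the kernel integral converges. *)
    have [c0|c0] := eqVneq (e z * phi y) 0.
      rewrite /tensor/= c0 mul0r integral0_eq// => s _.
      by rewrite /Psi/= c0 mul0r.
    have cd0 : e z * phi y * d_const H != 0 by rewrite mulf_neq0// gt_eqF// d_const_gt0.
    have If : itg leb (fun s => cutp G (s, z) * kap2 s y).
      apply: (itg_eq _ (itgZ (e z * phi y * d_const H)^-1 Iz)) => s.
      have -> : Psi (z, y, s) = e z * phi y * d_const H * (cutp G (s, z) * kap2 s y).
        by rewrite /Psi/= mulrA.
      by rewrite mulKf.
    rewrite /IKr IKE -EFin_Rint// -EFinM/= -RintZ// -RintZ; last exact: itgZ.
    by rewrite EFin_Rint//; apply: eq_integral => s _; rewrite /Psi /tensor/= mulrA.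
- have := ae_integrable1 itgE; apply: filterS => s Is.
  have [sI|sI] := boolP (s \in I); last first.
    rewrite /h /ip integral0_eq; last first.
      by move=> p _; rewrite PsiE /tensor cutpE (negbTE sI) mulr0 mul0r.
    rewrite (_ : \int[m]_z _ = 0) ?mulr0//.
    by under eq_Rintegral do rewrite cutpE (negbTE sI) mulr0; rewrite Rint0.
  have [C C0 hC] := A_bound.
  have IA : itg leb2 (A s).
    apply/integrableP; split; first exact/measurable_EFinP.
    exact: le_lt_trans (hC s sI) (ltry _).
  have [It e1] := tensor_Rint Is IA.
  rewrite /h mulrC /ip /kphi -e1 EFin_Rint//.
  by apply: eq_integral => p _; rewrite PsiE.
Qed.

End field.

(** The weight [kphi] depends on [phi] alone, so an identity between pairings at almost every time
    passes to the kernels of two fields living on different spaces. *)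
Lemma kernel_transfer d1 (S1 : measurableType d1) (m1 : {sigma_finite_measure set S1 -> \bar R})
    d2 (S2 : measurableType d2) (m2 : {sigma_finite_measure set S2 -> \bar R})
    G1 G2 e1 e2 (phi : RR * RR -> R) M c :
  measurable_fun (I `*` setT) (fun q : RR * S1 => G1 q.1 q.2) -> L2 (prodm leb m1) (cutp G1) ->
  measurable_fun (I `*` setT) (fun q : RR * S2 => G2 q.1 q.2) -> L2 (prodm leb m2) (cutp G2) ->
  L2 m1 e1 -> L2 m2 e2 -> L2 leb2 phi -> (forall y, `|phi y| <= M) ->
  L2 (prodm m1 leb2) (IKr G1) -> L2 (prodm m2 leb2) (IKr G2) ->
  {ae leb, forall s, c * ip m1 e1 (fun z => cutp G1 (s, z)) =
                     ip m2 e2 (fun z => cutp G2 (s, z))} ->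
  c * ip (prodm m1 leb2) (tensor e1 phi) (IKr G1) =
  ip (prodm m2 leb2) (tensor e2 phi) (IKr G2).
Proof.
move=> mG1 LG1 mG2 LG2 Le1 Le2 Lphi phiM LU1 LU2 ae12.
have [mh1 i1 a1] := kernel_fubini mG1 LG1 Le1 Lphi phiM LU1.
have [mh2 i2 a2] := kernel_fubini mG2 LG2 Le2 Lphi phiM LU2.
apply: EFin_inj; rewrite i2 EFinM i1 -integralZl//.
apply: ae_eq_integral => //; first by apply: emeasurable_funM => //; exact: measurable_int mh1.
  exact: measurable_int mh2.
move: a1 a2 ae12; apply: filterS3 => s h1 h2 h3 _.
by rewrite h1 h2 -h3 -EFinM mulrCA.
Qed.

End kernel_fubini.

(** * L^2 closures of families indexed by a level *)

Section closure.
Context d (S : measurableType d) (R : realType) (mu : {measure set S -> \bar R}).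
Variable Q : nat -> (S -> R) -> Prop.
Hypothesis QL2 : forall n q, Q n q -> L2 mu q.
Hypothesis Qadd : forall n p q, Q n p -> Q n q -> Q n (fun z => p z + q z).
Hypothesis Qscale : forall n k q, Q n q -> Q n (fun z => k * q z).
Hypothesis Qmono : forall m n q, (m <= n)%N -> Q m q -> Q n q.

(* The index of [Q] is a level of discretisation. *)
Definition clos (V : S -> R) : Prop := L2 mu V /\
  forall e, 0 < e -> exists n0, forall n, (n0 <= n)%N -> exists q, Q n q /\
    ip mu (fun z => V z - q z) (fun z => V z - q z) <= e.

Lemma clos_of n q : Q n q -> clos q.
Proof.
move=> hq; split; first exact: QL2 hq.
move=> e e0; exists n => m nm; exists q; split; first exact: Qmono hq.
by rewrite ipE; under eq_Rintegral do rewrite subrr expr0n; rewrite Rint0 ltW.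
Qed.

Lemma clos_lim V : L2 mu V ->
  (forall e, 0 < e -> exists V', clos V' /\
     ip mu (fun z => V z - V' z) (fun z => V z - V' z) <= e) -> clos V.
Proof.
move=> LV hV; split=> // e e0; have e4 : 0 < e / 4 by rewrite divr_gt0.
have [V' [[LV' h'] le1]] := hV _ e4.
have [n0 hn] := h' _ e4; exists n0 => n /hn[q [hq le2]]; exists q; split=> //.
rewrite (_ : (fun z => V z - q z) = (fun z => (V z - V' z) + (V' z - q z))); last first.
  by apply/funext => z; rewrite addrA subrK.
have := ip_sum_le2 (L2B LV LV') (L2B LV' (QL2 hq)); lra.
Qed.

Lemma clos_add V W : clos V -> clos W -> clos (fun z => V z + W z).
Proof.
move=> [LV hV] [LW hW]; split; first exact: L2D.
move=> e e0; have e4 : 0 < e / 4 by rewrite divr_gt0.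
have [n1 h1] := hV _ e4; have [n2 h2] := hW _ e4; exists (maxn n1 n2) => n.
rewrite geq_max => /andP[/h1[p [hp le1]] /h2[q [hq le2]]].
exists (fun z => p z + q z); split; first exact: Qadd.
rewrite (_ : (fun z => _) = (fun z => (V z - p z) + (W z - q z))); last first.
  by apply/funext => z; ring.
have := ip_sum_le2 (L2B LV (QL2 hp)) (L2B LW (QL2 hq)); lra.
Qed.

Lemma clos_scale k V : clos V -> clos (fun z => k * V z).
Proof.
move=> [LV hV]; split; first exact: L2Z.
move=> e e0; have k0 : 0 < k ^+ 2 + 1 by rewrite ltr_wpDl// sqr_ge0.
have [n0 hn] := hV _ (divr_gt0 e0 k0); exists n0 => n /hn[q [hq le]].
exists (fun z => k * q z); split; first exact: Qscale.
have LD := L2B LV (QL2 hq).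
rewrite (_ : (fun z => _) = (fun z => k * (V z - q z))); last first.
  by apply/funext => z; rewrite mulrBr.
rewrite ipZl//; last exact: L2Z.
rewrite ipZr// mulrA -expr2.
move: le; rewrite ler_pdivlMr// => le; apply: (le_trans _ le).
by rewrite mulrC ler_wpM2l ?ip_ge0// lerDl.
Qed.

Lemma clos_eq V W : clos V -> (forall z, W z = V z) -> clos W.
Proof. by move=> h /funext ->. Qed.

Lemma clos_ae V W : clos V -> measurable_fun setT W -> {ae mu, forall z, W z = V z} ->
  clos W.
Proof.
move=> cV mW VW; have LV := cV.1.
have LW : L2 mu W.
  split=> //; apply: (itg_ae_le _ LV.2); first exact: measurable_funX.
  by apply: filterS VW => z ->; rewrite ger0_norm ?sqr_ge0.
apply: clos_lim LW _ => e e0; exists V; split=> //.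
rewrite ipE (@Rint_ae_eq _ _ _ _ _ (fun=> 0)) ?Rint0 ?ltW//.
  by apply: measurable_funX; exact: measurable_funB mW LV.1.
by apply: filterS VW => z ->; rewrite subrr expr0n.
Qed.

End closure.

Lemma L2_dct d (S : measurableType d) (R : realType) (mu : {measure set S -> \bar R})
    (F : nat -> S -> R) (f g : S -> R) : (forall n, measurable_fun setT (F n)) ->
  measurable_fun setT f -> (forall x, F ^~ x @ \oo --> f x) -> L2 mu g ->
  (forall n x, `|F n x| <= `|g x|) -> L2 mu f /\
  (fun n => ip mu (fun x => f x - F n x) (fun x => f x - F n x)) @ \oo --> 0.
Proof.
move=> mF mf Ff Lg Fg.
have fg x : `|f x| <= `|g x|.
  have cv : (fun n => `|F n x|) @ \oo --> `|f x| by apply: cvg_norm; exact: Ff.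
  rewrite -(cvg_lim (@Rhausdorff R) cv); apply: limr_le; first by apply/cvg_ex; eexists; exact: cv.
  exact: nearW.
have Lf : L2 mu f by exact: L2_le fg.
split=> //.
have [] := @Rint_dct _ _ _ mu (fun n x => (f x - F n x) ^+ 2) (fun=> 0) (fun x => 4 * g x ^+ 2).
- by move=> n; apply: measurable_funX; exact: measurable_funB.
- by [].
- apply: nearW => x /=; rewrite -[X in _ --> X](expr0n R 2); apply: cvg_sqr.
  rewrite -[X in _ --> X](subrr (f x)); apply: cvgB; [exact: cvg_cst|exact: Ff].
- by apply: itgZ; exact: Lg.2.
- move=> n x; rewrite ger0_norm ?sqr_ge0// -real_normK ?num_real//.
  rewrite -[g x ^+ 2]real_normK ?num_real//.
  rewrite (_ : 4 * _ = (2 * `|g x|) ^+ 2); last by ring.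
  rewrite lerXn2r ?nnegrE ?mulr_ge0// (le_trans (ler_normB _ _))//.
  have := fg x; have := Fg n x; lra.
move=> _; rewrite Rint0; apply: cvg_trans; apply: near_eq_cvg; apply: nearW => n /=.
by rewrite ipE.
Qed.

(** * Bounded multipliers of the closure of the polynomials in the increments *)

Section multipliers.
Context (R : realType) d (Om : measurableType d) (P : probability Om R).
Variables (T : R) (B : R -> Om -> R).
Hypothesis T_gt0 : 0 < T.
Hypothesis hB : brownian_motion P T B.

Definition chaos_poly n (q : Om -> R) : Prop :=
  exists p, polyf p /\ forall w, q w = p (xiv T B n w).

Lemma chaos_poly_L2 n q : chaos_poly n q -> L2 P q.
Proof.
by move=> [p [hp /funext ->]]; exact: (nice_L2 T_gt0 hB (polyf_nice hp)).
Qed.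

Lemma chaos_poly_add n p q : chaos_poly n p -> chaos_poly n q ->
  chaos_poly n (fun w => p w + q w).
Proof.
move=> [p' [hp ep]] [q' [hq eq']]; exists (fun x => p' x + q' x).
by split=> [|w]; [exact: polyf_add|rewrite ep eq'].
Qed.

Lemma chaos_poly_mul n p q : chaos_poly n p -> chaos_poly n q ->
  chaos_poly n (fun w => p w * q w).
Proof.
move=> [p' [hp ep]] [q' [hq eq']]; exists (fun x => p' x * q' x).
by split=> [|w]; [exact: polyf_mul|rewrite ep eq'].
Qed.

Lemma chaos_poly_scale n k q : chaos_poly n q -> chaos_poly n (fun w => k * q w).
Proof.
move=> hq; apply: chaos_poly_mul hq; exists (fun=> k); split=> //; exact: polyf_cst.
Qed.

Lemma chaos_poly_mono m n q : (m <= n)%N -> chaos_poly m q -> chaos_poly n q.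
Proof.
move=> mn [p [hp ep]]; rewrite -(subnKC mn); exists (fun x => p (lincomb (refmx R m (n - m)) x)).
split=> [|w]; first exact: polyf_lincomb.
by rewrite ep; congr p; apply/funext => j; rewrite /lincomb -xi_refine.
Qed.

Definition clP := clos P chaos_poly.

Let clP_lim V : L2 P V -> (forall e, 0 < e -> exists V', clP V' /\
     ip P (fun z => V z - V' z) (fun z => V z - V' z) <= e) -> clP V.
Proof. exact: clos_lim chaos_poly_L2 V. Qed.

Lemma clP1 : clP (fun=> 1).
Proof.
apply: (clos_of chaos_poly_L2 chaos_poly_mono (n := 0)).
by exists (fun=> 1); split=> //; exact: polyf_cst.
Qed.

(** Multipliers form an algebra stable under bounded pointwise limits, so the sets whose indicators
    are multipliers form a sigma-algebra; and since 1 is in the closure, every multiplier is. *)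
Definition multiplier (Y : Om -> R) : Prop := [/\ measurable_fun setT Y,
  exists K, forall w, `|Y w| <= K & forall V, clP V -> clP (fun w => Y w * V w)].

Lemma mult_eq Y Y' : multiplier Y -> (forall w, Y' w = Y w) -> multiplier Y'.
Proof. by move=> h /funext ->. Qed.

Lemma mult_cst k : multiplier (fun=> k).
Proof.
split=> //; first by exists `|k|.
move=> V; exact: (clos_scale chaos_poly_L2 chaos_poly_scale).
Qed.

Lemma mult_add X Y : multiplier X -> multiplier Y -> multiplier (fun w => X w + Y w).
Proof.
move=> [mX [K hK] hX] [mY [M hM] hY]; split; first exact: measurable_funD.
  by exists (K + M) => w; rewrite (le_trans (ler_normD _ _))// lerD.
move=> V cV; apply: clos_eq (clos_add chaos_poly_L2 chaos_poly_add (hX _ cV) (hY _ cV)) _ => w.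
by rewrite mulrDl.
Qed.

Lemma mult_mul X Y : multiplier X -> multiplier Y -> multiplier (fun w => X w * Y w).
Proof.
move=> [mX [K hK] hX] [mY [M hM] hY]; split; first exact: measurable_funM.
  by exists (K * M) => w; rewrite normrM ler_pM.
by move=> V cV; apply: clos_eq (hX _ (hY _ cV)) _ => w; rewrite mulrA.
Qed.

Lemma mult_scale k Y : multiplier Y -> multiplier (fun w => k * Y w).
Proof. by move=> hY; apply: mult_mul hY; exact: mult_cst. Qed.

Lemma mult_exp Y n : multiplier Y -> multiplier (fun w => Y w ^+ n).
Proof.
move=> hY; elim: n => [|n IH].
  by apply: mult_eq (mult_cst 1) _ => w; rewrite expr0.
by apply: mult_eq (mult_mul hY IH) _ => w; rewrite exprS.
Qed.

Lemma mult_sum I (s : seq I) (F : I -> Om -> R) : (forall i, multiplier (F i)) ->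
  multiplier (fun w => \sum_(i <- s) F i w).
Proof.
move=> hF; elim: s => [|i s IH].
  by apply: mult_eq (mult_cst 0) _ => w; rewrite big_nil.
by apply: mult_eq (mult_add (hF i) IH) _ => w; rewrite big_cons.
Qed.

Lemma mult_lim (F : nat -> Om -> R) Y K : (forall n, multiplier (F n)) ->
  (forall n w, `|F n w| <= K) -> (forall w, F ^~ w @ \oo --> Y w) -> multiplier Y.
Proof.
move=> hF FK FY.
have mY : measurable_fun setT Y.
  apply: (measurable_fun_cvg (h := F)) => // n; by have [] := hF n.
split=> //.
  exists K => w; have cv : (fun n => `|F n w|) @ \oo --> `|Y w| by apply: cvg_norm; exact: FY.
  rewrite -(cvg_lim (@Rhausdorff R) cv); apply: limr_le; first by apply/cvg_ex; eexists; exact: cv.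
  exact: nearW.
move=> V cV; have LV := cV.1.
have [|||||LYV cv] := @L2_dct _ _ _ P (fun n w => F n w * V w) (fun w => Y w * V w) (fun w => K * V w).
- by move=> n; have [m _ _] := hF n; apply: measurable_funM m LV.1.
- exact: measurable_funM mY LV.1.
- by move=> w; apply: cvgM; [exact: FY|exact: cvg_cst].
- exact: L2Z.
- move=> n w; rewrite !normrM ler_wpM2r// (le_trans (FK n w))// ler_norm//.
apply: clP_lim => // e e0.
have /cvgr0Pnorm_le/(_ _ e0)[n _ /(_ n (leqnn n))/= hn] := cv.
exists (fun w => F n w * V w); split; first by have [_ _] := hF n; apply.
by rewrite (le_trans (ler_norm _)).
Qed.

Lemma mult_ae Y (Y' : Om -> R) : multiplier Y -> measurable_fun setT Y' -> (exists K, forall w, `|Y' w| <= K) ->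
  {ae P, forall w, Y' w = Y w} -> multiplier Y'.
Proof.
move=> [mY _ hY] mY' bY' YY'; split=> // V cV.
apply: (clos_ae chaos_poly_L2 (hY _ cV)); first exact: measurable_funM mY' cV.1.1.
by apply: filterS YY' => w ->.
Qed.

(** The iteration [t + (Y^2 - t^2) / 2] started at 0 stays polynomial in [Y] and increases to [|Y|]:
    each step multiplies the error by at most [1 - |Y| / 2]. *)
Lemma mult_abs Y : multiplier Y -> (forall w, `|Y w| <= 1) -> multiplier (fun w => `|Y w|).
Proof.
move=> hY Y1.
pose a n w := iter n (fun t => t + (Y w ^+ 2 - t ^+ 2) / 2) 0.
have ma n : multiplier (a n).
  elim: n => [|n IH]; first exact: mult_cst.
  apply: mult_eq (mult_add IH (mult_scale 2^-1 (mult_add (mult_exp 2 hY) (mult_scale (-1) (mult_exp 2 IH))))) _ => w.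
  by rewrite /a iterS; field.
have ha n w : 0 <= a n w /\ 0 <= `|Y w| - a n w <= (1 - `|Y w| / 2) ^+ n * `|Y w|.
  have y0 := normr_ge0 (Y w); have y1 := Y1 w; have y2 : Y w ^+ 2 = `|Y w| ^+ 2 by rewrite real_normK ?num_real.
  elim: n => [|n [IH0 /andP[IH1 IH2]]]; first by rewrite /a/= subr0 expr0 mul1r lexx y0.
  have e : `|Y w| - a n.+1 w = (`|Y w| - a n w) * (1 - (`|Y w| + a n w) / 2).
    by rewrite {1}/a iterS -/(a n w) y2; field.
  have f0 : 0 <= 1 - (`|Y w| + a n w) / 2 by lra.
  have s0 : 0 <= a n.+1 w.
    rewrite /a iterS -/(a n w) y2 addr_ge0//.
    have : a n w ^+ 2 <= `|Y w| ^+ 2 by rewrite lerXn2r ?nnegrE//; lra.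
    lra.
  split=> //; rewrite e mulr_ge0//= exprS -mulrA mulrC ler_pM//; lra.
apply: (mult_lim (K := 1) ma).
  by move=> n w; have [a0 /andP[a1 _]] := ha n w; rewrite ger0_norm//; have := Y1 w; lra.
move=> w; apply/subr_cvg0.
apply: (@cvg0_le R _ (fun n => (1 - `|Y w| / 2) ^+ n * `|Y w|)); last first.
  by move=> n; have [_ /andP[h1 h2]] := ha n w; rewrite distrC ger0_norm.
have [->|y0] := eqVneq `|Y w| 0; first by under eq_fun do rewrite mulr0; exact: cvg_cst.
rewrite -[X in _ --> X](mul0r `|Y w|); apply: cvgM; last exact: cvg_cst.
have y1 : 0 < `|Y w| by rewrite lt_def y0 normr_ge0.
apply: cvg_expr; rewrite ger0_norm; have := Y1 w; lra.
Qed.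

(** With [p] the positive part of [Y], the sequence [1 - (1 - p)^n] tends to the indicator of
    [p > 0]. *)
Lemma mult_pos Y : multiplier Y -> (forall w, `|Y w| <= 1) ->
  multiplier (fun w => (0 < Y w)%R%:R).
Proof.
move=> hY Y1; pose p w := (`|Y w| + Y w) / 2.
have hp : multiplier p.
  apply: mult_eq (mult_scale 2^-1 (mult_add (mult_abs hY Y1) hY)) _ => w.
  by rewrite /p mulrC.
have p01 w : 0 <= p w <= 1.
  rewrite /p; have := Y1 w; have := ler_norm (Y w); have := ler_norm (- Y w); rewrite normrN.
  by move=> *; apply/andP; split; lra.
apply: (mult_lim (F := fun n w => 1 - (1 - p w) ^+ n) (K := 1)).
- move=> n; apply: mult_eq (mult_add (mult_cst 1) (mult_scale (-1) (mult_exp n (mult_add (mult_cst 1) (mult_scale (-1) hp))))) _ => w.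
  by rewrite !mulN1r.
- move=> n w; have /andP[h0 h1] := p01 w.
  have q0 : 0 <= (1 - p w) ^+ n by rewrite exprn_ge0//; lra.
  have q1 : (1 - p w) ^+ n <= 1 by rewrite exprn_ile1//; lra.
  by rewrite ger0_norm; lra.
- move=> w; have /andP[h0 h1] := p01 w; case: (ltP 0 (Y w)) => Y0.
    have p0 : 0 < p w by rewrite /p ger0_norm ?ltW//; lra.
    rewrite -[X in _ --> X](subr0 1); apply: cvgB; first exact: cvg_cst.
    by apply: cvg_expr; rewrite ger0_norm; lra.
  have p0 : p w = 0 by rewrite /p ler0_norm// addNr mul0r.
  by under eq_fun do rewrite p0 subr0 expr1n subrr; exact: cvg_cst.
Qed.

Lemma series_sin_le (x : R) n : `|series (sin_coeff x) n| <= expR `|x|.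
Proof.
apply: (@le_trans _ _ (series (exp_coeff `|x|) n)).
  rewrite /series/= (le_trans (ler_norm_sum _ _ _))//; apply: ler_sum => i _.
  rewrite /sin_coeff /exp_coeff/= !normrM normrX normrN1 expr1n mulr1 normrV ?unitfE//.
  rewrite normrX [X in _ / X]ger0_norm// ler_wpM2r ?invr_ge0//.
  by case: odd; rewrite ?normr1 ?normr0 ?mul1r// mul0r exprn_ge0.
rewrite /expR; apply: (nondecreasing_cvgn_le _ (is_cvg_series_exp_coeff _)).
by apply: nondecreasing_series => i _ _; exact: exp_coeff_ge0.
Qed.

Lemma nice_expR_lin r (k : 'I_r) (a c : R) : nice (fun x : 'I_r -> R => expR (a * (x k - c))).
Proof.
split=> [d' S v mv||x v].
- apply: measurableT_comp => //; apply: measurable_funM => //.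
  exact: measurable_funB.
- exists (expR (`|a| * `|c|)), `|a|; split=> // x.
  rewrite ger0_norm ?expR_ge0// -expRD ler_expR -mulrDr (le_trans (ler_norm _))//.
  rewrite normrM ler_wpM2l// (le_trans (ler_normB _ _))// addrC lerD2l.
  by rewrite /sumabs (bigD1 k)//= lerDl sumr_ge0.
- move=> t; apply: continuous_comp; last exact: continuous_expR.
  rewrite /line; apply: cvgM; first exact: cvg_cst.
  apply: cvgB; last exact: cvg_cst.
  apply: cvgD; first exact: cvg_cst.
  by apply: cvgM; [exact: cvg_id|exact: cvg_cst].
Qed.

(** The sine is bounded and has an everywhere convergent series: its Taylor polynomials times a
    polynomial are dominated by exponentials of the increment times that polynomial, which is square
    integrable. *)
Lemma mult_sin n (k : 'I_(2 ^ n)) (a c : R) :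
  multiplier (fun w => sin (a * (xi T B n k w - c))).
Proof.
have msin : measurable_fun setT (fun w => sin (a * (xi T B n k w - c))).
  apply: measurableT_comp; first exact: (continuous_measurable_fun (@continuous_sin R)).
  by apply: measurable_funM => //; apply: measurable_funB => //; exact: (measurable_xi T_gt0 hB (ltn_ord k)).
have sin1 w : `|sin (a * (xi T B n k w - c))| <= 1 by rewrite ler_norml sin_geN1 sin_le1.
split=> //; first by exists 1.
have LsL (V : Om -> R) : L2 P V -> L2 P (fun w => sin (a * (xi T B n k w - c)) * V w).
  move=> LV; apply: (L2_le (measurable_funM msin LV.1) LV).
  by move=> w; rewrite normrM ler_piMl.
move=> V cV; have LsV := LsL _ cV.1.
apply: (clos_lim chaos_poly_L2 LsV) => e e0.
have [n0 hn] := cV.2 _ e0.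
(* A common level for the increment and for the approximant [p]. *)
pose N := (n + n0)%N.
have [p [hp le1]] := hn N (leq_addl _ _).
have Lp := chaos_poly_L2 hp.
exists (fun w => sin (a * (xi T B n k w - c)) * p w); split; last first.
  apply: le_trans le1; apply: le_Rint.
  - exact: (L2M (L2B LsV (LsL _ Lp)) (L2B LsV (LsL _ Lp))).
  - exact: (L2M (L2B cV.1 Lp) (L2B cV.1 Lp)).
  - by move=> w; rewrite -!expr2 -mulrBr exprMn ler_piMl ?sqr_ge0// -(real_normK (num_real (sin _))) exprn_ile1.
have hlin : chaos_poly N (fun w => a * (xi T B n k w - c)).
  apply: (@chaos_poly_mono n); first exact: leq_addr.
  exists (fun x => a * (x k + (- c))); split=> //.
  apply: polyf_mul; first exact: polyf_cst.
  by apply: polyf_add; [exact: polyf_coord|exact: polyf_cst].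
have hexp m : chaos_poly N (fun w => (a * (xi T B n k w - c)) ^+ m).
  elim: m => [|m IH].
    by exists (fun=> 1); split=> [|w]; [exact: polyf_cst|rewrite expr0].
  have [q [hq eq']] := chaos_poly_mul hlin IH; exists q; split=> // w.
  by rewrite exprS eq'.
have hser m : chaos_poly N (fun w => series (sin_coeff (a * (xi T B n k w - c))) m * p w).
  apply: chaos_poly_mul hp; elim: m => [|m IH].
    exists (fun=> 0); split=> [|w]; first exact: polyf_cst.
    by rewrite /series/= big_geq.
  have [q [hq eq']] := chaos_poly_add IH (chaos_poly_scale ((odd m)%:R * (-1) ^+ m.-1./2 / m`!%:R) (hexp m)).
  exists q; split=> // w; rewrite -eq' seriesSr; congr (_ + _).
  by rewrite /sin_coeff/= mulrAC.
have [pp [hpp epp]] := hp.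
have Ldom : L2 P (fun w => (expR (a * (xi T B n k w - c)) + expR (- a * (xi T B n k w - c))) * p w).
  have xiE w : xiv T B n w = lincomb (refmx R n n0) (xiv T B N w).
    by apply/funext => j; rewrite /lincomb -xi_refine.
  have nE := nice_lincomb (refmx R n n0) (nice_add (nice_expR_lin k a c) (nice_expR_lin k (- a) c)).
  apply: (L2_eq _ (nice_L2 T_gt0 hB (nice_mul nE (polyf_nice hpp)))) => w.
  by rewrite -/N epp -xiE.
have [||||LYV cv] := @L2_dct _ _ _ P (fun m w => series (sin_coeff (a * (xi T B n k w - c))) m * p w)
   (fun w => sin (a * (xi T B n k w - c)) * p w) _ _ _ _ Ldom.
- by move=> m; exact: (chaos_poly_L2 (hser m)).1.
- exact: measurable_funM msin Lp.1.
- move=> w; apply: cvgM; last exact: cvg_cst.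
  by rewrite sin.unlock; exact: is_cvg_series_sin_coeff.
- move=> m w; rewrite !normrM ler_wpM2r// (le_trans (series_sin_le _ _))//.
  rewrite ger0_norm ?addr_ge0 ?expR_ge0// mulNr.
  have [h|h] := lerP 0 (a * (xi T B n k w - c)); first by rewrite ger0_norm// lerDl expR_ge0.
  by rewrite ltr0_norm// lerDr expR_ge0.
apply: clos_lim chaos_poly_L2 _ _ _ => // e1 e10.
have /cvgr0Pnorm_le/(_ _ e10)[m _ /(_ m (leqnn m))/= hm] := cv.
exists (fun w => series (sin_coeff (a * (xi T B n k w - c))) m * p w); split.
  exact: (clos_of chaos_poly_L2 chaos_poly_mono (hser m)).
by rewrite (le_trans (ler_norm _)).
Qed.

End multipliers.

(** * Density of the polynomials in L^2 of the Brownian sigma-algebra *)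

Section density.
Context (R : realType) d (Om : measurableType d) (P : probability Om R).
Variables (T : R) (B : R -> Om -> R).
Hypothesis T_gt0 : 0 < T.
Hypothesis hB : brownian_motion P T B.

Local Notation mult := (@multiplier R d Om P T B).
Local Notation clP := (@clP R d Om P T B).

Definition msets : set (set Om) := [set A | measurable A /\ mult (\1_A)].

Lemma msets_eq A Y : mult Y -> measurable A -> (forall w, \1_A w = Y w) -> msets A.
Proof. by move=> hY mA e; split=> //; exact: mult_eq hY e. Qed.

Lemma msets_sigma : sigma_algebra setT msets.
Proof.
split.
- by apply: (msets_eq (mult_cst T_gt0 hB 0)) => // w; rewrite indic0.
- move=> A [mA hA]; rewrite setTD.
  apply: (msets_eq (mult_add T_gt0 hB (mult_cst T_gt0 hB 1) (mult_scale T_gt0 hB (-1) hA))).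
    exact: measurableC.
  move=> w; rewrite !indicE in_setC; case: (w \in A) => /=; lra.
- move=> A hA; have mA k : measurable (A k) by have [] := hA k.
  (* The indicator of a finite union as a polynomial in the indicators of its members; it increases
     to that of the whole union. *)
  pose F n w : R := 1 - \prod_(k < n) (1 - \1_(A k) w).
  have hF n : mult (F n).
    suff hp : mult (fun w => \prod_(k < n) (1 - \1_(A k) w)).
      apply: mult_eq (mult_add T_gt0 hB (mult_cst T_gt0 hB 1) (mult_scale T_gt0 hB (-1) hp)) _ => w.
      by rewrite mulN1r.
    elim: n => [|n IH].
      by apply: mult_eq (mult_cst T_gt0 hB 1) _ => w; rewrite big_ord0.
    have h1 := mult_add T_gt0 hB (mult_cst T_gt0 hB 1) (mult_scale T_gt0 hB (-1) (hA n).2).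
    apply: mult_eq (mult_mul IH h1) _ => w.
    by rewrite big_ord_recr/= mulN1r.
  have i01 k w : 0 <= 1 - (\1_(A k) w : R) <= 1.
    by rewrite indicE; case: (_ \in _); rewrite ?subrr ?subr0 ?lexx ?ler01.
  split; first exact: bigcup_measurable.
  apply: (mult_lim T_gt0 hB (K := 1) hF).
    move=> n w; have h0 : 0 <= \prod_(k < n) (1 - \1_(A k) w) :> R.
      by apply: prodr_ge0 => k _; have /andP[] := i01 k w.
    have h1 : \prod_(k < n) (1 - \1_(A k) w) <= 1 :> R by apply: prodr_ile1 => k _; exact: i01.
    by rewrite /F ger0_norm; lra.
  move=> w; apply: (@cvg_near_cst _ _ _ _ _); rewrite indicE.
  have [/set_mem[k _ Akw]|wA] := boolP (w \in \bigcup_k A k).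
    exists k.+1 => // n /= kn; rewrite /F (bigD1 (Ordinal kn))//= indicE mem_set//.
    by rewrite subrr mul0r subr0.
  apply: nearW => n; rewrite /F big1 ?subrr// => k _.
  rewrite indicE memNset ?subr0// => Akw; move/negP: wA; apply; rewrite inE.
  by exists (k : nat).
Qed.

(** The sign of [sin (y / (m + 1))] is that of [y] as soon as [|y| < pi (m + 1)]. *)
Lemma msets_xi n (k : 'I_(2 ^ n)) c : msets [set w | c < xi T B n k w].
Proof.
have mx : measurable_fun setT (xi T B n k) := (xi_L2 T_gt0 hB k).1.
split.
  rewrite (_ : [set w | _] = xi T B n k @^-1` `]c, +oo[%classic).
    by rewrite -[X in measurable X]setTI; exact: mx.
  by apply/seteqP; split=> w /=; rewrite in_itv/= andbT.
pose F m w : R := (0 < sin (m.+1%:R^-1 * (xi T B n k w - c)))%R%:R.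
apply: (mult_lim T_gt0 hB (F := F) (K := 1)).
- move=> m; apply: (mult_pos T_gt0 hB); first exact: mult_sin.
  by move=> w; rewrite ler_norml sin_geN1 sin_le1.
- by move=> m w; rewrite /F; case: (_ < _); rewrite ?normr1 ?normr0.
move=> w; apply: (@cvg_near_cst _ _ _ _ _).
set y := xi T B n k w - c.
exists (Num.trunc (`|y| / pi)) => // m /= hm.
have m0 : 0 < m.+1%:R :> R by [].
have yp : `|y| < pi * m.+1%:R.
  rewrite mulrC -ltr_pdivrMr ?pi_gt0// (lt_le_trans (truncnS_gt _))// ler_nat ltnS//.
rewrite /F indicE -/y.
have [y0|y0|y0] := ltgtP y 0.
- rewrite memNset; last by rewrite /= => h; move: y0; rewrite /y subr_lt0 ltNge (ltW h).
  rewrite -[X in sin X]opprK sinN oppr_gt0 ltNge ltW// sin_gt0_pi//.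
  rewrite -mulrN mulr_gt0 ?invr_gt0 ?oppr_gt0//= ltr_pdivrMl// mulrC.
  by rewrite -(ltr0_norm y0).
- rewrite mem_set; last by rewrite /= -subr_gt0.
  rewrite sin_gt0_pi// mulr_gt0 ?invr_gt0//= ltr_pdivrMl// mulrC.
  by rewrite -(gtr0_norm y0).
- rewrite y0 mulr0 sin0 ltxx memNset//= => h.
  by move: y0; rewrite /y => /eqP; rewrite subr_eq0 gt_eqF.
Qed.

Let SA := g_sigma_algebraType msets.

Lemma SA_msets (A : set Om) : (measurable : set (set SA)) A <-> msets A.
Proof.
by rewrite /measurable/= (sigma_algebra_id msets_sigma).
Qed.

Lemma SA_meas (f : Om -> R) : measurable_fun (setT : set SA) (f : SA -> R) ->
  measurable_fun setT f.
Proof.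
by move=> mf _ A mA; rewrite setTI; have := mf measurableT A mA; rewrite setTI => /SA_msets[].
Qed.

Lemma SA_xi n (k : 'I_(2 ^ n)) : measurable_fun (setT : set SA) (xi T B n k : SA -> R).
Proof.
apply: (measurability _ (RGenOInfty.measurableE R)).
move=> _ [_ [a ->] <-]; rewrite setTI; apply/SA_msets.
rewrite (_ : _ @^-1` _ = [set w | a < xi T B n k w]); first exact: msets_xi.
by apply/seteqP; split=> w /=; rewrite in_itv/= andbT.
Qed.

(** The shift by [K] makes [f] nonnegative; the dyadic truncation of the result is a finite sum of
    indicators of the sets where it is at least [(k + 1) / 2^n], all of them multipliers. *)
Lemma SA_bounded (f : Om -> R) K : measurable_fun (setT : set SA) (f : SA -> R) ->
  (forall w, `|f w| <= K) -> mult f.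
Proof.
move=> mf fK; pose g w := f w + K.
have g0 w : 0 <= g w by have := fK w; rewrite ler_norml /g => /andP[? ?]; lra.
have gK w : g w <= 2 * K by have := fK w; rewrite ler_norml /g => /andP[? ?]; lra.
pose X n w : R := 2^-1 ^+ n * \sum_(k < (Num.trunc (2 * K * 2 ^+ n)).+1)
   (k.+1%:R <= g w * 2 ^+ n)%R%:R.
have h2 n : 0 < 2 ^+ n :> R by rewrite exprn_gt0.
have XE n w : X n w = 2^-1 ^+ n * (Num.trunc (g w * 2 ^+ n))%:R.
  have gn0 : 0 <= g w * 2 ^+ n by rewrite mulr_ge0// ltW.
  rewrite /X; congr (_ * _); rewrite -natr_sum; congr (_%:R).
  set t := Num.trunc (g w * 2 ^+ n); set N := (Num.trunc (2 * K * 2 ^+ n)).+1.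
  have tN : (t <= N)%N by rewrite leqW// le_truncn// ler_wpM2r// ltW.
  rewrite (eq_bigr (fun k : 'I_N => (k < t)%N : nat)); last first.
    move=> k _; congr (nat_of_bool _); apply/idP/idP.
      by rewrite truncn_ge_nat.
    by rewrite truncn_ge_nat.
  rewrite -(big_mkord xpredT (fun k => (k < t)%N : nat)) (big_cat_nat (n := t))//=.
  rewrite (eq_big_nat _ _ (F2 := fun=> 1%N)); last by move=> i /andP[_ ->].
  rewrite sum_nat_const_nat subn0 muln1 big_nat_cond big1 ?addn0//.
  by move=> i /andP[/andP[ti _] _]; rewrite ltnNge ti.
have Xg n w : `|X n w - g w| <= 2^-1 ^+ n.
  have gn0 : 0 <= g w * 2 ^+ n by rewrite mulr_ge0// ltW.
  have /andP[t1 t2] := truncn_itv gn0; rewrite XE.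
  set t := Num.trunc _ in t1 t2 *.
  rewrite distrC (_ : g w - _ = 2^-1 ^+ n * (g w * 2 ^+ n - t%:R)); last first.
    by rewrite mulrBr mulrCA exprVn mulVf ?mulr1// gt_eqF.
  rewrite normrM ger0_norm ?exprn_ge0// ler_piMr ?exprn_ge0//.
  by rewrite -natr1 in t2; rewrite ger0_norm; lra.
have hg : mult g.
  apply: (mult_lim T_gt0 hB (F := X) (K := 2 * K)).
  - move=> n; apply: mult_scale => //; apply: mult_sum => // k.
    have : msets (f @^-1` `[k.+1%:R / 2 ^+ n - K, +oo[%classic).
      by apply/SA_msets; rewrite -[X in measurable X]setTI; apply: mf => //; exact: measurable_itv.
    move=> [_ h]; apply: mult_eq h _ => w.
    rewrite indicE (_ : (w \in _) = (k.+1%:R <= g w * 2 ^+ n))//.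
    rewrite -ler_pdivrMr// /g -lerBlDr.
    by apply/idP/idP => [/set_mem|h]; [|apply/mem_set]; rewrite /= in_itv/= andbT.
  - move=> n w; rewrite XE ger0_norm; last by rewrite mulr_ge0 ?exprn_ge0.
    apply: (le_trans _ (gK w)); rewrite exprVn ler_pdivrMl// [_ * g w]mulrC.
    have gn0 : 0 <= g w * 2 ^+ n by rewrite mulr_ge0// ltW.
    by have /andP[] := truncn_itv gn0.
  - move=> w; apply/subr_cvg0; apply: (@cvg0_le R _ (fun n => 2^-1 ^+ n)) => //.
    exact: cvg_half.
apply: mult_eq (mult_add T_gt0 hB hg (mult_cst T_gt0 hB (- K))) _ => w.
by rewrite /g addrK.
Qed.

Lemma SA_clP (f : Om -> R) : measurable_fun (setT : set SA) (f : SA -> R) ->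
  L2 P f -> clP f.
Proof.
move=> mf Lf; pose F (n : nat) w := Num.max (Num.min (f w) n%:R) (- n%:R).
have mF n : measurable_fun (setT : set SA) (F n : SA -> R).
  by apply: measurable_maxr => //; exact: measurable_minr.
have Fn n w : `|F n w| <= n%:R.
  rewrite /F ler_norml; apply/andP; split; first by rewrite le_max lexx orbT.
  by rewrite ge_max ge_min lexx orbT/= ge0_cp.
have Ff n w : `|F n w| <= `|f w|.
  have n0 : 0 <= n%:R :> R by [].
  have := ler_norm (f w); have := ler_norm (- f w); rewrite normrN => *.
  rewrite /F; have [a|a] := leP (f w) n%:R.
    by have [b|b] := leP (f w) (- n%:R); rewrite ler_norml; apply/andP; split; lra.
  by have [b|b] := leP (n%:R : R) (- n%:R); rewrite ler_norml; apply/andP; split; lra.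
have cF w : F ^~ w @ \oo --> f w.
  apply: (@cvg_near_cst _ _ _ _ _); exists (Num.trunc `|f w|).+1 => // n /= hn.
  have : `|f w| < n%:R by rewrite (lt_le_trans (truncnS_gt _))// ler_nat.
  rewrite ltr_norml => /andP[h1 h2].
  by rewrite /F min_l ?max_l// ltW.
have [Lf' cv] := L2_dct (mu := P) (fun n => SA_meas (mF n)) (SA_meas mf) cF Lf Ff.
apply: (clos_lim (@chaos_poly_L2 R d Om P T B T_gt0 hB) Lf) => e e0.
have /cvgr0Pnorm_le/(_ _ e0)[n _ /(_ n (leqnn n))/= hn] := cv.
exists (F n); split; last by rewrite (le_trans (ler_norm _)).
have [_ _ h] := SA_bounded (mF n) (Fn n).
by apply: clos_eq (h _ (clP1 T_gt0 hB)) _ => w; rewrite mulr1.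
Qed.

Lemma clP_nice n G : nice G -> clP (fun w => G (xiv T B n w)).
Proof.
move=> nG; apply: SA_clP; last exact: (nice_L2 T_gt0 hB nG).
exact: (nice_meas nG (S := SA) (v := fun i => xi T B n i) (fun i => @SA_xi n i)).
Qed.

Lemma clP_cyl r (phi : 'I_r.+1 -> R -> R) (W : 'I_r.+1 -> Om -> R) h :
  (forall i, wiener_integral P T B (phi i) (W i)) -> continuous h -> pgrowth h ->
  clP (fun w => h (\row_i W i w)).
Proof.
move=> hW ch gh; have [e [b hb]] := wiener_family T_gt0 hB 0 hW.
have [L cv] := hW_cvg T_gt0 hB hW hb ch gh.
apply: (clos_lim (@chaos_poly_L2 R d Om P T B T_gt0 hB) L) => e1 e10.
have /cvgr0Pnorm_le/(_ _ e10)[m _ /(_ m (leqnn m))/= hm] := cv.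
eexists; split; first exact: (clP_nice (nice_Wm b ch gh m)).
apply: le_trans hm; apply: (le_trans _ (ler_norm _)).
rewrite !ipE le_eqVlt; apply/orP; left; apply/eqP; apply: eq_Rintegral => w _.
by rewrite -sqrrN opprB.
Qed.

(** [B t] is recovered from its values on the grid by continuity of paths, but only almost surely:
    hence the limsup as a version, and [mult_ae]. *)
Lemma SA_bm t (A : set R) : 0 <= t <= T -> measurable A -> msets (B t @^-1` A).
Proof.
move=> /andP[t0 tT] mA.
have mB : measurable_fun setT (B t) by have [h _ _ _ _] := hB; apply: h; rewrite t0.
have mBA : measurable (B t @^-1` A) by rewrite -[X in measurable X]setTI; exact: mB.
pose N n := gfloor T n t.
have N2 n : (N n <= 2 ^ n)%N by exact: gfloor_le.
pose Y n w : R := \sum_(k < N n) Num.sqrt (mesh T n) * xi T B n k w.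
have YE n w : Y n w = B (grid T n (N n)) w - B 0 w.
  rewrite /Y (eq_bigr (fun k : 'I_(N n) => B (grid T n k.+1) w - B (grid T n k) w)).
    rewrite -(big_mkord xpredT (fun k => B (grid T n k.+1) w - B (grid T n k) w)).
    by rewrite (telescope_sumr (fun k => B (grid T n k) w))// /grid mulr0 mul0r.
  by move=> k _; rewrite /xi mulrC divfK// gt_eqF// sqrtr_gt0 mesh_gt0.
have mY n : measurable_fun (setT : set SA) (Y n : SA -> R).
  apply: measurable_sum => k; apply: measurable_funM => //.
  exact: (SA_xi (Ordinal (leq_trans (ltn_ord k) (N2 n)))).
pose f w : R := fine (limn_esup (fun n => (Y n w)%:E)).
have mf : measurable_fun (setT : set SA) (f : SA -> R).
  apply: measurableT_comp; first exact: fine_measurable.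
  by apply: measurable_fun_limn_esup => n; apply/measurable_EFinP.
have fB : {ae P, forall w, f w = B t w}.
  have [_ h0 hc _ _] := hB; move: h0 hc; apply: filterS2 => w B0 cB.
  apply: limn_esup_EFin.
  have -> : (fun n => Y n w) = (fun n => B (grid T n (N n)) w) by apply/funext => n; rewrite YE B0 subr0.
  have gt : (fun n => grid T n (N n)) @ \oo --> t.
    apply/subr_cvg0; apply: (@cvg0_le R _ (fun n => T * 2^-1 ^+ n)).
      rewrite -[X in _ --> X](mulr0 T); apply: cvgM; first exact: cvg_cst.
      exact: cvg_half.
    move=> n; have /andP[h1 h2] := gfloor_itv T_gt0 n t0.
    rewrite distrC ger0_norm ?subr_ge0// lerBlDl ltW// (lt_le_trans h2)// lerD2l.
    by rewrite /mesh exprVn.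
  have tin : `[0, T]%classic t by rewrite /= in_itv/= t0.
  have cBt := (subspace_continuousP _ _).1 cB t tin.
  apply: (cvg_comp (fun n => grid T n (N n)) (fun t => B t w) _ cBt) => U hU.
  have [M _ hM] := gt _ hU; exists M => // n /hM /=; apply.
  by rewrite in_itv/=; exact: (grid_in T_gt0 (N2 n)).
have mf' := SA_meas mf.
split=> //.
have [_ h1] : msets (f @^-1` A).
  by apply/SA_msets; rewrite -[X in measurable X]setTI; apply: mf.
apply: (mult_ae T_gt0 hB h1).
- exact: measurable_indic.
- by exists 1 => w; rewrite indicE; case: (_ \in _); rewrite ?normr1 ?normr0.
- apply: filterS fB => w e.
  have ind (h : Om -> R) : \1_(h @^-1` A) w = \1_A (h w) :> R.
    by rewrite !indicE; congr (nat_of_bool _)%:R; apply/idP/idP => /set_mem ?; exact/mem_set.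
  by rewrite (ind (B t)) (ind f) e.
Qed.

Lemma brownian_msets : brownian_sigma_algebra T B `<=` msets.
Proof.
apply: smallest_sub; first exact: msets_sigma.
move=> _ [t /= tT] [A mA <-]; by rewrite setTI; apply: SA_bm => //; move: tT; rewrite in_itv.
Qed.

(** Through this the measurability clause of [delta2] acts: it places every admissible value in the
    closure of the test variables, where duality determines it. *)
Lemma brownian_clP X X' : L2 P X ->
  (forall A : set R, measurable A -> brownian_sigma_algebra T B (X' @^-1` A)) ->
  {ae P, forall w, X w = X' w} -> clP X.
Proof.
move=> LX hX' XX'.
have mX' : measurable_fun (setT : set SA) (X' : SA -> R).
  by move=> _ A mA; rewrite setTI; apply/SA_msets/brownian_msets; exact: hX'.
apply: (clos_ae (@chaos_poly_L2 R d Om P T B T_gt0 hB) _ LX.1 XX').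
apply: SA_clP => //; split; first exact: SA_meas.
apply: (itg_ae_le _ LX.2); first by apply: measurable_funX; exact: SA_meas.
by apply: filterS XX' => w ->; rewrite ger0_norm ?sqr_ge0.
Qed.

Let SB := g_sigma_algebraType
  (\bigcup_(t in `[0, T]%classic) preimage_set_system setT (B t) measurable).

Lemma SB_xi n (k : 'I_(2 ^ n)) : measurable_fun (setT : set SB) (xi T B n k : SB -> R).
Proof.
have mB i : (i <= 2 ^ n)%N -> measurable_fun (setT : set SB) (B (grid T n i) : SB -> R).
  move=> i2 _ A mA; rewrite setTI; apply: sub_gen_smallest.
  exists (grid T n i); first by rewrite /= in_itv/=; exact: grid_in.
  by exists A => //; rewrite setTI.
apply: measurable_funM => //; apply: measurable_funB; apply: mB => //; exact: ltnW.
Qed.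

(** Produces a value that satisfies the measurability clause: polynomials in the increments are
    exactly measurable for the sigma-algebra of [B], and so is the limsup of a fast sequence of
    them. *)
Lemma clP_brownian X : clP X -> exists X' : Om -> R,
  (forall A : set R, measurable A -> brownian_sigma_algebra T B (X' @^-1` A)) /\
  {ae P, forall w, X w = X' w}.
Proof.
move=> [LX hX].
have h n : exists q, (exists N, chaos_poly T B N q) /\
    ip P (fun z => q z - X z) (fun z => q z - X z) <= 2^-1 ^+ n.
  have e0 : 0 < 2^-1 ^+ n :> R by rewrite exprn_gt0.
  have [n0 /(_ n0 (leqnn n0))[q [hq le]]] := hX _ e0; exists q; split; first by exists n0.
  apply: le_trans le; rewrite !ipE le_eqVlt; apply/orP; left; apply/eqP.
  by apply: eq_Rintegral => w _; rewrite -sqrrN opprB.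
have [q hq] := choice h.
have Lq n : L2 P (q n) by have [[N hN] _] := hq n; exact: (chaos_poly_L2 T_gt0 hB hN).
have ae := ae_cvg_fast Lq LX (fun n => (hq n).2).
exists (fun w => fine (limn_esup (fun n => (q n w)%:E))); split.
  have m : measurable_fun (setT : set SB) ((fun w => fine (limn_esup (fun n => (q n w)%:E))) : SB -> R).
    apply: measurableT_comp; first exact: fine_measurable.
    apply: measurable_fun_limn_esup => n; apply/measurable_EFinP.
    have [[N [p [hp /funext ->]]] _] := hq n.
    exact: (nice_meas (polyf_nice hp) (S := SB) (v := fun i => xi T B N i) (fun i => @SB_xi N i)).
  by move=> A mA; have := m measurableT A mA; rewrite setTI.
by apply: filterS ae => w cw; apply/esym/limn_esup_EFin.
Qed.

End density.

(** * Weights of pairs of derivatives *)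

Section weights.
Variable r : nat.
Implicit Types al be : mindex r.

(** [l] is removed before [k], reversing the order in which [ibp2] raises them. *)
Definition mdecr2 al (k l : 'I_r) : mindex r := mdecr (mdecr al l) k.

(* [wt al k l] is the product of the two factors brought down when the Hermite
   product of index [al] is differentiated in the directions [k] and [l]. *)
Definition wt al (k l : 'I_r) : nat := (al l * mdecr al l k)%N.

Lemma msize_mdecr al l : (0 < al l)%N -> msize (mdecr al l) = (msize al).-1.
Proof.
move=> a0; rewrite /msize (bigD1 l)//= [in RHS](bigD1 l)//= ffunE eqxx subn1.
rewrite (eq_bigr (fun i => al i)); last by move=> i /negbTE il; rewrite ffunE il subn0.
by case: (al l) a0.
Qed.

(** For [al l] positive, lowering in the direction [l] leaves an index of size one less, so the
    inner sum is [al l] times that size. *)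
Lemma wt_sum al : (\sum_k \sum_l wt al k l = msize al * (msize al).-1)%N.
Proof.
rewrite exchange_big/= {1}/msize big_distrl/=; apply: eq_bigr => l _.
rewrite /wt -big_distrr/=; case: (posnP (al l)) => [->|a0]; first by rewrite !mul0n.
by rewrite -(msize_mdecr a0).
Qed.

(** A positive weight means that neither subtraction was truncated, so raising undoes lowering. *)
Lemma wt_gt0 al k l : (0 < wt al k l)%N ->
  [/\ mincr (mincr (mdecr2 al k l) k) l = al,
      wt al k l = ((mdecr2 al k l k).+1 * (mincr (mdecr2 al k l) k l).+1)%N &
      msize al = (msize (mdecr2 al k l)).+2].
Proof.
rewrite muln_gt0 => /andP[a0 b0].
have e1 : mincr (mdecr2 al k l) k = mdecr al l by rewrite mdecrK.
have e2 : mincr (mdecr al l) l = al by rewrite mdecrK.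
split; first by rewrite e1.
  have -> : (mdecr2 al k l k).+1 = mdecr al l k.
    by rewrite -[in RHS]e1 [RHS]ffunE eqxx addn1.
  have -> : (mincr (mdecr2 al k l) k l).+1 = al l by rewrite e1 ffunE eqxx subn1 prednK.
  by rewrite mulnC.
rewrite /mdecr2 msize_mdecr// msize_mdecr//.
have : (0 < msize (mdecr al l))%N by rewrite /msize (bigD1 k)//= addn_gt0 b0.
have : (0 < msize al)%N by rewrite /msize (bigD1 l)//= addn_gt0 a0.
rewrite msize_mdecr//; case: (msize al) => [|[|s]]//.
Qed.

End weights.

Lemma sum_CS (R : realType) (I : finType) (A : pred I) (x y : I -> R) :
  (\sum_(i | A i) x i * y i) ^+ 2 <=
  (\sum_(i | A i) x i ^+ 2) * (\sum_(i | A i) y i ^+ 2).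
Proof.
set X := \sum_(i | A i) x i ^+ 2; set Y := \sum_(i | A i) y i ^+ 2.
set C := \sum_(i | A i) x i * y i.
have Y0 : 0 <= Y by apply: sumr_ge0 => i _; exact: sqr_ge0.
have key : 0 <= Y * (X * Y - C ^+ 2).
  rewrite (_ : Y * _ = \sum_(i | A i) (Y * x i - C * y i) ^+ 2).
    by apply: sumr_ge0 => i _; exact: sqr_ge0.
  rewrite (eq_bigr (fun i => Y ^+ 2 * x i ^+ 2 - 2 * Y * C * (x i * y i) + C ^+ 2 * y i ^+ 2)).
    by rewrite big_split/= sumrB -!mulr_sumr -/X -/Y -/C; ring.
  by move=> i _; ring.
move: Y0; rewrite le_eqVlt => /predU1P[/esym Y0|Y0]; last first.
  by move: key; rewrite pmulr_rge0// subr_ge0.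
have y0 i : A i -> y i = 0.
  move=> Ai; apply/eqP; rewrite -sqrf_eq0 eq_le sqr_ge0 andbT -Y0 /Y (bigD1 i)//= lerDl.
  by apply: sumr_ge0 => j _; exact: sqr_ge0.
rewrite Y0 mulr0 /C big1 ?expr0n// => i Ai; by rewrite y0// mulr0.
Qed.

(** * The duality estimate on a grid and in the limit *)

Section core.
Context (R : realType) d (Om : measurableType d) (P : probability Om R).
Variables (T : R) (B : R -> Om -> R).
Hypothesis T_gt0 : 0 < T.
Hypothesis hB : brownian_motion P T B.
Local Notation leb := (@lebesgue_measure R).
Local Notation leb2 := (prodm leb leb).
Local Notation mu2 := (prodm P leb2).
Local Notation mu4 := (prodm mu2 leb2).

Lemma basis2_orthonormal n (al be : mindex (2 ^ n)) k l k' l' :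
  ip mu2 (basis2 T B al k l) (basis2 T B be k' l') =
  ((al == be) && (k == k') && (l == l'))%:R.
Proof.
have Lk q : L2 leb (cell T n q) by exact: cell_L2.
rewrite /basis2 (tensor_ip (hermv_L2 T_gt0 hB al) (tensor_L2 (Lk k) (Lk l))
  (hermv_L2 T_gt0 hB be) (tensor_L2 (Lk k') (Lk l'))).
rewrite (tensor_ip (Lk k) (Lk l) (Lk k') (Lk l')) hermv_orthonormal//.
by rewrite !cell_orthonormal// -!natrM !mulnb andbA.
Qed.

Lemma ibp2_wt F V n (al : mindex (2 ^ n)) k l : ibp2 P T B F V -> (0 < wt al k l)%N ->
  Num.sqrt (wt al k l)%:R * ip P (fun w => hermv al (xiv T B n w)) F =
  ip mu2 (basis2 T B (mdecr2 al k l) k l) V.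
Proof.
move=> hFV /wt_gt0[e1 e2 _]; rewrite -hFV e1 mulrA e2 natrM sqrtrM//.
Qed.

Variables (u : Om * (R * R) -> R) (u4 : (Om * (R * R)) * (R * R) -> R).
Hypothesis Lu : L2 mu2 u.
Hypothesis Lu4 : L2 mu4 u4.
(** The only relation between [u] and [u4]: tested on the basis, [u4] acts as a second derivative of
    [u]. *)
Hypothesis hu : forall n (al : mindex (2 ^ n)) (k l i j : 'I_(2 ^ n)),
  Num.sqrt (al k).+1%:R * Num.sqrt (mincr al k l).+1%:R *
    ip mu2 (basis2 T B (mincr (mincr al k) l) i j) u =
  ip mu4 (tensor (basis2 T B al k l) (tensor (cell T n i) (cell T n j))) u4.

Lemma hu_wt n (al : mindex (2 ^ n)) k l i j : (0 < wt al k l)%N ->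
  Num.sqrt (wt al k l)%:R * ip mu2 (basis2 T B al i j) u =
  ip mu4 (tensor (basis2 T B (mdecr2 al k l) k l) (tensor (cell T n i) (cell T n j))) u4.
Proof.
by move=> /wt_gt0[e1 e2 _]; rewrite -hu e1 e2 natrM sqrtrM.
Qed.

Section box.
Variables (n K : nat).
Local Notation M := (2 ^ n)%N.
Local Notation J := {ffun 'I_M -> 'I_K}.

(** Bounding the entries by [K] makes the multi-indices a finite type, over which Bessel's
    inequality is available. *)
Definition bidx (j : J) : mindex M := [ffun i => val (j i)].

Lemma bidx_inj : injective bidx.
Proof.
move=> j j' /ffunP e; apply/ffunP => i; apply: val_inj.
by have := e i; rewrite !ffunE.
Qed.

Definition bpred (t : J * ('I_M * 'I_M)) : bool := (0 < wt (bidx t.1) t.2.1 t.2.2)%N.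

(** Indexed by the multi-index before lowering, so that for a positive weight the coefficient of [V]
    here is a multiple of the coefficient of [F] at [t.1]. *)
Definition bfun (t : J * ('I_M * 'I_M)) : Om * (R * R) -> R :=
  basis2 T B (mdecr2 (bidx t.1) t.2.1 t.2.2) t.2.1 t.2.2.

Lemma bfun_L2 t : L2 mu2 (bfun t).
Proof. exact: basis2_L2. Qed.

Lemma mdecr2_bidx_inj (j j' : J) k l : (0 < wt (bidx j) k l)%N -> (0 < wt (bidx j') k l)%N ->
  mdecr2 (bidx j) k l = mdecr2 (bidx j') k l -> j = j'.
Proof.
move=> /wt_gt0[e1 _ _] /wt_gt0[e2 _ _] e; apply: bidx_inj.
by rewrite -e1 -e2 e.
Qed.

Lemma bfun_orthonormal t t' : bpred t -> bpred t' ->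
  ip mu2 (bfun t) (bfun t') = (t == t')%:R.
Proof.
case: t t' => [j [k l]] [j' [k' l']]; rewrite /bpred /bfun/= => pt pt'.
rewrite basis2_orthonormal; congr (nat_of_bool _)%:R.
apply/idP/eqP => [/andP[/andP[/eqP e /eqP kk] /eqP ll]|[-> -> ->]]; last by rewrite !eqxx.
move: pt' e; rewrite -kk -ll => pt' e.
by rewrite (mdecr2_bidx_inj pt pt' e).
Qed.

(** The weight is split as [wt / N] times [N], with [N = n (n - 1)]. Summed over the directions
    [wt / N] gives 1, or 0 when [N = 0], which leaves a Bessel sum for [F]; the factor [N] goes to
    the coefficients of [u], where two further derivatives pay for it. *)
Lemma core_estimate F V : L2 P F -> ibp2 P T B F V ->
  (\sum_(t | bpred t) ip mu2 (bfun t) V * ip mu2 (bfun t) u) ^+ 2 <=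
  ip P F F * (6 * (ip mu2 u u + ip mu4 u4 u4)).
Proof.
move=> LF hFV; pose N (al : mindex M) : R := (msize al * (msize al).-1)%:R.
pose e (j : J) w := hermv (bidx j) (xiv T B n w).
pose U t := ip mu2 (bfun t) u.
pose x (t : J * ('I_M * 'I_M)) := Num.sqrt ((wt (bidx t.1) t.2.1 t.2.2)%:R / N (bidx t.1)) * ip P (e t.1) F.
pose y t := Num.sqrt (N (bidx t.1)) * U t.
have N0 t : bpred t -> 0 < N (bidx t.1).
  by move=> /wt_gt0[_ _ h]; rewrite /N h ltr0n.
have -> : \sum_(t | bpred t) ip mu2 (bfun t) V * ip mu2 (bfun t) u = \sum_(t | bpred t) x t * y t.
  apply: eq_bigr => t pt; rewrite /x /y mulrACA -sqrtrM ?divr_ge0//.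
  rewrite divfK ?gt_eqF ?N0// mulrA; congr (_ * _).
  by rewrite /bfun -(ibp2_wt hFV pt).
apply: (le_trans (sum_CS _ _ _)); apply: ler_pM.
- by apply: sumr_ge0 => t _; exact: sqr_ge0.
- by apply: sumr_ge0 => t _; exact: sqr_ge0.
- apply: (@le_trans _ _ (\sum_(j : J) ip P (e j) F ^+ 2)); last first.
    apply: (@Bessel _ _ _ P J xpredT e) => //.
    + by move=> j _; exact: hermv_L2.
    + move=> j j' _ _; rewrite hermv_orthonormal//.
      by rewrite (inj_eq bidx_inj).
  rewrite (eq_bigl (fun t => true && bpred t))// -(pair_big_dep xpredT (fun j kl => bpred (j, kl)) (fun j kl => x (j, kl) ^+ 2))/=.
  apply: ler_sum => j _.
  have e1 kl : bpred (j, kl) -> x (j, kl) ^+ 2 = (wt (bidx j) kl.1 kl.2)%:R * (ip P (e j) F ^+ 2 / N (bidx j)).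
    by move=> _; rewrite /x exprMn sqr_sqrtr ?divr_ge0//=; ring.
  rewrite (eq_bigr _ e1) -mulr_suml.
  have e2 : \sum_(kl | bpred (j, kl)) (wt (bidx j) kl.1 kl.2)%:R = N (bidx j).
    rewrite /N -wt_sum pair_big natr_sum big_mkcond; apply: eq_bigr => kl _.
    by rewrite /bpred/=; case: posnP => [->|].
  rewrite e2; have [->|n0] := eqVneq (N (bidx j)) 0; first by rewrite mul0r sqr_ge0.
  by rewrite mulrCA divff// mulr1.
(* With [s = n - 2] the size of the lowered index, the inner sum of weights is [s (s - 1)] by
   [wt_sum], and the claim reduces to [(s + 2) (s + 1) <= 6 (1 + s (s - 1))], an equality at
   [s = 1]. *)
- have b6 t : bpred t -> y t ^+ 2 <= 6 * (U t ^+ 2 + \sum_pq (wt (mdecr2 (bidx t.1) t.2.1 t.2.2) pq.1 pq.2)%:R * U t ^+ 2).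
    move=> /wt_gt0[_ _ h]; rewrite /y exprMn sqr_sqrtr// -mulr_suml.
    rewrite -{2}[U t ^+ 2]mul1r -mulrDl mulrA ler_wpM2r ?sqr_ge0//.
    rewrite -natr_sum -(pair_big xpredT xpredT (fun p q => wt (mdecr2 (bidx t.1) t.2.1 t.2.2) p q))/= wt_sum /N h.
    rewrite -[1]/(1%:R) -natrD -natrM ler_nat.
    set s := msize _; case: s => [|[|s]]//=.
    rewrite -(ler_nat R) !(natrM, natrD) -!natr1; have := ler0n R s; nra.
  apply: (le_trans (ler_sum _ b6)); rewrite -mulr_sumr ler_wpM2l//.
  rewrite big_split/=; apply: lerD.
    apply: (@Bessel _ _ _ mu2 _ bpred bfun) => //.
    + by move=> t _; exact: bfun_L2.
    + by move=> t t' pt pt'; exact: bfun_orthonormal.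
  pose Q (s : (J * ('I_M * 'I_M)) * ('I_M * 'I_M)) :=
    bpred s.1 && (0 < wt (mdecr2 (bidx s.1.1) s.1.2.1 s.1.2.2) s.2.1 s.2.2)%N.
  pose b4 (s : (J * ('I_M * 'I_M)) * ('I_M * 'I_M)) : (Om * (R * R)) * (R * R) -> R :=
    tensor (basis2 T B (mdecr2 (mdecr2 (bidx s.1.1) s.1.2.1 s.1.2.2) s.2.1 s.2.2) s.2.1 s.2.2)
      (tensor (cell T n s.1.2.1) (cell T n s.1.2.2)).
  have Lk q : L2 leb (cell T n q) by exact: cell_L2.
  have -> : \sum_(t | bpred t) \sum_pq (wt (mdecr2 (bidx t.1) t.2.1 t.2.2) pq.1 pq.2)%:R * U t ^+ 2 =
      \sum_(s | Q s) ip mu4 (b4 s) u4 ^+ 2.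
    rewrite -(pair_big_dep bpred (fun t pq => 0 < wt (mdecr2 (bidx t.1) t.2.1 t.2.2) pq.1 pq.2)%N
      (fun t pq => ip mu4 (b4 (t, pq)) u4 ^+ 2))/=.
    apply: eq_bigr => t _; rewrite [RHS]big_mkcond/=; apply: eq_bigr => pq _.
    case: posnP => [->|w0]; first by rewrite mul0r.
    by rewrite /b4/= -hu_wt// exprMn sqr_sqrtr.
  apply: (@Bessel _ _ _ mu4 _ Q b4) => //.
    by move=> s _; apply: tensor_L2; [exact: basis2_L2|exact: tensor_L2].
  (* The four directions are read off from the cells; since both weights are positive, they and the
     lowered index determine the original one, which gives orthonormality. *)
  move=> [[j [k l]] [p q]] [[j' [k' l']] [p' q']]; rewrite /Q /b4 /bpred/=.
  move=> /andP[pt w0] /andP[pt' w0'].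
  rewrite (tensor_ip (basis2_L2 T_gt0 hB _ _ _) (tensor_L2 (Lk _) (Lk _)) (basis2_L2 T_gt0 hB _ _ _) (tensor_L2 (Lk _) (Lk _))).
  rewrite (tensor_ip (Lk _) (Lk _) (Lk _) (Lk _)) basis2_orthonormal !cell_orthonormal//.
  rewrite -!natrM !mulnb; congr (nat_of_bool _)%:R.
  apply/idP/eqP => [|[-> -> -> -> ->]]; last by rewrite !eqxx.
  move=> /andP[/andP[/andP[/eqP ee /eqP pp] /eqP qq] /andP[kk ll]].
  have {}kk : k = k' by apply: val_inj; exact/eqP.
  have {}ll : l = l' by apply: val_inj; exact/eqP.
  move: pt' w0' ee; rewrite -kk -ll -pp -qq => pt' w0' ee.
  have [f1 _ _] := wt_gt0 w0; have [f2 _ _] := wt_gt0 w0'.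
  have e' : mdecr2 (bidx j) k l = mdecr2 (bidx j') k l by rewrite -f1 -f2 ee.
  by rewrite (mdecr2_bidx_inj pt pt' e').
Qed.

End box.

Lemma bidx_lift n (al : mindex (2 ^ n)) K : (forall i, (al i < K)%N) ->
  exists j : {ffun 'I_(2 ^ n) -> 'I_K}, bidx j = al.
Proof.
move=> aK; exists [ffun i => Ordinal (aK i)]; apply/ffunP => i.
by rewrite !ffunE.
Qed.

Definition steps n (q : Om * (R * R) -> R) : Prop :=
  exists p : 'I_(2 ^ n) -> 'I_(2 ^ n) -> ('I_(2 ^ n) -> R) -> R,
    (forall k l, polyf (p k l)) /\
    forall z, q z = \sum_k \sum_l
      tensor (fun w => p k l (xiv T B n w)) (tensor (cell T n k) (cell T n l)) z.

Lemma steps_bfun n q : steps n q -> exists K (c : {ffun 'I_(2 ^ n) -> 'I_K} * ('I_(2 ^ n) * 'I_(2 ^ n)) -> R),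
  forall z, q z = \sum_(t | bpred t) c t * bfun t z.
Proof.
move=> [p [hp hq]].
have h (kl : 'I_(2 ^ n) * 'I_(2 ^ n)) : exists s : seq (R * mindex (2 ^ n)), forall x, p kl.1 kl.2 x = \sum_(a <- s) a.1 * hermv a.2 x.
  exact: (polyf_hspan (hp kl.1 kl.2)).
have [s hs] := choice h.
(* Two raisings add at most 2 to an entry, and the bound in [bidx] is strict: hence 3. *)
pose mx := (\max_kl \max_(a <- s kl) \max_i a.2 i).+3.
have bnd kl a i : a \in s kl -> (mincr (mincr a.2 kl.1) kl.2 i < mx)%N.
  move=> ain; rewrite !ffunE /mx; apply: (@leq_trans (a.2 i).+3).
    by rewrite -addnA -[(a.2 i).+3]addn3 ltn_add2l; case: (_ == _); case: (_ == _).
  rewrite !ltnS (leq_trans (leq_bigmax i))//.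
  apply: (leq_trans _ (leq_bigmax kl)).
  exact: (@leq_bigmax_seq _ (s kl) xpredT (fun a => \max_i a.2 i) a ain isT).
exists mx, (fun t => \sum_(a <- s t.2) a.1 * (a.2 == mdecr2 (bidx t.1) t.2.1 t.2.2)%:R) => z.
rewrite hq pair_big/= (eq_bigl (fun t : {ffun 'I_(2 ^ n) -> 'I_mx} * ('I_(2 ^ n) * 'I_(2 ^ n)) => true && bpred t))//.
rewrite -(pair_big_dep xpredT (fun j kl => bpred (j, kl)) (fun j kl => (\sum_(a <- s kl) a.1 * (a.2 == mdecr2 (bidx j) kl.1 kl.2)%:R) * bfun (j, kl) z))/=.
rewrite (exchange_big_dep xpredT)//=; apply: eq_bigr => kl _.
rewrite /tensor hs.
under [RHS]eq_bigr do rewrite mulr_suml.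
rewrite exchange_big/= mulr_suml [LHS]big_seq [RHS]big_seq; apply: eq_bigr => a ain.
have [j0 hj0] := bidx_lift (fun i => bnd kl a i ain).
have e0 : mdecr2 (bidx j0) kl.1 kl.2 = a.2 by rewrite hj0 /mdecr2 !mincrK.
have w0 : bpred (j0, kl).
  rewrite /bpred/= /wt hj0 mincrK muln_gt0 !ffunE !eqxx !addn1//.
rewrite (bigD1 j0)//= [X in _ + X]big1 ?addr0.
  by rewrite e0 eqxx mulr1 /bfun/= e0 /basis2 /tensor/= -mulrA.
move=> j /andP[wj jj0]; case: eqP => [e|_]; last by rewrite mulr0 mul0r.
case/eqP: jj0; apply: (mdecr2_bidx_inj wj w0); by rewrite /= e0 e.
Qed.

Lemma steps_L2 n q : steps n q -> L2 mu2 q.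
Proof.
move=> /steps_bfun[K [c /funext ->]]; apply: L2_sum => t _; apply: L2Z; exact: bfun_L2.
Qed.

(** [V] is replaced by its projection on the finite family and not by the approximating step field:
    the projection keeps the coefficients of [V], to which [core_estimate] applies, and by
    [proj_dist] it is at least as close. *)
Lemma duality_bound F V : L2 P F -> clos mu2 steps V -> ibp2 P T B F V ->
  ip mu2 V u ^+ 2 <= 6 * (ip mu2 u u + ip mu4 u4 u4) * ip P F F.
Proof.
move=> LF [LV hV] hFV; set K2 := 6 * _.
have K0 : 0 <= K2 by rewrite mulr_ge0// addr_ge0// ip_ge0.
have key e : 0 < e -> `|ip mu2 V u| <= Num.sqrt (K2 * ip P F F) + e * Num.sqrt (ip mu2 u u).
  move=> e0; have e20 : 0 < e ^+ 2 by rewrite exprn_gt0.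
  have [n /(_ n (leqnn n))[q [hq le]]] := hV _ e20.
  have [K [c qE]] := steps_bfun hq.
  pose p z := \sum_(t | bpred t) ip mu2 (bfun t) V * @bfun n K t z.
  have Lp : L2 mu2 p by apply: L2_sum => t _; apply: L2Z; exact: bfun_L2.
  have Vp : ip mu2 (fun z => V z - p z) (fun z => V z - p z) <= e ^+ 2.
    apply: (le_trans _ le).
    have := @proj_dist _ _ _ mu2 _ (@bpred n K) (@bfun n K) (fun t _ => bfun_L2 t) (@bfun_orthonormal n K) V c LV.
    by rewrite /= (_ : (fun x => V x - q x) = (fun x => V x - \sum_(t | bpred t) c t * bfun t x))//;
      apply/funext => x; rewrite qE.
  have pu : ip mu2 p u ^+ 2 <= K2 * ip P F F.
    rewrite /p ip_combination//; last by move=> t _; exact: bfun_L2.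
    by rewrite mulrC; exact: core_estimate.
  have -> : ip mu2 V u = ip mu2 p u + ip mu2 (fun z => V z - p z) u.
    by rewrite ipBl// addrC subrK.
  rewrite (le_trans (ler_normD _ _))// lerD//.
    by rewrite -sqrtr_sqr ler_wsqrtr.
  have LD := L2B LV Lp.
  rewrite -[e]gtr0_norm// -!sqrtr_sqr -sqrtrM ?sqr_ge0// ler_wsqrtr//.
  by rewrite (le_trans (ip_CS LD Lu))// ler_wpM2r ?ip_ge0.
have lim : `|ip mu2 V u| <= Num.sqrt (K2 * ip P F F).
  apply/ler_addgt0Pl => e e0; set s := Num.sqrt (ip mu2 u u) in key.
  have s1 : 0 < s + 1 by rewrite ltr_wpDl// sqrtr_ge0.
  have := key (e / (s + 1)) (divr_gt0 e0 s1); move/le_trans; apply.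
  by rewrite addrC lerD2r mulrAC ler_pdivrMr// ler_wpM2l ?(ltW e0)// lerDl ler01.
have : `|ip mu2 V u| ^+ 2 <= Num.sqrt (K2 * ip P F F) ^+ 2.
  by rewrite lerXn2r ?nnegrE ?sqrtr_ge0.
by rewrite sqr_sqrtr ?(mulr_ge0 K0 (ip_ge0 P F))// real_normK// num_real.
Qed.

End core.

(** * Closures of tensor products *)

Section tensor_closure.
Context d1 d2 (S1 : measurableType d1) (S2 : measurableType d2) (R : realType).
Variables (m1 : {sigma_finite_measure set S1 -> \bar R}).
Variables (m2 : {sigma_finite_measure set S2 -> \bar R}).
Variables (Q1 : nat -> (S1 -> R) -> Prop) (Q2 : nat -> (S2 -> R) -> Prop).
Variable Q : nat -> (S1 * S2 -> R) -> Prop.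
Hypothesis Q1L2 : forall n q, Q1 n q -> L2 m1 q.
Hypothesis Q2L2 : forall n q, Q2 n q -> L2 m2 q.
Hypothesis Q12 : forall n p q, Q1 n p -> Q2 n q -> Q n (tensor p q).

(** The error is the tensor of [f - p] with [g] plus that of [p] with [g - q], so the norm of [p]
    has to be controlled as well. *)
Lemma clos_tensor f g : clos m1 Q1 f -> clos m2 Q2 g -> clos (prodm m1 m2) Q (tensor f g).
Proof.
move=> [Lf hf] [Lg hg]; split; first exact: tensor_L2.
move=> e e0.
have f0 := ip_ge0 m1 f; have g0 := ip_ge0 m2 g.
have a0 : 0 < 4 * (ip m2 g g + 1) by lra.
have b0 : 0 < 4 * (2 * ip m1 f f + 2) by lra.
(* The bound 1 ensures [|p|^2 <= 2 |f|^2 + 2], the quantity that sets the accuracy required of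
   [q]. *)
have d10 : 0 < Num.min 1 (e / (4 * (ip m2 g g + 1))) by rewrite lt_min ltr01 divr_gt0.
have [n1 h1] := hf _ d10; have [n2 h2] := hg _ (divr_gt0 e0 b0).
exists (maxn n1 n2) => n; rewrite geq_max => /andP[/h1[p [hp le1]] /h2[q [hq le2]]].
exists (tensor p q); split; first exact: Q12.
have Lp := Q1L2 hp; have Lq := Q2L2 hq.
have Lfp := L2B Lf Lp; have Lgq := L2B Lg Lq.
rewrite (_ : (fun z => _) = (fun z => tensor (fun x => f x - p x) g z + tensor p (fun y => g y - q y) z)); last first.
  by apply/funext => z; rewrite /tensor; ring.
apply: (le_trans (ip_sum_le2 (tensor_L2 Lfp Lg) (tensor_L2 Lp Lgq))).
rewrite (tensor_ip Lfp Lg Lfp Lg) (tensor_ip Lp Lgq Lp Lgq).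
move: le1; rewrite le_min => /andP[le0 le1].
have pp : ip m1 p p <= 2 * ip m1 f f + 2.
  have := ip_sum_le2 Lf (L2N Lfp).
  rewrite (_ : (fun x => f x + _) = p); last by apply/funext => x; ring.
  rewrite (_ : ip m1 (fun x => - (f x - p x)) (fun x => - (f x - p x)) = ip m1 (fun x => f x - p x) (fun x => f x - p x)).
    lra.
  by rewrite !ipE; apply: eq_Rintegral => x _; rewrite sqrrN.
have k1 : ip m1 (fun x => f x - p x) (fun x => f x - p x) * ip m2 g g <= e / 4.
  move: le1; rewrite ler_pdivlMr// => le1.
  have := ip_ge0 m1 (fun x => f x - p x); lra.
have k2 : ip m1 p p * ip m2 (fun y => g y - q y) (fun y => g y - q y) <= e / 4.
  move: le2; rewrite ler_pdivlMr// => le2.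
  have := ler_wpM2r (ip_ge0 m2 (fun y => g y - q y)) pp; lra.
lra.
Qed.

End tensor_closure.

(** * Malliavin derivatives as limits of polynomial step fields *)

Section malliavin_closure.
Context (R : realType) d (Om : measurableType d) (P : probability Om R).
Variables (T : R) (B : R -> Om -> R).
Hypothesis T_gt0 : 0 < T.
Hypothesis hB : brownian_motion P T B.
Local Notation leb := (@lebesgue_measure R).
Local Notation leb2 := (prodm leb leb).
Local Notation mu2 := (prodm P leb2).
Local Notation I := (`[0, T]%classic : set (measurableTypeR R)).
Local Notation clP := (@clP R d Om P T B).
Local Notation steps := (@steps R d Om T B).

Lemma steps_add n p q : steps n p -> steps n q -> steps n (fun z => p z + q z).
Proof.
move=> [p' [hp ep]] [q' [hq eq']]; exists (fun k l x => p' k l x + q' k l x); split.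
  by move=> k l; exact: polyf_add.
move=> z; rewrite ep eq' -big_split; apply: eq_bigr => k _.
by rewrite -big_split; apply: eq_bigr => l _; rewrite /tensor mulrDl.
Qed.

Lemma steps_scale n k q : steps n q -> steps n (fun z => k * q z).
Proof.
move=> [q' [hq eq']]; exists (fun i l x => k * q' i l x); split.
  by move=> i l; apply: polyf_mul => //; exact: polyf_cst.
move=> z; rewrite eq' mulr_sumr; apply: eq_bigr => i _; rewrite mulr_sumr.
by apply: eq_bigr => l _; rewrite /tensor !mulrA.
Qed.

Definition steps1 n (q : R -> R) : Prop :=
  exists b : 'I_(2 ^ n) -> R, forall x, q x = \sum_j b j * cell T n j x.

Definition steps2 n (q : R * R -> R) : Prop :=
  exists c : 'I_(2 ^ n) -> 'I_(2 ^ n) -> R,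
    forall y, q y = \sum_k \sum_l c k l * tensor (cell T n k) (cell T n l) y.

Lemma steps1_L2 n q : steps1 n q -> L2 leb q.
Proof.
move=> [b /funext ->]; apply: L2_sum => j _; apply: L2Z; exact: cell_L2.
Qed.

Lemma steps2_L2 n q : steps2 n q -> L2 leb2 q.
Proof.
move=> [b /funext ->]; apply: L2_sum => k _; apply: L2_sum => l _; apply: L2Z.
by apply: tensor_L2; exact: cell_L2.
Qed.

Lemma steps11 n p q : steps1 n p -> steps1 n q -> steps2 n (tensor p q).
Proof.
move=> [b hb] [c hc]; exists (fun k l => b k * c l) => y.
rewrite /tensor hb hc mulr_suml; apply: eq_bigr => k _.
by rewrite mulr_sumr; apply: eq_bigr => l _; rewrite mulrACA.
Qed.

Lemma poly_steps2 n p q : chaos_poly T B n p -> steps2 n q -> steps n (tensor p q).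
Proof.
move=> [p' [hp ep]] [c hc]; exists (fun k l x => p' x * c k l); split.
  by move=> k l; apply: polyf_mul => //; exact: polyf_cst.
move=> z; rewrite {1}/tensor ep hc mulr_sumr; apply: eq_bigr => k _.
by rewrite mulr_sumr; apply: eq_bigr => l _; rewrite /tensor !mulrA.
Qed.

Lemma wiener_clos phi W : wiener_integral P T B phi W -> clos leb steps1 (cut T phi).
Proof.
move=> hW; split; first exact: (wiener_L2 hW).1.
move=> e e0; have [n0 hn] := wiener_dyadic T_gt0 hB hW e0; exists n0 => n /hn[b [le _]].
exists (fun x => \sum_j b j * cell T n j x); split; first by exists b.
apply: le_trans le; rewrite !ipE le_eqVlt; apply/orP; left; apply/eqP.
by apply: eq_Rintegral => w _; rewrite -sqrrN opprB.
Qed.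

Lemma smooth_clos F DF D2F : smooth_cylindrical P T B F DF D2F ->
  clP F /\ clos mu2 steps (cut2 I D2F).
Proof.
move=> [r [phi [W [f [hW sf hF _ hD]]]]].
have df s x : differentiable (partials s f) x by exact: (sf s).1.
have gf s : pgrowth (partials s f) by exact: (sf s).2.
have cf s : continuous (partials s f) by move=> x; exact: differentiable_continuous.
have hcl s : clP (fun w => partials s f (\row_i W i w)) by exact: (clP_cyl T_gt0 hB hW).
split.
  by have := hcl [::]; rewrite (_ : F = (fun w => partials [::] f (\row_i W i w)))//; exact/funext.
rewrite (smooth_cut2 T hD).
have ht i j : clos mu2 steps (tensor (fun w => partials [:: i; j] f (\row_i W i w)) (tensor (cut T (phi i)) (cut T (phi j)))).
  apply: (@clos_tensor _ _ _ _ _ P leb2 (chaos_poly T B) steps2 steps (@chaos_poly_L2 _ _ _ _ _ _ T_gt0 hB) steps2_L2 poly_steps2).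
    exact: hcl.
  apply: (@clos_tensor _ _ _ _ _ leb leb steps1 steps1 steps2 steps1_L2 steps1_L2 steps11).
    exact: wiener_clos (hW i).
  exact: wiener_clos (hW j).
have sL2 n q : steps n q -> L2 mu2 q by exact: steps_L2.
have c0 : clos mu2 steps (fun=> 0).
  have h := clos_scale (mu := mu2) sL2 steps_scale 0 (ht ord0 ord0).
  by apply: (clos_eq h) => z; rewrite mul0r.
have csum (G : 'I_r.+1 -> Om * (R * R) -> R) : (forall i, clos mu2 steps (G i)) ->
    clos mu2 steps (fun z => \sum_i G i z).
  move=> hG; elim: (index_enum _) => [|i s IH].
    by apply: clos_eq c0 _ => z; rewrite big_nil.
  have h := clos_add (mu := mu2) sL2 steps_add (hG i) IH.
  by apply: (clos_eq h) => z; rewrite big_cons.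
exact: (csum _ (fun i => csum _ (fun j => ht i j))).
Qed.

Lemma malliavin22_clos F DF D2F : malliavin22 P T B F DF D2F ->
  clP F /\ clos mu2 steps (cut2 I D2F).
Proof.
move=> /(malliavin22_approx T_gt0 hB)[LF LD [Fn [DFn [D2Fn [hs c1 c2]]]]].
have sq (d' : measure_display) (S : measurableType d') (mu : {measure set S -> \bar R}) (f g : S -> R) :
    ip mu (fun x => f x - g x) (fun x => f x - g x) = ip mu (fun x => g x - f x) (fun x => g x - f x).
  by rewrite !ipE; apply: eq_Rintegral => w _; rewrite -sqrrN opprB.
split.
  apply: (clos_lim (@chaos_poly_L2 _ _ _ _ _ _ T_gt0 hB) LF) => e e0.
  have /cvgr0Pnorm_le/(_ _ e0)[m _ /(_ m (leqnn m))/= hm] := c1.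
  exists (Fn m); split; first exact: (smooth_clos (hs m)).1.
  by rewrite sq (le_trans (ler_norm _)).
have sL2 n q : steps n q -> L2 mu2 q by exact: steps_L2.
apply: (clos_lim (mu := mu2) sL2 LD) => e e0.
have /cvgr0Pnorm_le/(_ _ e0)[m _ /(_ m (leqnn m))/= hm] := c2.
exists (cut2 I (D2Fn m)); split; first exact: (smooth_clos (hs m)).2.
by rewrite sq (le_trans (ler_norm _)).
Qed.

End malliavin_closure.

(** The polynomials of [polyf] transported to row vectors, where partial derivatives are taken. *)
Inductive polyV (R : realType) r : ('rV[R]_r.+1 -> R) -> Prop :=
| polyV_cst k : polyV (fun=> k)
| polyV_coord i : polyV (fun x => x ord0 i)
| polyV_add p q : polyV p -> polyV q -> polyV (fun x => p x + q x)
| polyV_mul p q : polyV p -> polyV q -> polyV (fun x => p x * q x).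

Section polyV.
Context (R : realType) (r : nat).
Implicit Types f : 'rV[R]_r.+1 -> R.

Lemma polyV_differentiable f : polyV f -> forall x, differentiable f x.
Proof.
elim=> [k|i|p q _ hp _ hq|p q _ hp _ hq] x.
- exact: differentiable_cst.
- exact: differentiable_coord.
- exact: differentiableD.
- exact: differentiableM.
Qed.

Lemma derive_coord (i : 'I_r.+1) (v x : 'rV[R]_r.+1) :
  'D_v (fun y : 'rV[R]_r.+1 => y ord0 i) x = v ord0 i.
Proof.
apply: cvg_lim => //; apply: cvg_near_cst.
near=> h; rewrite /= !mxE addrK /GRing.scale/= mulrA mulVf ?mul1r//.
by near: h; exact: nbhs_dnbhs_neq.
Unshelve. all: by end_near.
Qed.

Lemma polyV_derive f v : polyV f -> polyV ('D_v f).
Proof.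
elim=> [k|i|p q hp IHp hq IHq|p q hp IHp hq IHq].
- rewrite (_ : 'D_v _ = fun=> 0); first exact: polyV_cst.
  by apply/funext => x; exact: derive_cst.
- rewrite (_ : 'D_v _ = fun=> v ord0 i); first exact: polyV_cst.
  by apply/funext => x; exact: derive_coord.
- rewrite (_ : 'D_v _ = fun x => 'D_v p x + 'D_v q x); first exact: polyV_add.
  apply/funext => x; apply: deriveD; apply: diff_derivable; exact: polyV_differentiable.
- rewrite (_ : 'D_v _ = fun x => p x * 'D_v q x + q x * 'D_v p x).
    by apply: polyV_add; exact: polyV_mul.
  apply/funext => x; apply: deriveM; apply: diff_derivable; exact: polyV_differentiable.
Qed.

Lemma pgrowth_coef (c a : R) k m : (k <= m)%N -> 0 <= a ->
  c * (1 + a ^+ k) <= `|c| * 2 * (1 + a ^+ m).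
Proof.
move=> km a0; have am : a ^+ k <= 1 + a ^+ m.
  have [a1|a1] := leP a 1.
    by rewrite (le_trans (exprn_ile1 k a0 a1))// lerDl exprn_ge0.
  by rewrite (le_trans (ler_weXn2l (ltW a1) km))// lerDr.
have m0 : 0 <= a ^+ m by exact: exprn_ge0.
have k0 : 0 <= a ^+ k by exact: exprn_ge0.
apply: (@le_trans _ _ (`|c| * (1 + a ^+ k))).
  by rewrite ler_wpM2r ?ler_norm// addr_ge0.
rewrite -mulrA ler_wpM2l//; lra.
Qed.

Lemma polyV_growth f : polyV f -> pgrowth f.
Proof.
elim=> [k|i|p q _ [c [k hp]] _ [e [l hq]]|p q _ [c [k hp]] _ [e [l hq]]].
- by exists `|k|, 0%N => x; rewrite ler_peMr// lerDl exprn_ge0.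
- exists 1, 1%N => x; rewrite mul1r expr1; apply: (@le_trans _ _ `|x|); last by rewrite lerDr.
  rewrite [leRHS](mx_normrE x).
  exact: (le_bigmax _ (fun ij => `|x ij.1 ij.2|) (ord0, i)).
- exists (`|c| * 2 + `|e| * 2), (k + l)%N => x; rewrite (le_trans (ler_normD _ _))// mulrDl.
  apply: lerD; [apply: (le_trans (hp x))|apply: (le_trans (hq x))]; apply: pgrowth_coef => //.
    exact: leq_addr.
  exact: leq_addl.
- exists (`|c| * 2 * (`|e| * 2) * 2), ((k + l) + (k + l))%N => x; rewrite normrM.
  have h1 := le_trans (hp x) (pgrowth_coef c (leq_addr l k) (normr_ge0 x)).
  have h2 := le_trans (hq x) (pgrowth_coef e (leq_addl k l) (normr_ge0 x)).
  apply: (le_trans (ler_pM (normr_ge0 _) (normr_ge0 _) h1 h2)).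
  rewrite mulrACA -[leRHS]mulrA ler_wpM2l ?mulr_ge0//.
  rewrite (exprD _ (k + l) (k + l)); have := sqr_ge0 (`|x| ^+ (k + l) - 1); lra.
Qed.

Lemma polyV_smooth f : polyV f -> smooth_poly_growth f.
Proof.
move=> hf s; have : polyV (partials s f).
  by elim: s => [//|i s IH]; exact: polyV_derive.
by move=> h; split; [exact: polyV_differentiable|exact: polyV_growth].
Qed.

End polyV.

(** * Polynomials in the increments belong to the Malliavin domain *)

Section poly_smooth.
Context (R : realType) d (Om : measurableType d) (P : probability Om R).
Variables (T : R) (B : R -> Om -> R).
Hypothesis T_gt0 : 0 < T.
Hypothesis hB : brownian_motion P T B.
Local Notation leb := (@lebesgue_measure R).

Lemma cell_wiener n k : (k < 2 ^ n)%N -> wiener_integral P T B (cell T n k) (xi T B n k).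
Proof.
move=> kn; have Lc : L2 leb (cell T n k) by exact: cell_L2.
have Lx : L2 P (xi T B n k) := xi_L2 T_gt0 hB (Ordinal kn).
split.
- apply: (@measurable_funS _ _ _ _ setT) => //; exact: Lc.1.
- apply: le_lt_trans ((L2P _ _).1 Lc).2.
  apply: ge0_subset_integral => //.
    apply/measurable_EFinP; apply: measurable_funX; exact: Lc.1.
  by move=> x _; rewrite lee_fin sqr_ge0.
- exact/L2P.
exists (fun=> 1%N), (fun _ i => grid T n (k + i)), (fun _ _ => (Num.sqrt (mesh T n))^-1).
have gk : grid T n k <= grid T n k.+1 by exact: grid_mono.
split.
- move=> _; split; rewrite ?addn0 ?addn1.
  + exact: grid_ge0.
  + by have /andP[] := grid_in T_gt0 kn.
  + by move=> i; rewrite ltnS leqn0 => /eqP ->; rewrite addn0 addn1.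
- rewrite (_ : (fun n0 : nat => _) = fun=> 0%E); first exact: cvg_cst.
  apply/funext => _; apply: integral0_eq => x _.
  by rewrite big_ord1 addn0 addn1 /cell mulrC subrr expr0n.
- rewrite (_ : (fun n0 : nat => _) = fun=> 0%E); first exact: cvg_cst.
  apply/funext => _; apply: integral0_eq => x _.
  by rewrite big_ord1 addn0 addn1 /xi mulrC subrr expr0n.
Qed.

Lemma polyf_polyV n (p : ('I_(2 ^ n) -> R) -> R) : polyf p ->
  polyV (fun x : 'rV[R]_(2 ^ n).+1 => p (fun k => x ord0 (widen_ord (leqnSn _) k))).
Proof.
elim=> *; [exact: polyV_cst|exact: polyV_coord|exact: polyV_add|exact: polyV_mul].
Qed.

Lemma chaos_poly_malliavin n q : chaos_poly T B n q ->
  exists DF D2F, malliavin22 P T B q DF D2F.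
Proof.
move=> [p [hp qE]].
pose r := (2 ^ n)%N.
(* The row has one coordinate more than the [2 ^ n] increments: [i %% r] fills it with the increment
   of index 0, and [f] ignores it. *)
pose W (i : 'I_r.+1) := xi T B n (i %% r).
pose phi (i : 'I_r.+1) := cell T n (i %% r).
pose f (x : 'rV[R]_r.+1) := p (fun k => x ord0 (widen_ord (leqnSn _) k)).
have hf : polyV f by exact: polyf_polyV.
have r0 : (0 < r)%N by rewrite expn_gt0.
have hW i : wiener_integral P T B (phi i) (W i) by apply: cell_wiener; rewrite ltn_pmod.
pose DF x w := \sum_i partials [:: i] f (\row_i W i w) * phi i x.
pose D2F x y w := \sum_i \sum_j partials [:: i; j] f (\row_i W i w) * phi i x * phi j y.
have sF : smooth_cylindrical P T B q DF D2F.
  exists r, phi, W, f; split=> //; first exact: polyV_smooth.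
  move=> w; rewrite qE /f; congr p; apply/funext => k.
  by rewrite mxE /W/= modn_small.
have mW i : measurable_fun setT (W i) by have [_ _ [m _] _] := hW i.
have mphi i : measurable_fun setT (phi i) by exact: (cell_L2 T_gt0 n (i %% r)).1.
have mpart s : measurable_fun setT (fun w => partials s f (\row_i W i w)).
  apply: measurable_rV => // x.
  exact: differentiable_continuous ((polyV_smooth hf s).1 x).
have mI : measurable (`[0, T]%classic : set (measurableTypeR R)) by exact: measurable_itv.
exists DF, D2F; split.
- by have [[m _] _ _] := smooth_ibp2 T_gt0 hB sF.
- apply: (@measurable_funS _ _ _ _ setT) => //.
  apply: measurable_sum => i; apply: measurable_funM.
    exact: (measurableT_comp (mpart [:: i]) measurable_snd).
  exact: (measurableT_comp (mphi i) measurable_fst).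
- apply: (@measurable_funS _ _ _ _ setT) => //.
  apply: measurable_sum => i; apply: measurable_sum => j; apply: measurable_funM; first apply: measurable_funM.
  + exact: (measurableT_comp (mpart [:: i; j]) measurable_snd).
  + exact: (measurableT_comp (mphi i) (measurableT_comp measurable_fst measurable_fst)).
  + exact: (measurableT_comp (mphi j) (measurableT_comp measurable_snd measurable_fst)).
exists (fun=> q), (fun=> DF), (fun=> D2F); split=> //.
- rewrite (_ : (fun n0 : nat => _) = fun=> 0%E); first exact: cvg_cst.
  by apply/funext => _; apply: integral0_eq => x _; rewrite subrr expr0n.
- rewrite (_ : (fun n0 : nat => _) = fun=> 0%E); first exact: cvg_cst.
  apply/funext => _; apply: integral0_eq => x _; apply: integral0_eq => y _.
  by rewrite subrr expr0n.
- rewrite (_ : (fun n0 : nat => _) = fun=> 0%E); first exact: cvg_cst.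
  apply/funext => _; apply: integral0_eq => x _; apply: integral0_eq => y _.
  by apply: integral0_eq => z _; rewrite subrr expr0n.
Qed.

End poly_smooth.

(** * The norm of H in terms of the kernel *)

Section norm_kernel.
Context (R : realType) (H T : R) d (S : measurableType d).
Variable m : {sigma_finite_measure set S -> \bar R}.
Local Notation leb := (@lebesgue_measure R).
Local Notation leb2 := (prodm leb leb).
Local Notation RR := (measurableTypeR R).
Local Notation I := (`[0, T]%classic : set (measurableTypeR R)).
Variable G : R -> S -> R.
Hypothesis mG : measurable_fun (I `*` setT) (fun q : RR * S => G q.1 q.2).

Lemma IK_sqr z : cut2 I (fun y1 y2 z => I_kernel H T (G ^~ z) y1 y2 ^+ 2)%E z = (IK H T G z ^+ 2)%E.
Proof.
by case: z => z [x y]; rewrite /IK !cut2E; case: ifP => // _; rewrite expe2 mule0.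
Qed.

Let IK2_meas : measurable_fun setT (fun p => IK H T G p ^+ 2)%E.
Proof.
rewrite (_ : (fun p => _) = (fun p => IK H T G p * IK H T G p)%E).
  by apply: emeasurable_funM; exact: IK_meas.
by apply/funext => p; rewrite expe2.
Qed.

Lemma IK_sqr_int :
  (\int[m]_z \int[leb]_(y1 in I) \int[leb]_(y2 in I) I_kernel H T (G ^~ z) y1 y2 ^+ 2 =
   \int[prodm m leb2]_p IK H T G p ^+ 2)%E.
Proof.
have e : cut2 I (fun y1 y2 z => I_kernel H T (G ^~ z) y1 y2 ^+ 2)%E = (fun p => IK H T G p ^+ 2)%E.
  by apply/funext => p; exact: IK_sqr.
rewrite -e cut2_int//; first by rewrite e; exact: IK2_meas.
by move=> x y z; exact: sqre_ge0.
Qed.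

Lemma normH2E z : normH2 H T (G ^~ z) = (2%:E * \int[leb2]_y IK H T G (z, y) ^+ 2)%E.
Proof.
rewrite /normH2; congr (_ * _)%E; rewrite prodm_tonelli; last 2 first.
- exact: (measurableT_comp IK2_meas (pair1_measurable z)).
- by move=> y; exact: sqre_ge0.
rewrite integral_mkcond; apply: eq_integral => x _; rewrite patchE.
case: ifPn => [xI|xI].
  rewrite integral_mkcond; apply: eq_integral => y _.
  by rewrite -IK_sqr cut2E patchE xI.
by rewrite integral0_eq// => y _; rewrite -IK_sqr cut2E (negbTE xI).
Qed.

Lemma normH2_meas : measurable_fun setT (fun z => normH2 H T (G ^~ z)).
Proof.
under eq_fun do rewrite normH2E.
apply: emeasurable_funM => //.
exact: (@measurable_integral_section _ _ _ _ _ leb2 (fun q => IK H T G q ^+ 2)%E IK2_meas).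
Qed.

Lemma normH2_int : (\int[m]_z normH2 H T (G ^~ z) =
  2%:E * \int[prodm m leb2]_p IK H T G p ^+ 2)%E.
Proof.
rewrite prodm_tonelli//; last by move=> p; exact: sqre_ge0.
under eq_integral do rewrite normH2E.
rewrite ge0_integralZl//.
- exact: (@measurable_integral_section _ _ _ _ _ leb2 (fun q => IK H T G q ^+ 2)%E IK2_meas).
- by move=> z _; apply: integral_ge0 => y _; exact: sqre_ge0.
Qed.

Hypothesis fin : (\int[m]_z normH2 H T (G ^~ z) < +oo)%E.

Lemma IK_fin : (\int[prodm m leb2]_p IK H T G p ^+ 2 < +oo)%E.
Proof.
rewrite ltNge leye_eq; apply/negP => /eqP e.
by move: fin; rewrite normH2_int e gt0_muley ?lte_fin// ltxx.
Qed.

(** An inequality, because [fine] replaces infinite values by 0; the factor 2 is that of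
    [normH2]. *)
Lemma IKr_L2 : L2 (prodm m leb2) (IKr H T G) /\
  ((2 * ip (prodm m leb2) (IKr H T G) (IKr H T G))%:E <= \int[m]_z normH2 H T (G ^~ z))%E.
Proof.
have mr : measurable_fun setT (IKr H T G).
  by apply: measurableT_comp; [exact: fine_measurable|exact: IK_meas].
have le : (\int[prodm m leb2]_p (IKr H T G p ^+ 2)%:E <= \int[prodm m leb2]_p IK H T G p ^+ 2)%E.
  apply: ge0_le_integral => //; try exact: IK2_meas.
  - by move=> p _; rewrite lee_fin sqr_ge0.
  - by apply/measurable_EFinP; exact: measurable_funX.
  - move=> p _; rewrite /IKr; case: (IK H T G p) => [r||] /=.
    + exact: lexx.
    + by rewrite expr0n leey.
    + by rewrite expr0n leey.
have L : L2 (prodm m leb2) (IKr H T G).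
  by apply/L2P; split => //; exact: le_lt_trans le IK_fin.
split=> //; rewrite normH2_int EFinM lee_pmul2l//.
by rewrite ip_EFin.
Qed.

Lemma IK_ae : {ae prodm m leb2, forall p, IK H T G p = (IKr H T G p)%:E}.
Proof.
have I2 : (prodm m leb2).-integrable setT (fun p => IK H T G p ^+ 2)%E.
  apply/integrableP; split=> //.
  have -> : (fun p => `|IK H T G p ^+ 2|)%E = (fun p => IK H T G p ^+ 2)%E.
    by apply/funext => p; rewrite gee0_abs// sqre_ge0.
  exact: IK_fin.
have := integrable_ae measurableT I2; apply: filterS => p /(_ Logic.I).
rewrite /IKr; case: (IK H T G p) => [r||]//=.
Qed.

End norm_kernel.

Lemma prodm_iterated d (S : measurableType d) (R : realType) d' (X : measurableType d')
    (m : {sigma_finite_measure set S -> \bar R}) (nu : {sigma_finite_measure set X -> \bar R})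
    (h : S * (X * X) -> \bar R) : (prodm m (prodm nu nu)).-integrable setT h ->
  (\int[prodm m (prodm nu nu)]_z h z = \int[m]_w \int[nu]_x \int[nu]_y h (w, (x, y)))%E.
Proof.
move=> Ih; have mh := measurable_int _ Ih.
rewrite prodm_fubini//; apply: ae_eq_integral => //.
- exact: measurable_integral_section.
- have m1 : measurable_fun setT (fun q : (S * X) * X => (q.1.1, (q.1.2, q.2))).
    apply: measurable_fun_pair; first exact: (measurableT_comp measurable_fst measurable_fst).
    by apply: measurable_fun_pair => //; exact: (measurableT_comp measurable_snd measurable_fst).
  have m2 := @measurable_integral_section _ _ _ _ _ nu _ (measurableT_comp mh m1).
  exact: (@measurable_integral_section _ _ _ _ _ nu _ m2).
- have := ae_integrable1 Ih; apply: filterS => w Iw _.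
  by rewrite prodm_fubini.
Qed.

(** The integral of a nonnegative function is a supremum over the simple functions below it, hence
    monotone for arbitrary functions. It is applied to [norm22_sq] as a function of time, for which
    no measurability is at hand. *)
Lemma ge0_le_integral_nonmeas d (S : measurableType d) (R : realType)
    (mu : {measure set S -> \bar R}) (f h : S -> \bar R) :
  (forall x, 0 <= f x)%E -> (forall x, f x <= h x)%E ->
  (\int[mu]_x f x <= \int[mu]_x h x)%E.
Proof.
move=> f0 fh; have h0 x : (0 <= h x)%E := le_trans (f0 x) (fh x).
rewrite !ge0_integralTE//; apply: le_ereal_sup => _ [k /= kf <-]; exists k => //= x.
exact: le_trans (kf x) (fh x).
Qed.

Lemma cutp_L2 (R : realType) (T : R) d (S : measurableType d)
    (m : {sigma_finite_measure set S -> \bar R}) (G : R -> S -> R) (N : R -> \bar R) :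
  measurable_fun ((`[0, T]%classic : set (measurableTypeR R)) `*` setT)
    (fun q : measurableTypeR R * S => G q.1 q.2) ->
  (forall s, 0 <= N s)%E ->
  (\int[@lebesgue_measure R]_(s in `[0%R, T]) N s < +oo)%E ->
  (forall s, s \in (`[0, T]%classic : set (measurableTypeR R)) ->
    (\int[m]_z (cutp T G (s, z) ^+ 2)%:E <= N s)%E) ->
  L2 (prodm (@lebesgue_measure R) m) (cutp T G).
Proof.
move=> mG N0 fin hN; have mc := cutp_meas mG.
apply/L2P; split=> //; rewrite prodm_tonelli; last 2 first.
- by apply/measurable_EFinP; exact: measurable_funX.
- by move=> z; rewrite lee_fin sqr_ge0.
apply: le_lt_trans fin; rewrite [leRHS]integral_mkcond.
apply: ge0_le_integral_nonmeas => s.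
  by apply: integral_ge0 => z _; rewrite lee_fin sqr_ge0.
rewrite patchE; case: ifPn => sI; first exact: hN.
by rewrite integral0_eq// => z _; rewrite cutpE (negbTE sI) expr0n.
Qed.

(** * The Skorohod integral: existence and norm bound *)

Section skorohod.
Context (R : realType) (d : measure_display) (Om : measurableType d) (P : probability Om R).
Variables (H T : R) (B : R -> Om -> R).
Hypothesis H_gt : 2^-1 < H.
Hypothesis H_lt : H < 1.
Hypothesis T_gt0 : 0 < T.
Hypothesis hB : brownian_motion P T B.
Local Notation leb := (@lebesgue_measure R).
Local Notation leb2 := (prodm leb leb).
Local Notation mu2 := (prodm P leb2).
Local Notation mu4 := (prodm mu2 leb2).
Local Notation RR := (measurableTypeR R).
Local Notation I := (`[0, T]%classic : set (measurableTypeR R)).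

Section integrand.
Variables (g : R -> Om -> R) (Dg : R -> R -> Om -> R) (D2g : R -> R -> R -> Om -> R).
Hypothesis hg : L2H P H T g.
Hypothesis hg22 : L22 P T B g Dg D2g.
Hypothesis fin2 : (\int[P]_w \int[lebesgue_measure]_(x1 in `[0%R, T])
       \int[lebesgue_measure]_(x2 in `[0%R, T])
         normH2 H T (fun s => D2g s x1 x2 w) < +oo)%E.

(** The second derivative as a process in [s] over the enlarged space, the form in which the kernel
    operator applies to it. *)
Definition D2cut (s : R) : Om * (RR * RR) -> R := cut2 I (D2g s).

Local Notation u := (IKr H T g).
Local Notation u4 := (IKr H T D2cut).

Lemma g_meas : measurable_fun (I `*` setT) (fun q : RR * Om => g q.1 q.2).
Proof. exact: hg.1. Qed.

Lemma D2cut_meas : measurable_fun (I `*` setT) (fun q : RR * (Om * (RR * RR)) => D2cut q.1 q.2).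
Proof.
have mI : measurable I by exact: measurable_itv.
have [_ _ m2 _ _] := hg22.
pose h (q : RR * (Om * (RR * RR))) := D2g q.1 q.2.2.1 q.2.2.2 q.2.1.
pose D := [set: RR] `*` @box d Om _ RR I.
have mD : measurable D by apply: measurableX => //; exact: box_meas.
rewrite (_ : (fun q => _) = h \_ D); last first.
  apply/funext => -[s [w [x y]]]; rewrite /D2cut cut2E patchE.
  rewrite (_ : (_ \in D) = (x \in I) && (y \in I))//.
  by apply/idP/andP; rewrite !inE => -[]//= _ [].
have mE : measurable (I `*` [set: Om * (RR * RR)]) by exact: measurableX.
apply/(measurable_restrict h mD mE).
apply: (measurable_comp (F := I `*` I `*` I `*` setT)
  (f := fun z : RR * RR * RR * Om => D2g z.1.1.1 z.1.1.2 z.1.2 z.2)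
  (g := fun q : RR * (Om * (RR * RR)) => (q.1, q.2.2.1, q.2.2.2, q.2.1))) => //.
- by do 3 (apply: measurableX => //).
- by move=> _ [[s [w [x y]]] /= [[h1 _] [_ [_ [h2 h3]]]] <-].
- apply: (@measurable_funS _ _ _ _ setT) => //.
  have m22 : measurable_fun setT (fun q : RR * (Om * (RR * RR)) => q.2.2).
    exact: (measurableT_comp measurable_snd measurable_snd).
  apply: measurable_fun_pair; last exact: (measurableT_comp measurable_fst measurable_snd).
  apply: measurable_fun_pair; last exact: (measurableT_comp measurable_snd m22).
  apply: measurable_fun_pair; first exact: measurable_fst.
  exact: (measurableT_comp measurable_fst m22).
Qed.

Lemma norm22_ge0 s : (0 <= norm22_sq P T (g s) (Dg s) (D2g s))%E.
Proof.
rewrite /norm22_sq; apply: adde_ge0; first apply: adde_ge0; apply: integral_ge0 => w _.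
- by rewrite lee_fin sqr_ge0.
- by apply: integral_ge0 => x _; rewrite lee_fin sqr_ge0.
- by apply: integral_ge0 => x _; apply: integral_ge0 => y _; rewrite lee_fin sqr_ge0.
Qed.

Lemma sqr_int_g (s : R) : s \in I ->
  (\int[P]_w ((cutp T g (s, w)) ^+ 2)%:E <= norm22_sq P T (g s) (Dg s) (D2g s))%E.
Proof.
move=> sI; under eq_integral do rewrite cutpE sI.
rewrite /norm22_sq -addeA leeDl// adde_ge0//.
  by apply: integral_ge0 => w _; apply: integral_ge0 => x _; rewrite lee_fin sqr_ge0.
apply: integral_ge0 => w _; apply: integral_ge0 => x _; apply: integral_ge0 => y _.
by rewrite lee_fin sqr_ge0.
Qed.

Lemma g_L2 : L2 (prodm leb P) (cutp T g).
Proof.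
have [_ _ _ _ fin] := hg22.
apply: (cutp_L2 g_meas _ fin) => s; first exact: norm22_ge0.
exact: sqr_int_g.
Qed.

Lemma D2cut_L2 : L2 (prodm leb mu2) (cutp T D2cut).
Proof.
have [_ _ _ _ fin] := hg22.
apply: (cutp_L2 D2cut_meas _ fin) => s; first exact: norm22_ge0.
move=> sI; have e : (fun z => cutp T D2cut (s, z)) = cut2 I (D2g s).
  by apply/funext => z; rewrite cutpE sI.
have m1 : measurable_fun setT (cut2 I (D2g s)).
  by rewrite -e; exact: (measurableT_comp (cutp_meas D2cut_meas) (pair1_measurable s)).
have e2 : (fun z => (cutp T D2cut (s, z) ^+ 2)%:E) = cut2 I (fun x y w => (D2g s x y w ^+ 2)%:E).
  apply/funext => -[w [x y]]; rewrite cutpE sI /D2cut !cut2E; case: ifP => // _.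
  by rewrite expr0n.
have e3 : (\int[P]_w \int[leb]_(x in I) \int[leb]_(y in I) (D2g s x y w ^+ 2)%:E =
    \int[mu2]_z cut2 I (fun x y w => (D2g s x y w ^+ 2)%:E) z)%E.
  apply: cut2_int => //.
    by rewrite -e2; apply/measurable_EFinP; apply: measurable_funX; rewrite e.
  by move=> x y w; rewrite lee_fin sqr_ge0.
rewrite e2 -e3 /norm22_sq leeDr//; apply: adde_ge0; apply: integral_ge0 => w _.
  by rewrite lee_fin sqr_ge0.
by apply: integral_ge0 => x _; rewrite lee_fin sqr_ge0.
Qed.

Lemma u_L2 : L2 mu2 u /\ ((2 * ip mu2 u u)%:E <= \int[P]_w normH2 H T (g ^~ w))%E.
Proof. exact: (IKr_L2 g_meas hg.2). Qed.

Lemma normH2_D2cut : (\int[P]_w \int[leb]_(x1 in I) \int[leb]_(x2 in I)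
    normH2 H T (fun s => D2g s x1 x2 w) = \int[mu2]_z normH2 H T (D2cut ^~ z))%E.
Proof.
have e : cut2 I (fun x1 x2 w => normH2 H T (fun s => D2g s x1 x2 w)) = (fun z => normH2 H T (D2cut ^~ z)).
  apply/funext => -[w [x y]]; rewrite cut2E; case: ifPn => xy.
    congr normH2; apply/funext => s; by rewrite /D2cut cut2E xy.
  rewrite /normH2 [X in (_ * X)%E]integral0_eq ?mule0// => y1 _; apply: integral0_eq => y2 _.
  rewrite /I_kernel [X in (_ * X)%E]integral0_eq ?mule0 ?expe2 ?mule0// => s _.
  by rewrite /D2cut cut2E (negbTE xy) !mul0r.
rewrite -e cut2_int//.
  by rewrite e; exact: (normH2_meas H D2cut_meas).
move=> x1 x2 w; rewrite /normH2 mule_ge0//; apply: integral_ge0 => y1 _; apply: integral_ge0 => y2 _.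
exact: sqre_ge0.
Qed.

Lemma u4_L2 : L2 mu4 u4 /\ ((2 * ip mu4 u4 u4)%:E <=
  \int[P]_w \int[leb]_(x1 in I) \int[leb]_(x2 in I) normH2 H T (fun s => D2g s x1 x2 w))%E.
Proof.
have fin : (\int[mu2]_z normH2 H T (D2cut ^~ z) < +oo)%E by rewrite -normH2_D2cut.
by rewrite normH2_D2cut; exact: (IKr_L2 D2cut_meas fin).
Qed.

(** For almost every [s] this is [ibp2] for [g s], and [kernel_transfer] integrates it against the
    kernel; the test functions in [y] are products of two cells, hence bounded by the inverse of the
    mesh. *)
Lemma hu_kernel n (al : mindex (2 ^ n)) (k l i j : 'I_(2 ^ n)) :
  Num.sqrt (al k).+1%:R * Num.sqrt (mincr al k l).+1%:R *
    ip mu2 (basis2 T B (mincr (mincr al k) l) i j) u =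
  ip mu4 (tensor (basis2 T B al k l) (tensor (cell T n i) (cell T n j))) u4.
Proof.
have Lk q : L2 leb (cell T n q) by exact: cell_L2.
have s0 : 0 < Num.sqrt (mesh T n) by rewrite sqrtr_gt0 mesh_gt0.
have cb q x : `|cell T n q x| <= (Num.sqrt (mesh T n))^-1.
  have i0 : 0 <= (Num.sqrt (mesh T n))^-1 by rewrite invr_ge0 ltW.
  rewrite /cell normrM (ger0_norm i0) ler_piMl//.
  by rewrite indicE; case: (_ \in _); rewrite ?normr1 ?normr0.
apply: (@kernel_transfer R H T H_gt H_lt T_gt0 _ _ P _ _ mu2 g D2cut
  (fun w => hermv (mincr (mincr al k) l) (xiv T B n w)) (basis2 T B al k l)
  (tensor (cell T n i) (cell T n j)) ((Num.sqrt (mesh T n))^-1 * (Num.sqrt (mesh T n))^-1)).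
- exact: g_meas.
- exact: g_L2.
- exact: D2cut_meas.
- exact: D2cut_L2.
- exact: hermv_L2.
- exact: basis2_L2.
- exact: tensor_L2.
- by move=> y; rewrite /tensor normrM ler_pM.
- exact: u_L2.1.
- exact: u4_L2.1.
have [_ _ _ hm _] := hg22; apply: negligibleS hm => s /= nQ hm; apply: nQ.
have [sI|sI] := boolP (s \in I); last first.
  rewrite /ip (_ : (\int[P]_w _) = 0); last first.
    by under eq_Rintegral do rewrite cutpE (negbTE sI) mulr0; rewrite Rint0.
  rewrite mulr0 (_ : (\int[mu2]_w _) = 0)//.
  by under eq_Rintegral do rewrite cutpE (negbTE sI) mulr0; rewrite Rint0.
have [|_ _ h] := malliavin22_ibp2 T_gt0 hB (hm _).
  by move: sI; rewrite mem_setE in_itv.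
rewrite -mulrA.
rewrite (_ : (fun w => cutp T g (s, w)) = g s); last by apply/funext => w; rewrite cutpE sI.
rewrite (_ : (fun w => cutp T D2cut (s, w)) = cut2 I (D2g s)); last first.
  by apply/funext => w; rewrite cutpE sI.
exact: h.
Qed.

Definition K2 : R := 6 * (ip mu2 u u + ip mu4 u4 u4).

Lemma K2_ge0 : 0 <= K2.
Proof. by rewrite mulr_ge0// addr_ge0// ip_ge0. Qed.

Lemma malliavin_bound F DF D2F : malliavin22 P T B F DF D2F ->
  ip mu2 (cut2 I D2F) u ^+ 2 <= K2 * ip P F F.
Proof.
move=> hF; have [LF LD hFV] := malliavin22_ibp2 T_gt0 hB hF.
have [_ cD] := malliavin22_clos T_gt0 hB hF.
exact: (duality_bound T_gt0 hB u_L2.1 u4_L2.1 hu_kernel LF cD hFV).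
Qed.

(** Bridges the iterated integral of extended reals in [delta2] and the real inner product: the
    kernel is finite almost everywhere and the product is integrable. *)
Lemma dual_integral F DF D2F : malliavin22 P T B F DF D2F ->
  (\int[P]_w \int[leb]_(x in I) \int[leb]_(y in I)
     ((D2F x y w)%:E * I_kernel H T (g ^~ w) x y) = (ip mu2 (cut2 I D2F) u)%:E)%E.
Proof.
move=> hF; have [LF LD _] := malliavin22_ibp2 T_gt0 hB hF.
have Lu := u_L2.1.
pose h z := ((cut2 I D2F z)%:E * IK H T g z)%E.
have mh : measurable_fun setT h.
  by apply: emeasurable_funM; [apply/measurable_EFinP; exact: LD.1|exact: (IK_meas H g_meas)].
have hae : ae_eq mu2 setT h (EFin \o (fun z => cut2 I D2F z * u z)).
  by have := IK_ae g_meas hg.2; apply: filterS => z e _; rewrite /h e.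
have Ih : mu2.-integrable setT h.
  have /integrableP[mP fP] := L2M LD Lu.
  apply/integrableP; split=> //; apply: le_lt_trans fP; rewrite le_eqVlt; apply/orP; left.
  apply/eqP; apply: ae_eq_integral => //; [exact: measurableT_comp|exact: measurableT_comp|].
  by move: hae; apply: filterS => z e _; rewrite e.
rewrite /ip EFin_Rint; last exact: L2M.
have <- : (\int[mu2]_z h z = \int[mu2]_z (cut2 I D2F z * u z)%:E)%E.
  by apply: ae_eq_integral => //; exact: (measurable_int _ (L2M LD Lu)).
rewrite (prodm_iterated Ih); apply: eq_integral => w _.
rewrite integral_mkcond; apply: eq_integral => x _; rewrite patchE; case: ifPn => xI; last first.
  by rewrite integral0_eq// => y _; rewrite /h cut2E (negbTE xI) mul0e.
rewrite integral_mkcond; apply: eq_integral => y _.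
rewrite patchE /h /IK !cut2E xI/=; case: ifP => // _.
by rewrite mul0e.
Qed.

Lemma skorohod_exists : exists X, [/\ L2 P X, clP P T B X &
  forall F DF D2F, malliavin22 P T B F DF D2F -> ip P F X = ip mu2 (cut2 I D2F) u].
Proof.
(* The domain is described through [clos] and [ibp2], linear conditions on [F] and [V]; a sum of two
   elements of [malliavin22] would require merging their families of Wiener integrals. Any such [V]
   may supply [c], and the bound [Db] makes the value unique. *)
pose D F c := clP P T B F /\ exists V, [/\ clos mu2 (@steps R d Om T B) V, ibp2 P T B F V & c = ip mu2 V u].
have Lu := u_L2.1.
have sL2 n q : @steps R d Om T B n q -> L2 mu2 q by exact: steps_L2.
have cL2 n q : chaos_poly T B n q -> L2 P q by exact: chaos_poly_L2.
have Lh n (al : mindex (2 ^ n)) : L2 P (fun w => hermv al (xiv T B n w)) by exact: hermv_L2.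
have Lb n (al : mindex (2 ^ n)) k l : L2 mu2 (basis2 T B al k l) by exact: basis2_L2.
have DZ k F c : D F c -> D (fun x => k * F x) (k * c).
  move=> [cF [V [cV hV ->]]]; split; first exact: (clos_scale cL2 (@chaos_poly_scale _ _ _ _ _) k cF).
  exists (fun z => k * V z); split; first exact: (clos_scale (mu := mu2) sL2 (@steps_scale _ _ _ _ _) k cV).
    by move=> n al i l; rewrite !ipZr -?hV; [ring|exact: cV.1|exact: Lb|exact: cF.1|exact: Lh].
  by rewrite ipZl//; exact: cV.1.
have DL2 F c : D F c -> L2 P F by move=> [[]].
have Dadd F G c e : D F c -> D G e -> D (fun x => F x + G x) (c + e).
  move=> [cF [V [cV hV ->]]] [cG [W [cW hW ->]]]; split.
    exact: (clos_add cL2 (@chaos_poly_add _ _ _ _ _) cF cG).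
  exists (fun z => V z + W z); split.
  - exact: (clos_add (mu := mu2) sL2 (@steps_add _ _ _ _ _) cV cW).
  - move=> n al i l; rewrite (ipDr cF.1 cG.1 (Lh _ _)) (ipDr cV.1 cW.1 (Lb _ _ _ _)) -hV -hW; ring.
  - by rewrite (ipDl cV.1 cW.1 Lu).
have DM F DF D2F : malliavin22 P T B F DF D2F -> D F (ip mu2 (cut2 I D2F) u).
  move=> hF; have [cF cD] := malliavin22_clos T_gt0 hB hF.
  by split=> //; exists (cut2 I D2F); split=> //; have [] := malliavin22_ibp2 T_gt0 hB hF.
have D0 : D (fun=> 0) 0.
  have h1 : chaos_poly T B 0%N (fun=> 1) by exists (fun=> 1); split=> //; exact: polyf_cst.
  have [DF [D2F hM]] := chaos_poly_malliavin T_gt0 hB h1.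
  have h : D (fun=> 0 * 1) (0 * ip mu2 (cut2 I D2F) u) := DZ 0 _ _ (DM _ _ _ hM).
  by rewrite !mul0r in h.
have Db F c : D F c -> c ^+ 2 <= K2 * ip P F F.
  move=> [cF [V [cV hV ->]]].
  exact: (duality_bound T_gt0 hB u_L2.1 u4_L2.1 hu_kernel cF.1 cV hV).
have [X [LX hX aX]] := riesz DL2 Dadd DZ D0 K2_ge0 Db.
exists X; split=> //; last by move=> F DF D2F hF; apply: hX; exact: DM hF.
(* The representative is a limit of elements of the domain, hence in the closure of the polynomials;
   its measurability will follow from this. *)
apply: (clos_lim cL2 LX) => e e0; have [F [c [[cF _] le]]] := aX _ e0.
by exists F.
Qed.



(** Polynomials [p] close to [X] are test variables, so duality gives [ip P p X <= k |p|] with [k]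
    the square root of [K2]; letting [p] tend to [X] yields [|X|^2 <= k |X|]. *)
Lemma skorohod_bound X : clP P T B X ->
  (forall F DF D2F, malliavin22 P T B F DF D2F -> ip P F X = ip mu2 (cut2 I D2F) u) ->
  ip P X X <= K2.
Proof.
move=> [LX aX] hX; set x := Num.sqrt (ip P X X); set k := Num.sqrt K2.
have x0 : 0 <= x by exact: sqrtr_ge0.
have k0 : 0 <= k by exact: sqrtr_ge0.
have xE : ip P X X = x ^+ 2 by rewrite sqr_sqrtr// ip_ge0.
have kE : K2 = k ^+ 2 by rewrite sqr_sqrtr// K2_ge0.
have key e : 0 < e -> x ^+ 2 <= k * x + e * (k + x).
  move=> e0; have e20 : 0 < e ^+ 2 by rewrite exprn_gt0.
  have [n /(_ n (leqnn n))[p [hp le]]] := aX _ e20.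
  have Lp : L2 P p by exact: (chaos_poly_L2 T_gt0 hB hp).
  have LD := L2B LX Lp.
  have [DF [D2F hM]] := chaos_poly_malliavin T_gt0 hB hp.
  have sq e' f : 0 <= e' -> ip P f f <= e' ^+ 2 -> Num.sqrt (ip P f f) <= e'.
    move=> e'0 /ler_wsqrtr; by rewrite sqrtr_sqr ger0_norm.
  have De := sq _ _ (ltW e0) le.
  have pn : Num.sqrt (ip P p p) <= x + e.
    have := ip_tri LX (L2N LD).
    rewrite (_ : (fun w => X w + - (X w - p w)) = p); last by apply/funext => w; ring.
    rewrite (_ : ip P (fun w => - (X w - p w)) (fun w => - (X w - p w)) = ip P (fun w => X w - p w) (fun w => X w - p w)).
      move=> h; apply: (le_trans h); rewrite lerD2l; exact: De.
    by rewrite !ipE; apply: eq_Rintegral => w _; rewrite sqrrN.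
  have b1 : ip P p X <= k * (x + e).
    rewrite (hX _ _ _ hM) (le_trans (ler_norm _))// -sqrtr_sqr.
    apply: (le_trans (ler_wsqrtr (malliavin_bound hM))).
    by rewrite sqrtrM ?K2_ge0// ler_wpM2l.
  have b2 : ip P (fun w => X w - p w) X <= e * x.
    rewrite (le_trans (ler_norm _))// (le_trans (ip_CS_abs LD LX))//.
    by rewrite ler_wpM2r.
  have -> : x ^+ 2 = ip P p X + ip P (fun w => X w - p w) X.
    by rewrite -xE ipBl// addrC subrK.
  have := lerD b1 b2; lra.
have lim : x ^+ 2 <= k * x.
  apply/ler_addgt0Pl => e e0; have s1 : 0 < k + x + 1 by lra.
  have := key (e / (k + x + 1)) (divr_gt0 e0 s1); move/le_trans; apply.
  rewrite addrC lerD2r mulrAC ler_pdivrMr//; have := mulr_ge0 (ltW e0) (addr_ge0 k0 x0); lra.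
have xk : x <= k.
  move: x0; rewrite le_eqVlt => /predU1P[<-//|x0].
  by move: lim; rewrite expr2 ler_pM2r.
by rewrite xE kE lerXn2r ?nnegrE.
Qed.

End integrand.
End skorohod.

Theorem lemma1 (R : realType) (d : measure_display) (Omega : measurableType d)
    (P : probability Omega R) (H T : R) (B Z : R -> Omega -> R)
    (H_gt : 2^-1 < H) (H_lt : H < 1) (T_gt0 : 0 < T)
    (hB : brownian_motion P T B) (hZ : rosenblatt_process P H T B Z) :
  exists C : R,
    forall (g : R -> Omega -> R) (Dg : R -> R -> Omega -> R)
      (D2g : R -> R -> R -> Omega -> R),
    L2H P H T g ->
    L22 P T B g Dg D2g ->
    (\int[P]_w \int[lebesgue_measure]_(x1 in `[0%R, T])
       \int[lebesgue_measure]_(x2 in `[0%R, T])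
         normH2 H T (fun s => D2g s x1 x2 w) < +oo)%E ->
    skorohod_integrable_Z P H T B g /\
    forall X : Omega -> R, skorohod_integral_Z P H T B g X ->
      (\int[P]_w (`|X w| ^+ 2)%:E <=
       C%:E * (\int[P]_w normH2 H T (fun s => g s w) +
               \int[P]_w \int[lebesgue_measure]_(x1 in `[0%R, T])
                 \int[lebesgue_measure]_(x2 in `[0%R, T])
                   normH2 H T (fun s => D2g s x1 x2 w)))%E.
Proof.
exists 3 => g Dg D2g hg hg22 fin2.
pose u := IKr H T g.
have mg := g_meas hg.
have mI : measurable (`[0, T]%classic : set (measurableTypeR R)) by exact: measurable_itv.
split.
  have [X [LX cX hX]] := skorohod_exists H_gt H_lt T_gt0 hB hg hg22 fin2.
  exists X; split; first exact: hg.1.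
    have Lg := g_L2 hg hg22.
    have := ((L2P _ _).1 Lg).2; rewrite prodm_tonelli2; last 2 first.
    - by apply/measurable_EFinP; apply: measurable_funX; exact: Lg.1.
    - by move=> z; rewrite lee_fin sqr_ge0.
    apply: le_lt_trans; rewrite le_eqVlt; apply/orP; left; apply/eqP.
    apply: eq_integral => w _; rewrite integral_mkcond; apply: eq_integral => s _.
    by rewrite patchE cutpE; case: ifP => // _; rewrite expr0n.
  split.
  - have mIK := IK_meas H mg.
    have m1 : measurable_fun setT (fun z : measurableTypeR R * measurableTypeR R * Omega => IK H T g (z.2, z.1)).
      by apply: (measurableT_comp mIK); apply: measurable_fun_pair.
    have m2 := @measurable_funS _ _ _ _ setT (`[0, T]%classic `*` `[0, T]%classic `*` setT) _ measurableT (@subsetT _ _) m1.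
    apply: (eq_measurable_fun _ _ m2) => -[[x y] w]; rewrite inE => -[[/= xI yI] _].
    by rewrite /IK cut2E !mem_set.
  - rewrite (IK_sqr_int H P mg).
    exact: (IK_fin mg hg.2).
  - exact/L2P.
  - have [X' [h1 h2]] := clP_brownian T_gt0 hB cX; by exists X'.
  - move=> F DF D2F hF; rewrite (dual_integral T_gt0 hB hg hF).
    have [LF _ _] := malliavin22_ibp2 T_gt0 hB hF.
    by rewrite -(hX _ _ _ hF) /ip EFin_Rint//; exact: L2M.
move=> X [_ _ [_ _ sX [X' [h1 h2]] hX]].
have LX : L2 P X by exact/L2P.
(* Here [X] is any admissible value, not the one constructed above, so its place in the closure has
   to come from the measurability clause. *)
have cX := brownian_clP T_gt0 hB LX h1 h2.
have hX2 F DF D2F : malliavin22 P T B F DF D2F -> ip P F X = ip (prodm P (prodm lebesgue_measure lebesgue_measure)) (cut2 (`[0, T]%classic : set (measurableTypeR R)) D2F) u.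
  move=> hF; have [LF _ _] := malliavin22_ibp2 T_gt0 hB hF.
  apply: EFin_inj; rewrite -(dual_integral T_gt0 hB hg hF) -(hX _ _ _ hF).
  by rewrite /ip EFin_Rint//; exact: L2M.
have bX := skorohod_bound H_gt H_lt T_gt0 hB hg hg22 fin2 cX hX2.
have [_ e1] := u_L2 hg.
have [_ e2] := u4_L2 hg22 fin2.
under eq_integral do rewrite real_normK ?num_real//.
rewrite -ip_EFin//; apply: (@le_trans _ _ (K2 P H T g D2g)%:E); first by rewrite lee_fin.
move: e1 e2; rewrite /K2; move: (ip _ (IKr H T g) _) (ip _ (IKr H T (D2cut T D2g)) _) => a b e1 e2.
rewrite (_ : 6 * (a + b) = 3 * (2 * a + 2 * b)); last by ring.
by rewrite EFinM lee_pmul2l// EFinD leeD.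
Qed.
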